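(* Let $\Bbbk$ be an algebraically closed field of characteristic zero and let $n\ge1$. Let $\overline Q$ be the quiver with vertices $0,\dots,n-1$ and arrows $u_i:i\to i+1$, $d_i:i+1\to i$ (indices modulo $n$). Let $\mathcal D$ be the quotient of $\Bbbk\overline Q$ by the relations, for all $i\in\mathbb Z/n$, $$d_id_{i-1}u_{i-1}=-u_{i+1}d_{i+1}d_i,$$ $$d_iu_iu_{i+1}u_{i+2}=u_{i+1}d_{i+1}u_{i+1}u_{i+2}-u_{i+1}u_{i+2}d_{i+2}u_{i+2}+u_{i+1}u_{i+2}u_{i+3}d_{i+3}.$$ Then $\mathcal D$ is twisted graded Calabi--Yau of dimension four.
   Context: Path algebras: paths composed left to right ($pq$ is nonzero only if the target of $p$ is the source of $q$); grading by path length. Twisted Calabi--Yau: with $A^e=A\otimes_\Bbbk A^{\mathrm{op}}$, an algebra $A$ is homologically smooth if $A$ has a finite length resolution by finitely generated projective $A^e$-modules; it is twisted Calabi--Yau of dimension $d$ if moreover there is an invertible $(A,A)$-bimodule $U$ with $\mathrm{Ext}^i_{A^e}(A,A^e)\cong U$ for $i=d$ and $0$ for $i\ne d$, as right $A^e$-modules. ''Twisted graded Calabi--Yau'' is the graded version of this; for a graded algebra it is equivalent to being twisted Calabi--Yau. *)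

(* Defs.v *)
From HB Require Import structures.
From mathcomp Require Import all_boot all_order all_algebra.
From mathcomp Require Import boolp.
From mathcomp Require Import finmap monalg.

Set Implicit Arguments.
Unset Strict Implicit.
Unset Printing Implicit Defensive.

Import GRing.Theory.
Local Open Scope ring_scope.
Local Open Scope quotient_scope.

(* Associative unital k-algebras in which 1 = 0 is allowed, so that every      *)
(* quotient by an ideal is one; the library's [algType] excludes the zero     *)
(* ring, and its scaling cannot be joined with rings that may be zero.        *)
HB.mixin Record isPzAlgebra (k : pzRingType) A of GRing.PzRing A := {
  kscale : k -> A -> A;
  kscaleA : forall a b x, kscale a (kscale b x) = kscale (a * b) x;
  kscale1 : left_id 1 kscale;
  kscaleDr : right_distributive kscale +%R;
  kscaleDl : forall x, {morph kscale^~ x : a b / a + b};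
  kscaleAl : forall c x y, kscale c (x * y) = kscale c x * y;
  kscaleAr : forall c x y, kscale c (x * y) = x * kscale c y
}.
#[short(type="pzAlgType")]
HB.structure Definition PzAlgebra (k : pzRingType) :=
  {A of GRing.PzRing A & isPzAlgebra k A}.

Section LinearExtension.

Variables (k : fieldType) (K : choiceType).

Definition plin (V : lmodType k) (g : K -> V) (x : {malg k[K]}) : V :=
  \sum_(p <- msupp x) x@_p *: g p.

Section Linear.
Variables (V : lmodType k) (g : K -> V).

Lemma plinEw (x : {malg k[K]}) (d : {fset K}) : (msupp x `<=` d)%fset ->
  plin g x = \sum_(p <- d) x@_p *: g p.
Proof.
move=> le; rewrite /plin (big_fset_incl _ le) // => p _ /mcoeff_outdom ->.
by rewrite scale0r.
Qed.

Lemma plinD x y : plin g (x + y) = plin g x + plin g y.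
Proof.
rewrite (@plinEw (x + y) (msupp x `|` msupp y)%fset) ?msuppD_le //.
rewrite (@plinEw x (msupp x `|` msupp y)%fset) ?fsubsetUl //.
rewrite (@plinEw y (msupp x `|` msupp y)%fset) ?fsubsetUr // -big_split /=.
by apply: eq_bigr => p _; rewrite mcoeffD scalerDl.
Qed.

Lemma plinZ c x : plin g (c *: x) = c *: plin g x.
Proof.
rewrite (@plinEw (c *: x) (msupp x)) ?msuppZ_le // /plin scaler_sumr.
by apply: eq_bigr => p _; rewrite mcoeffZ scalerA.
Qed.

Lemma plin0 : plin g 0 = 0.
Proof. by rewrite -(scale0r 0) plinZ scale0r. Qed.

Lemma plinU p : plin g << p >> = g p.
Proof.
rewrite (@plinEw _ [fset p]%fset) ?msuppU_le // big_seq_fset1.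
by rewrite mcoeffUU scale1r.
Qed.

Lemma plin_sum I (r : seq I) (F : I -> {malg k[K]}) :
  plin g (\sum_(i <- r) F i) = \sum_(i <- r) plin g (F i).
Proof.
by elim: r => [|i r IHr]; rewrite ?big_nil ?plin0 // !big_cons plinD IHr.
Qed.

End Linear.

Lemma plin_ext (V : lmodType k) (g h : K -> V) x :
  g =1 h -> plin g x = plin h x.
Proof. by move=> gh; apply: eq_bigr => p _; rewrite gh. Qed.

Lemma plin_addf (V : lmodType k) (g h : K -> V) x :
  plin (fun p => g p + h p) x = plin g x + plin h x.
Proof. by rewrite -big_split; apply: eq_bigr => p _; rewrite scalerDr. Qed.

Lemma plin_scalef (V : lmodType k) c (g : K -> V) x :
  plin (fun p => c *: g p) x = c *: plin g x.
Proof.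
by rewrite scaler_sumr; apply: eq_bigr => p _; rewrite !scalerA mulrC.
Qed.

Lemma malgUZ (c : k) (p : K) : << c *g p >> = c *: << p >> :> {malg k[K]}.
Proof. by apply/malgP => q; rewrite mcoeffZ !mcoeffU mulrnAr mulr1. Qed.

Lemma malg_ind (P : {malg k[K]} -> Prop) :
  P 0 -> (forall x y, P x -> P y -> P (x + y)) ->
  (forall c x, P x -> P (c *: x)) -> (forall p, P << p >>) -> forall x, P x.
Proof.
move=> P0 PD PZ PU x; rewrite [x]monalgE.
elim: (enum_fset _) => [|p s IHs]; rewrite ?big_nil // big_cons.
by apply: PD IHs; rewrite malgUZ; apply: PZ.
Qed.

End LinearExtension.

Section PathAlgebra.

Record quiver := Quiver {
  vertex : finType;
  arrow : finType;
  source : arrow -> vertex;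
  target : arrow -> vertex }.

Variables (k : fieldType) (Q : quiver).

Fixpoint walk (v : vertex Q) (s : seq (arrow Q)) : bool :=
  if s is a :: s' then (source a == v) && walk (target a) s' else true.

Fixpoint walk_end (v : vertex Q) (s : seq (arrow Q)) : vertex Q :=
  if s is a :: s' then walk_end (target a) s' else v.

(* A path is its starting vertex together with its list of arrows.            *)
Definition qpath := {p : vertex Q * seq (arrow Q) | walk p.1 p.2}.
HB.instance Definition _ := SubChoice.on qpath.

Definition pstart (p : qpath) : vertex Q := (val p).1.
Definition pend (p : qpath) : vertex Q := walk_end (val p).1 (val p).2.
Definition plength (p : qpath) : nat := size (val p).2.

Definition vpath (v : vertex Q) : qpath := exist _ (v, [::]) isT.

Lemma apath_subproof (a : arrow Q) : walk (source a) [:: a].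
Proof. by rewrite /= eqxx. Qed.
Definition apath (a : arrow Q) : qpath :=
  exist _ (source a, [:: a]) (apath_subproof a).

Lemma walk_cat v s t : walk v (s ++ t) = walk v s && walk (walk_end v s) t.
Proof. by elim: s v => //= a s IHs v; rewrite IHs andbA. Qed.

Lemma walk_end_cat v s t : walk_end v (s ++ t) = walk_end (walk_end v s) t.
Proof. by elim: s v => //=. Qed.

Definition pcat (p q : qpath) : option qpath :=
  if pend p == pstart q then
    (insub (pstart p, (val p).2 ++ (val q).2) : option qpath)
  else None.

Lemma pcat_Some p q : pend p == pstart q ->
  exists2 r, pcat p q = Some r & val r = (pstart p, (val p).2 ++ (val q).2).
Proof.
move=> Epq; rewrite /pcat Epq; case: insubP => [r _ Er|]; first by exists r.
rewrite /= walk_cat (valP p) /= -/(pend p) (eqP Epq).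
by rewrite (valP q).
Qed.

Lemma pcat_None p q : pend p != pstart q -> pcat p q = None.
Proof. by rewrite /pcat => /negPf->. Qed.

Definition pathalg := {malg k[qpath]}.
HB.instance Definition _ := GRing.Lmodule.on pathalg.

Definition pbase (o : option qpath) : pathalg :=
  if o is Some p then << p >> else 0.

Definition pathmul (x y : pathalg) : pathalg :=
  plin (fun p => plin (fun q => pbase (pcat p q)) y) x.

Definition pathone : pathalg := \sum_(v : vertex Q) << vpath v >>.

Lemma pathmulDl : left_distributive pathmul +%R.
Proof. by move=> x y z; rewrite /pathmul plinD. Qed.

Lemma pathmulDr : right_distributive pathmul +%R.
Proof.
move=> x y z; rewrite /pathmul -plin_addf.
by apply: plin_ext => p; rewrite plinD.
Qed.

Lemma pathmulZl c x y : c *: pathmul x y = pathmul (c *: x) y.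
Proof. by rewrite /pathmul plinZ. Qed.

Lemma pathmulZr c x y : c *: pathmul x y = pathmul x (c *: y).
Proof.
by rewrite /pathmul -plin_scalef; apply: plin_ext => p; rewrite plinZ.
Qed.

Lemma pathmul0r x : pathmul 0 x = 0.
Proof. exact: plin0. Qed.

Lemma pathmulr0 x : pathmul x 0 = 0.
Proof. by apply: (addIr (pathmul x 0)); rewrite -pathmulDr !add0r. Qed.

Lemma pathmulUU p q : pathmul << p >> << q >> = pbase (pcat p q).
Proof. by rewrite /pathmul !plinU. Qed.

Lemma pathmulA : associative pathmul.
Proof.
move=> x y z; elim/malg_ind: x => [|x x' Ex Ex'|c x Ex|p].
- by rewrite !pathmul0r.
- by rewrite !pathmulDl Ex Ex'.
- by rewrite -!pathmulZl Ex.
elim/malg_ind: y => [|x x' Ex Ex'|c x Ex|q].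
- by rewrite !(pathmul0r, pathmulr0).
- by rewrite !(pathmulDl, pathmulDr) Ex Ex'.
- by rewrite -!(pathmulZl, pathmulZr) Ex.
elim/malg_ind: z => [|x x' Ex Ex'|c x Ex|r].
- by rewrite !pathmulr0.
- by rewrite !pathmulDr Ex Ex'.
- by rewrite -!pathmulZr Ex.
rewrite !pathmulUU; case: (boolP (pend p == pstart q)) => Epq; last first.
  rewrite (pcat_None Epq) /= pathmul0r.
  case: (boolP (pend q == pstart r)) => Eqr; last first.
    by rewrite (pcat_None Eqr) /= pathmulr0.
  have [s -> Es] := pcat_Some Eqr; rewrite /= pathmulUU pcat_None //.
  by rewrite /pstart Es.
have [t -> Et] := pcat_Some Epq; rewrite /= pathmulUU.
have Ete : pend t = pend q.
  by rewrite /pend Et /= walk_end_cat -/(pend p) (eqP Epq).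
case: (boolP (pend q == pstart r)) => Eqr; last first.
  by rewrite (pcat_None Eqr) /= pathmulr0 pcat_None // Ete.
have [s -> Es] := pcat_Some Eqr; rewrite /= pathmulUU.
have Eps : pend p == pstart s by rewrite /pstart Es.
have Etr : pend t == pstart r by rewrite Ete.
have [u -> Eu] := pcat_Some Eps; have [w -> Ew] := pcat_Some Etr.
congr (<< _ >>); apply: val_inj; rewrite Eu Ew Es [pstart t]/pstart Et.
by rewrite /= catA.
Qed.

Lemma pathmul1l : left_id pathone pathmul.
Proof.
move=> x; elim/malg_ind: x => [|x y Ex Ey|c x Ex|p].
- by rewrite pathmulr0.
- by rewrite pathmulDr Ex Ey.
- by rewrite -pathmulZr Ex.
rewrite /pathmul /pathone plin_sum (bigD1 (pstart p)) //= big1 ?addr0.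
  rewrite !plinU; have [r -> Er] := @pcat_Some (vpath (pstart p)) p (eqxx _).
  by congr (<< _ >>); apply: val_inj; rewrite Er; case: (p) => [[v t] ?].
by move=> v ne; rewrite !plinU pcat_None.
Qed.

Lemma pathmul1r : right_id pathone pathmul.
Proof.
move=> x; elim/malg_ind: x => [|x y Ex Ey|c x Ex|p].
- by rewrite pathmul0r.
- by rewrite pathmulDl Ex Ey.
- by rewrite -pathmulZl Ex.
rewrite /pathmul /pathone plinU plin_sum (bigD1 (pend p)) //= big1 ?addr0.
  rewrite !plinU; have [r -> Er] := @pcat_Some p (vpath (pend p)) (eqxx _).
  congr (<< _ >>); apply: val_inj; rewrite Er cats0.
  by case: (p) => [[v t] ?].
by move=> v ne; rewrite plinU pcat_None // eq_sym.
Qed.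

HB.instance Definition _ := GRing.Zmodule_isPzRing.Build pathalg
  pathmulA pathmul1l pathmul1r pathmulDl pathmulDr.
HB.instance Definition _ := isPzAlgebra.Build k pathalg
  (@scalerA k pathalg) (@scale1r k pathalg) (@scalerDr k pathalg)
  (fun x a b => scalerDl x a b) pathmulZl pathmulZr.

Definition arr (a : arrow Q) : pathalg := << apath a >>.

Definition path_deg (j : int) (x : pathalg) : Prop :=
  forall p, p \in msupp x -> (plength p)%:Z = j.

End PathAlgebra.

Section QuotientAlgebra.
Variables (k : pzRingType) (B : pzAlgType k).

Definition two_sided_ideal (I : B -> Prop) : Prop :=
  [/\ I 0, forall x y, I x -> I y -> I (x + y),
      forall a x, I x -> I (a * x) & forall a x, I x -> I (x * a)].

Variable rls : B -> Prop.

Definition gen_ideal (x : B) : Prop :=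
  forall I, two_sided_ideal I -> (forall r, rls r -> I r) -> I x.

Lemma gen_idealP : two_sided_ideal gen_ideal.
Proof.
split=> [I [] //|x y Ix Iy I II rI|a x Ix I II rI|a x Ix I II rI];
  case: (II) => _ ID Il Ir.
- by apply: ID; [exact: Ix | exact: Iy].
- by apply: Il; exact: Ix.
- by apply: Ir; exact: Ix.
Qed.

Lemma gen_ideal0 : gen_ideal 0. Proof. by case: gen_idealP. Qed.
Lemma gen_idealD x y : gen_ideal x -> gen_ideal y -> gen_ideal (x + y).
Proof. by case: gen_idealP => _ + _ _; apply. Qed.
Lemma gen_idealMl a x : gen_ideal x -> gen_ideal (a * x).
Proof. by case: gen_idealP => _ _ + _; apply. Qed.
Lemma gen_idealMr a x : gen_ideal x -> gen_ideal (x * a).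
Proof. by case: gen_idealP => _ _ _; apply. Qed.
Lemma gen_idealN x : gen_ideal x -> gen_ideal (- x).
Proof. by rewrite -mulN1r; apply: gen_idealMl. Qed.

Definition ideal_eq : rel B := fun x y => `[< gen_ideal (x - y) >].

Lemma ideal_eq_refl : reflexive ideal_eq.
Proof. by move=> x; apply/asboolP; rewrite subrr; apply: gen_ideal0. Qed.
Lemma ideal_eq_sym : symmetric ideal_eq.
Proof.
by move=> x y; apply/asboolP/asboolP => /gen_idealN; rewrite opprB.
Qed.
Lemma ideal_eq_trans : transitive ideal_eq.
Proof.
move=> y x z /asboolP xy /asboolP yz; apply/asboolP.
by have := gen_idealD xy yz; rewrite addrA subrK.
Qed.

Definition ideal_equiv :=
  EquivRel ideal_eq ideal_eq_refl ideal_eq_sym ideal_eq_trans.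

Definition quotalg := {eq_quot ideal_equiv}.
HB.instance Definition _ := Choice.on quotalg.
HB.instance Definition _ := EqQuotient.on quotalg.

Definition quot_pi (x : B) : quotalg := \pi_quotalg x.

Lemma quot_piP x y : gen_ideal (x - y) <-> quot_pi x = quot_pi y.
Proof.
split=> [Ixy | /eqmodP /asboolP //].
by apply/eqmodP/asboolP.
Qed.

Lemma quot_piK (x : quotalg) : quot_pi (repr x) = x.
Proof. exact: reprK. Qed.

Lemma repr_quot x : gen_ideal (repr (quot_pi x) - x).
Proof. by apply/quot_piP; rewrite quot_piK. Qed.

Definition quot_add (x y : quotalg) := quot_pi (repr x + repr y).
Definition quot_opp (x : quotalg) := quot_pi (- repr x).
Definition quot_mul (x y : quotalg) := quot_pi (repr x * repr y).
Definition quot_scale (c : k) (x : quotalg) := quot_pi (kscale c (repr x)).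

Lemma quot_addE x y : quot_add (quot_pi x) (quot_pi y) = quot_pi (x + y).
Proof.
apply/quot_piP; have := gen_idealD (repr_quot x) (repr_quot y).
by rewrite opprD addrACA.
Qed.

Lemma quot_oppE x : quot_opp (quot_pi x) = quot_pi (- x).
Proof.
by apply/quot_piP; have := gen_idealN (repr_quot x); rewrite opprD.
Qed.

Lemma quot_mulE x y : quot_mul (quot_pi x) (quot_pi y) = quot_pi (x * y).
Proof.
apply/quot_piP; set x' := repr _; set y' := repr _.
have -> : x' * y' - x * y = (x' - x) * y' + x * (y' - y).
  by rewrite mulrBl mulrBr addrA subrK.
apply: gen_idealD; [apply: gen_idealMr | apply: gen_idealMl]; exact: repr_quot.
Qed.

Lemma quot_scaleE c x : quot_scale c (quot_pi x) = quot_pi (kscale c x).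
Proof.
apply/quot_piP; have := gen_idealMl (kscale c 1) (repr_quot x).
by rewrite mulrBr -!kscaleAl !mul1r.
Qed.

Let quotE := (quot_addE, quot_oppE, quot_mulE, quot_scaleE).

Lemma quot_ind (P : quotalg -> Prop) : (forall x, P (quot_pi x)) -> forall x, P x.
Proof. by move=> Ppi x; rewrite -(quot_piK x). Qed.

Lemma quot_addA : associative quot_add.
Proof.
elim/quot_ind=> x; elim/quot_ind=> y; elim/quot_ind=> z.
by rewrite !quotE addrA.
Qed.
Lemma quot_addC : commutative quot_add.
Proof. by elim/quot_ind=> x; elim/quot_ind=> y; rewrite !quotE addrC. Qed.
Lemma quot_add0 : left_id (quot_pi 0) quot_add.
Proof. by elim/quot_ind=> x; rewrite !quotE add0r. Qed.
Lemma quot_addN : left_inverse (quot_pi 0) quot_opp quot_add.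
Proof. by elim/quot_ind=> x; rewrite !quotE addNr. Qed.

HB.instance Definition _ := GRing.isZmodule.Build quotalg
  quot_addA quot_addC quot_add0 quot_addN.

Lemma quot_piD x y : quot_pi x + quot_pi y = quot_pi (x + y).
Proof. exact: quot_addE. Qed.

Lemma quot_mulA : associative quot_mul.
Proof.
elim/quot_ind=> x; elim/quot_ind=> y; elim/quot_ind=> z.
by rewrite !quotE mulrA.
Qed.
Lemma quot_mul1l : left_id (quot_pi 1) quot_mul.
Proof. by elim/quot_ind=> x; rewrite !quotE mul1r. Qed.
Lemma quot_mul1r : right_id (quot_pi 1) quot_mul.
Proof. by elim/quot_ind=> x; rewrite !quotE mulr1. Qed.
Lemma quot_mulDl : left_distributive quot_mul +%R.
Proof.
elim/quot_ind=> x; elim/quot_ind=> y; elim/quot_ind=> z.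
by rewrite quot_piD !quotE quot_piD mulrDl.
Qed.
Lemma quot_mulDr : right_distributive quot_mul +%R.
Proof.
elim/quot_ind=> x; elim/quot_ind=> y; elim/quot_ind=> z.
by rewrite quot_piD !quotE quot_piD mulrDr.
Qed.

HB.instance Definition _ := GRing.Zmodule_isPzRing.Build quotalg
  quot_mulA quot_mul1l quot_mul1r quot_mulDl quot_mulDr.

Lemma quot_scaleA a b x : quot_scale a (quot_scale b x) = quot_scale (a * b) x.
Proof. by elim/quot_ind: x => x; rewrite !quotE kscaleA. Qed.
Lemma quot_scale1 : left_id 1 quot_scale.
Proof. by elim/quot_ind=> x; rewrite !quotE kscale1. Qed.
Lemma quot_scaleDr : right_distributive quot_scale +%R.
Proof.
move=> c; elim/quot_ind=> x; elim/quot_ind=> y.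
by rewrite quot_piD !quotE quot_piD kscaleDr.
Qed.
Lemma quot_scaleDl x : {morph quot_scale^~ x : a b / a + b}.
Proof.
elim/quot_ind: x => x a b.
by rewrite /= !quotE !quot_piD kscaleDl.
Qed.

Lemma quot_scaleAl c (x y : quotalg) : quot_scale c (x * y) = quot_scale c x * y.
Proof.
elim/quot_ind: x => x; elim/quot_ind: y => y.
by rewrite -[_ * _]/(quot_mul _ _) -[RHS]/(quot_mul _ _) !quotE kscaleAl.
Qed.
Lemma quot_scaleAr c (x y : quotalg) : quot_scale c (x * y) = x * quot_scale c y.
Proof.
elim/quot_ind: x => x; elim/quot_ind: y => y.
by rewrite -[_ * _]/(quot_mul _ _) -[RHS]/(quot_mul _ _) !quotE kscaleAr.
Qed.

HB.instance Definition _ := isPzAlgebra.Build k quotalg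
  quot_scaleA quot_scale1 quot_scaleDr quot_scaleDl quot_scaleAl quot_scaleAr.

End QuotientAlgebra.

(* Tensor product over R of a right R-module U (action [ra]) and a left       *)
(* R-module V (action [la]).  Its elements are formal sums of pure tensors    *)
(* (the empty sum is 0, and -(u, v) is (-u, v)), two such sums being          *)
(* identified when they have the same image under every R-balanced map.       *)
Section Tensor.
Variables (U V : zmodType) (R : Type) (ra : U -> R -> U) (la : R -> V -> V).

Definition balanced (W : zmodType) (f : U -> V -> W) : Prop :=
  [/\ forall u u' v, f (u + u') v = f u v + f u' v,
      forall u v v', f u (v + v') = f u v + f u v' &
      forall u r v, f (ra u r) v = f u (la r v)].

Definition feval (W : zmodType) (f : U -> V -> W) (s : seq (U * V)) : W :=
  \sum_(p <- s) f p.1 p.2.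

Definition tens_eq : rel (seq (U * V)) := fun s t =>
  `[< forall (W : zmodType) (f : U -> V -> W), balanced f ->
        feval f s = feval f t >].

Lemma tens_eq_refl : reflexive tens_eq.
Proof. by move=> s; apply/asboolP. Qed.
Lemma tens_eq_sym : symmetric tens_eq.
Proof. by move=> s t; apply/asboolP/asboolP => st W f bf; rewrite st. Qed.
Lemma tens_eq_trans : transitive tens_eq.
Proof.
move=> t s u /asboolP st /asboolP tu; apply/asboolP => W f bf.
by rewrite st // tu.
Qed.

Definition tens_equiv := EquivRel tens_eq tens_eq_refl tens_eq_sym tens_eq_trans.

Definition tens := {eq_quot tens_equiv}.
HB.instance Definition _ := Choice.on tens.
HB.instance Definition _ := EqQuotient.on tens.

Definition tens_pi (s : seq (U * V)) : tens := \pi_tens s.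

Definition pure (u : U) (v : V) : tens := tens_pi [:: (u, v)].

Definition tlift (W : zmodType) (f : U -> V -> W) (x : tens) : W :=
  feval f (repr x).

Lemma tens_piP s t :
  (forall (W : zmodType) (f : U -> V -> W), balanced f -> feval f s = feval f t)
    <-> tens_pi s = tens_pi t.
Proof.
split=> [st | /eqmodP /asboolP //].
by apply/eqmodP/asboolP.
Qed.

Lemma tlift_pi (W : zmodType) (f : U -> V -> W) s : balanced f ->
  tlift f (tens_pi s) = feval f s.
Proof.
by move=> bf; apply/(tens_piP _ s).2: bf; rewrite /tens_pi reprK.
Qed.

Lemma tlift_pure (W : zmodType) (f : U -> V -> W) u v : balanced f ->
  tlift f (pure u v) = f u v.
Proof. by move=> bf; rewrite tlift_pi // /feval big_seq1. Qed.

Lemma tens_ext x y :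
  (forall (W : zmodType) (f : U -> V -> W), balanced f ->
     tlift f x = tlift f y) -> x = y.
Proof.
by move=> xy; rewrite -[x]reprK -[y]reprK; apply/tens_piP => W f /xy.
Qed.

Definition tens_add (x y : tens) := tens_pi (repr x ++ repr y).
Definition tens_opp (x : tens) := tens_pi [seq (- p.1, p.2) | p <- repr x].

Section Lift.
Variables (W : zmodType) (f : U -> V -> W) (bf : balanced f).

Lemma balanced0l v : f 0 v = 0.
Proof. by case: bf => D _ _; apply: (addIr (f 0 v)); rewrite -D !add0r. Qed.
Lemma balanced0r u : f u 0 = 0.
Proof. by case: bf => _ D _; apply: (addIr (f u 0)); rewrite -D !add0r. Qed.
Lemma balancedNl u v : f (- u) v = - f u v.
Proof.
case: (bf) => D _ _; apply: (addIr (f u v)).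
by rewrite -D !addNr balanced0l.
Qed.

Lemma tlift_add x y : tlift f (tens_add x y) = tlift f x + tlift f y.
Proof. by rewrite tlift_pi // /feval big_cat. Qed.

Lemma tlift_nil : tlift f (tens_pi [::]) = 0.
Proof. by rewrite tlift_pi // /feval big_nil. Qed.

Lemma tlift_opp x : tlift f (tens_opp x) = - tlift f x.
Proof.
rewrite tlift_pi // /feval big_map -sumrN.
by apply: eq_bigr => p _; rewrite balancedNl.
Qed.
End Lift.

Lemma tens_addA : associative tens_add.
Proof. by move=> x y z; apply: tens_ext => W f bf; rewrite !tlift_add // addrA. Qed.
Lemma tens_addC : commutative tens_add.
Proof. by move=> x y; apply: tens_ext => W f bf; rewrite !tlift_add // addrC. Qed.
Lemma tens_add0 : left_id (tens_pi [::]) tens_add.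
Proof.
by move=> x; apply: tens_ext => W f bf; rewrite tlift_add // tlift_nil // add0r.
Qed.
Lemma tens_addN : left_inverse (tens_pi [::]) tens_opp tens_add.
Proof.
move=> x; apply: tens_ext => W f bf.
by rewrite tlift_add // tlift_nil // tlift_opp // addNr.
Qed.

HB.instance Definition _ := GRing.isZmodule.Build tens
  tens_addA tens_addC tens_add0 tens_addN.

Lemma tliftD (W : zmodType) (f : U -> V -> W) : balanced f ->
  {morph tlift f : x y / x + y}.
Proof. by move=> bf x y; apply: tlift_add. Qed.

Lemma tlift0 (W : zmodType) (f : U -> V -> W) : balanced f -> tlift f 0 = 0.
Proof. by move=> bf; apply: tlift_nil. Qed.

Lemma pure_balanced : balanced pure.
Proof.
by split=> [u u' v|u v v'|u r v]; apply: tens_ext => W f bf;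
  rewrite ?tliftD ?tlift_pure //; case: bf.
Qed.

Lemma tens_sum (x : tens) : x = \sum_(p <- repr x) pure p.1 p.2.
Proof.
apply: tens_ext => W f bf; rewrite {1}/tlift /feval.
elim: (repr x) => [|p s IHs]; first by rewrite !big_nil tlift0.
by rewrite !big_cons tliftD // tlift_pure // IHs.
Qed.

Lemma tens_ind (P : tens -> Prop) :
  P 0 -> (forall x y, P x -> P y -> P (x + y)) -> (forall u v, P (pure u v)) ->
  forall x, P x.
Proof.
move=> P0 PD Pp x; rewrite (tens_sum x).
by elim: (repr x) => [|p s IHs]; rewrite ?big_nil // big_cons; apply: PD.
Qed.

Lemma tlift_ext (W : zmodType) (f g : U -> V -> W) x :
  (forall u v, f u v = g u v) -> tlift f x = tlift g x.
Proof. by move=> fg; apply: eq_bigr => p _; apply: fg. Qed.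

Lemma tlift_addf (W : zmodType) (f g : U -> V -> W) x :
  tlift (fun u v => f u v + g u v) x = tlift f x + tlift g x.
Proof. by rewrite /tlift /feval big_split. Qed.

End Tensor.

(* The enveloping algebra: the tensor product over k of A and its opposite.   *)
Section Enveloping.
Variables (k : pzRingType) (A : pzAlgType k).

Definition env := tens (fun (a : A) (c : k) => kscale c a)
                       (fun (c : k) (b : A) => kscale c b).
HB.instance Definition _ := GRing.Zmodule.on env.

Notation elift := (@tlift A A k (fun (a : A) (c : k) => kscale c a)
                                (fun (c : k) (b : A) => kscale c b) _).

Definition epure (a b : A) : env := pure _ _ a b.

Notation kbalanced := (balanced (fun (a : A) (c : k) => kscale c a)
                                (fun (c : k) (b : A) => kscale c b)).

(* (a (x) b) (a' (x) b') = a a' (x) b' b *)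
Definition env_mul (x y : env) : env :=
  elift (fun a b => elift (fun a' b' => epure (a * a') (b' * b)) y) x.

Lemma epure_balanced : kbalanced epure.
Proof. exact: pure_balanced. Qed.

Lemma env_mul_inner a b :
  kbalanced (fun a' b' => epure (a * a') (b' * b)).
Proof.
have [Dl Dr Z] := epure_balanced.
split=> [u u' v|u v v'|u c v]; first by rewrite mulrDr Dl.
  by rewrite mulrDl Dr.
by rewrite -kscaleAr Z kscaleAl.
Qed.

Lemma env_mul_outer y : kbalanced
  (fun a b => elift (fun a' b' => epure (a * a') (b' * b)) y : env).
Proof.
have [Dl Dr Z] := epure_balanced.
split=> [u u' v|u v v'|u c v]; rewrite -?tlift_addf;
  apply: tlift_ext => a b.
- by rewrite mulrDl Dl.
- by rewrite mulrDr Dr.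
- by rewrite -kscaleAl Z kscaleAr.
Qed.

Lemma env_mulDl : left_distributive env_mul +%R.
Proof. by move=> x y z; rewrite /env_mul tliftD //; apply: env_mul_outer. Qed.

Lemma env_mulDr : right_distributive env_mul +%R.
Proof.
move=> x y z; rewrite /env_mul -tlift_addf; apply: tlift_ext => a b.
by rewrite tliftD //; apply: env_mul_inner.
Qed.

Lemma env_mulE a b a' b' :
  env_mul (epure a b) (epure a' b') = epure (a * a') (b' * b).
Proof.
rewrite /env_mul tlift_pure; last exact: env_mul_outer.
by rewrite tlift_pure //; apply: env_mul_inner.
Qed.

Lemma env_mul0l x : env_mul 0 x = 0.
Proof. by apply: tlift0; apply: env_mul_outer. Qed.

Lemma env_mul0r x : env_mul x 0 = 0.
Proof. by apply: (addIr (env_mul x 0)); rewrite -env_mulDr !add0r. Qed.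

Lemma env_ind (P : env -> Prop) :
  P 0 -> (forall x y, P x -> P y -> P (x + y)) -> (forall a b, P (epure a b)) ->
  forall x, P x.
Proof. exact: tens_ind. Qed.

Lemma env_mulA : associative env_mul.
Proof.
move=> x y z; elim/env_ind: x => [|x x' Ex Ex'|a b].
- by rewrite !env_mul0l.
- by rewrite !env_mulDl Ex Ex'.
elim/env_ind: y => [|x x' Ex Ex'|a' b'].
- by rewrite !(env_mul0l, env_mul0r).
- by rewrite !(env_mulDl, env_mulDr) Ex Ex'.
elim/env_ind: z => [|x x' Ex Ex'|a'' b''].
- by rewrite !env_mul0r.
- by rewrite !env_mulDr Ex Ex'.
by rewrite !env_mulE !mulrA.
Qed.

Lemma env_mul1l : left_id (epure 1 1) env_mul.
Proof.
move=> x; elim/env_ind: x => [|x y Ex Ey|a b].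
- by rewrite env_mul0r.
- by rewrite env_mulDr Ex Ey.
by rewrite env_mulE mul1r mulr1.
Qed.

Lemma env_mul1r : right_id (epure 1 1) env_mul.
Proof.
move=> x; elim/env_ind: x => [|x y Ex Ey|a b].
- by rewrite env_mul0l.
- by rewrite env_mulDl Ex Ey.
by rewrite env_mulE mul1r mulr1.
Qed.

HB.instance Definition _ := GRing.Zmodule_isPzRing.Build env
  env_mulA env_mul1l env_mul1r env_mulDl env_mulDr.

Definition env_swap (x : env) : env := elift (fun a b => epure b a) x.

(* A as a left module over its enveloping algebra: (a (x) b) . x = a x b.      *)
Definition diag : Type := A.
HB.instance Definition _ := GRing.Zmodule.on diag.

Definition diag_scale (r : env) (x : diag) : diag :=
  elift (fun a b => a * (x : A) * b) r.

Lemma diag_scale_balanced (x : A) : kbalanced (fun a b => a * x * b).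
Proof.
split=> [u u' v|u v v'|u c v]; first by rewrite !mulrDl.
  by rewrite mulrDr.
by rewrite -!kscaleAl -kscaleAr.
Qed.

Lemma diag_scale_pure a b (x : diag) :
  diag_scale (epure a b) x = a * (x : A) * b.
Proof. by rewrite /diag_scale tlift_pure //; apply: diag_scale_balanced. Qed.

Lemma diag_scaleDl x : {morph diag_scale^~ x : r s / r + s}.
Proof. by move=> r s; apply: tliftD; apply: diag_scale_balanced. Qed.

Lemma diag_scaleDr : right_distributive diag_scale +%R.
Proof.
move=> r x y; rewrite /diag_scale -tlift_addf; apply: tlift_ext => a b.
by rewrite mulrDr mulrDl.
Qed.

Lemma diag_scale0l x : diag_scale 0 x = 0.
Proof. by apply: tlift0; apply: diag_scale_balanced. Qed.

Lemma diag_scale0r r : diag_scale r 0 = 0.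
Proof. by apply: (addIr (diag_scale r 0)); rewrite -diag_scaleDr !add0r. Qed.

Lemma diag_scaleA r s x : diag_scale r (diag_scale s x) = diag_scale (r * s) x.
Proof.
elim/env_ind: r => [|r r' Er Er'|a b].
- by rewrite mul0r !diag_scale0l.
- by rewrite mulrDl !diag_scaleDl Er Er'.
elim/env_ind: s => [|r r' Er Er'|a' b'].
- by rewrite mulr0 !diag_scale0l diag_scale0r.
- by rewrite mulrDr !diag_scaleDl diag_scaleDr Er Er'.
by rewrite [_ * _]env_mulE !diag_scale_pure !mulrA.
Qed.

Lemma diag_scale1 : left_id 1 diag_scale.
Proof. by move=> x; rewrite diag_scale_pure mul1r mulr1. Qed.

HB.instance Definition _ := GRing.Zmodule_isLmodule.Build env diag
  diag_scaleA diag_scale1 diag_scaleDr diag_scaleDl.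

End Enveloping.

Section Gradings.

(* M is the direct sum of the subgroups G j.                                  *)
Definition is_grading (M : zmodType) (G : int -> M -> Prop) : Prop :=
  [/\ forall j, G j 0,
      forall j x y, G j x -> G j y -> G j (x - y),
      forall x, exists (s : seq int) (f : int -> M),
        (forall j, G j (f j)) /\ x = \sum_(j <- s) f j &
      forall (s : seq int) (f : int -> M), uniq s -> (forall j, G j (f j)) ->
        \sum_(j <- s) f j = 0 -> forall j, j \in s -> f j = 0].

Definition graded_algebra (k : pzRingType) (A : pzAlgType k)
    (gA : int -> A -> Prop) : Prop :=
  [/\ is_grading gA, gA 0 1,
      forall i j x y, gA i x -> gA j y -> gA (i + j) (x * y) &
      forall (c : k) j x, gA j x -> gA j (kscale c x)].

Definition env_deg (k : pzRingType) (A : pzAlgType k) (gA : int -> A -> Prop)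
    (j : int) (x : env A) : Prop :=
  exists (m : nat) (a b : 'I_m -> A) (p q : 'I_m -> int),
    (forall t, [/\ gA (p t) (a t), gA (q t) (b t) & p t + q t = j]) /\
    x = \sum_(t < m) epure (a t) (b t).

Definition graded_module (R : pzRingType) (gR : int -> R -> Prop)
    (M : lmodType R) (gM : int -> M -> Prop) : Prop :=
  is_grading gM /\
  forall i j r x, gR i r -> gM j x -> gM (i + j) (r *: x).

Record grmod (R : pzRingType) (gR : int -> R -> Prop) := GrMod {
  grcar :> lmodType R;
  grdeg : int -> grcar -> Prop;
  grmodP : graded_module gR grdeg }.

End Gradings.

Arguments grdeg {R gR} g _ _.

Section Ext.
Variables (R : pzRingType) (gR : int -> R -> Prop).

Definition hom_deg (M N : lmodType R) (gM : int -> M -> Prop)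
    (gN : int -> N -> Prop) (j : int) (f : M -> N) : Prop :=
  linear f /\ forall i x, gM i x -> gN (i + j) (f x).

(* The graded Hom group: finite sums of homogeneous homomorphisms.            *)
Definition graded_hom (M N : lmodType R) (gM : int -> M -> Prop)
    (gN : int -> N -> Prop) (f : M -> N) : Prop :=
  exists (m : nat) (j : 'I_m -> int) (g : 'I_m -> M -> N),
    (forall t, hom_deg gM gN (j t) (g t)) /\
    forall x, f x = \sum_(t < m) g t x.

Definition finitely_generated (M : lmodType R) : Prop :=
  exists (m : nat) (g : 'I_m -> M),
    forall x, exists c : 'I_m -> R, x = \sum_(t < m) c t *: g t.

Definition graded_projective (P : grmod gR) : Prop :=
  forall (M N : grmod gR) (p : M -> N) (g : P -> N),
    hom_deg (grdeg M) (grdeg N) 0 p -> (forall y, exists x, p x = y) ->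
    hom_deg (grdeg P) (grdeg N) 0 g ->
    exists h : P -> M, hom_deg (grdeg P) (grdeg M) 0 h /\
      forall x, p (h x) = g x.

Variables (M : lmodType R) (gM : int -> M -> Prop).

Record resolution := Resolution {
  res :> nat -> grmod gR;
  res_d : forall i, res i.+1 -> res i;
  res_eps : res 0%N -> M;
  res_proj : forall i, graded_projective (res i);
  res_d_hom : forall i, hom_deg (grdeg (res i.+1)) (grdeg (res i)) 0 (@res_d i);
  res_eps_hom : hom_deg (grdeg (res 0%N)) gM 0 res_eps;
  res_eps_surj : forall y, exists x, res_eps x = y;
  res_exact0 : forall x, res_eps x = 0 <-> exists y, x = res_d y;
  res_exact : forall i (x : res i.+1), res_d x = 0 <-> exists y, x = res_d y }.

Definition finite_fg_resolution (P : resolution) : Prop :=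
  (forall i, finitely_generated (P i)) /\
  exists m : nat, forall i, (m <= i)%N -> forall x : P i, x = 0.

(* The complex of graded homomorphisms from P to the free module of rank one. *)
Definition cochain (P : resolution) i (f : P i -> R^o) : Prop :=
  graded_hom (grdeg (P i)) (gR : int -> R^o -> Prop) f.

Definition cocycle (P : resolution) i (f : P i -> R^o) : Prop :=
  cochain f /\ forall y, f (res_d y) = 0.

Definition coboundary (P : resolution) i : (P i -> R^o) -> Prop :=
  if i is i'.+1 then
    fun f => exists2 g : P i' -> R^o, cochain g & forall y, f y = g (res_d y)
  else fun f => forall y, f y = 0.

(* Ext^i_R(M, R) is isomorphic, as a graded right R-module, to the abelian    *)
(* group E with grading gE and right action [act].  The action on a cocycle   *)
(* is (f . r)(x) = f(x) r, and the isomorphism is given by a surjection from  *)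
(* the cocycles whose kernel is the group of coboundaries.                    *)
Definition Ext_iso (i : nat) (E : zmodType) (act : E -> R -> E)
    (gE : int -> E -> Prop) : Prop :=
  exists (P : resolution) (phi : (P i -> R^o) -> E),
    [/\ forall f g, cocycle f -> cocycle g ->
          phi (fun x => f x + g x) = phi f + phi g,
        forall f r, cocycle f ->
          phi (fun x => (f x : R) * r) = act (phi f) r,
        forall e, exists2 f, cocycle f & phi f = e,
        forall f, cocycle f -> (phi f = 0 <-> coboundary f) &
        forall j f, cocycle f -> hom_deg (grdeg (P i)) (gR : int -> R^o -> Prop) j f ->
          gE j (phi f)].

Definition Ext_zero (i : nat) : Prop :=
  exists P : resolution, forall f : P i -> R^o, cocycle f -> coboundary f.

End Ext.

Section TwistedCalabiYau.
Variables (k : pzRingType) (A : pzAlgType k) (gA : int -> A -> Prop).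

(* Graded (A, A)-bimodules (with k acting centrally) are graded left modules  *)
(* over the enveloping algebra.                                               *)
Notation grbimod := (grmod (env_deg gA)).

Definition lact (U : lmodType (env A)) (a : A) (u : U) : U := epure a 1 *: u.
Definition ract (U : lmodType (env A)) (u : U) (b : A) : U := epure 1 b *: u.

(* U (x)_A V is isomorphic to A as a graded bimodule.                         *)
Definition tensor_iso_unit (U V : grbimod) : Prop :=
  exists phi : tens (@ract U) (@lact V) -> A,
    [/\ forall x y, phi (x + y) = phi x + phi y,
        bijective phi,
        forall a b u v, phi (pure _ _ (lact a u) (ract v b)) =
          a * phi (pure _ _ u v) * b &
        forall i j u v, grdeg U i u -> grdeg V j v ->
          gA (i + j) (phi (pure _ _ u v))].

Definition invertible_bimodule (U : grbimod) : Prop :=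
  exists V : grbimod, tensor_iso_unit U V /\ tensor_iso_unit V U.

Definition graded_homologically_smooth : Prop :=
  exists P : resolution (env_deg gA) (gA : int -> diag A -> Prop),
    finite_fg_resolution P.

(* The right action of the enveloping algebra on a bimodule:                  *)
(* u . (a (x) b) = b u a.                                                     *)
Definition env_ract (U : lmodType (env A)) (u : U) (r : env A) : U :=
  env_swap r *: u.

Definition twisted_graded_CY (d : nat) : Prop :=
  [/\ graded_algebra gA,
      graded_homologically_smooth &
      exists U : grbimod,
        [/\ invertible_bimodule U,
            Ext_iso (env_deg gA) (gA : int -> diag A -> Prop) d
              (@env_ract U) (grdeg U) &
            forall i, i != d ->
              Ext_zero (env_deg gA) (gA : int -> diag A -> Prop) i]].

End TwistedCalabiYau.

Section AlgebraD.
Variables (k : fieldType) (n : nat).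

(* [inl i] is u_i : i -> i+1 and [inr i] is d_i : i+1 -> i, where [ordS] is   *)
(* the cyclic successor.                                                      *)
Definition Qbar : quiver := @Quiver 'I_n ('I_n + 'I_n)%type
  (fun a => match a with inl i => i | inr i => ordS i end)
  (fun a => match a with inl i => ordS i | inr i => i end).

Definition u_ (i : 'I_n) : pathalg k Qbar := @arr k Qbar (inl i).
Definition d_ (i : 'I_n) : pathalg k Qbar := @arr k Qbar (inr i).

Definition D_rel (x : pathalg k Qbar) : Prop :=
  exists i : 'I_n,
    let i0 := ord_pred i in
    let i1 := ordS i in let i2 := ordS i1 in let i3 := ordS i2 in
    x = d_ i * d_ i0 * u_ i0 - (- (u_ i1 * d_ i1 * d_ i)) \/
    x = d_ i * u_ i * u_ i1 * u_ i2
        - (u_ i1 * d_ i1 * u_ i1 * u_ i2 - u_ i1 * u_ i2 * d_ i2 * u_ i2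
           + u_ i1 * u_ i2 * u_ i3 * d_ i3).

Definition algD := quotalg D_rel.
HB.instance Definition _ := PzAlgebra.on algD.

Definition algD_deg (j : int) (x : algD) : Prop :=
  exists2 y : pathalg k Qbar, path_deg j y & x = quot_pi D_rel y.

End AlgebraD.

(* Main.v *)
(* Put u = sum of the u_i, d = sum of the d_i, e_j = trivial paths, and        *)

(* The relations at the vertices are the vertex idempotents times two relations between [u] and [d],
   so the vertices only add bookkeeping: integer weights, and idempotents that move past [u] and
   [d].

   Basis. Spanning and independence of the monomials come from one construction. Operators on formal
   monomials are defined by the straightening formulas for right multiplication; [periodic_rel1] and
   [periodic_rel2] check the relations for them, so D acts. The effect of an element on the vector
   of 1 gives its coordinates, and [val_co] and [co_bas] show that taking coordinates and evaluating
   monomials are mutually inverse.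

   Resolution. The bimodule complex has generators in degrees 0; 1, 1; 3, 4; 6, 6; 7. Killing
   right-hand factors of positive degree leaves a complex of left modules with entries in [u], [d],
   [w]. Its exactness ([one_sided_exact1] to [one_sided_exact4]) is proved by division with
   remainder: D is the direct sum of T and D u, where T is spanned by the d^a z^b w^m; cycles are
   reduced modulo [u], and on T the sequence [d], [z], [w] behaves as in a Koszul complex
   ([koszul_exact]). [lift_exact] returns to bimodules by successive approximation in the degree of
   the right-hand factor, which stops because the total degree bounds that degree. The augmentation
   is treated by [augmentation_kernel].

   Projectives. A generator of weight m spans the sum of the D e_i (x) e_(i + m) D, which is the
   module of rows fixed by an idempotent. The differentials commute with these idempotents, so
   exactness of rows and columns over the enveloping algebra passes to the summands
   ([idem_resolution], [idem_Ext_zero], [idem_Ext_iso]).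

   Duality. Homomorphisms into the enveloping algebra turn rows into columns, and the
   anti-automorphism [tau] turns columns back into rows. By [tau_Dm0] to [tau_Dm3] it maps each
   differential to the complementary one, up to sign and a swap. Hence the transposed complex is
   exact outside degree 4 ([Dm0_col_inj], [Dm_col_exact]), and its cohomology there is the cokernel
   of the augmentation complex read through [tau]: D twisted by the rotation and shifted by 7. *)
(* w = u^2 d + d u^2, which commutes with u and d.  With I^2 = -1 and          *)
(* z = u d + I d u one has z d = I d z and u z = w + I z u, and the monomials  *)
(* d^a z^b w^m u^c e_j form a basis of D: they span by the relations, and the  *)
(* right action they ought to carry satisfies the relations.  So D is free     *)
(* over powers of u on the span of the d^a z^b w^m, on which d, z, w act       *)
(* regularly, and this makes the one-sided complex of D-modules with ranks     *)
(* 1, 2, 2, 2, 1 exact.  Filtering D (x) D by the degree of the right-hand     *)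
(* factor lifts the exactness to a complex of projective bimodules of the      *)
(* same shape, resolving D.                                                    *)
(* Let nu be the automorphism of D induced by rotating the quiver.  The        *)
(* anti-automorphism a (x) b |-> b (x) nu(a) of the enveloping algebra carries *)
(* the transposed complex to the complex itself up to signs and swaps, so its  *)
(* only cohomology is D twisted by nu, in degree 4.                            *)
Require Import Defs.
From HB Require Import structures.
From mathcomp Require Import all_boot all_order all_algebra.
From mathcomp Require Import boolp finmap monalg.
From mathcomp Require Import ring zify.

Set Implicit Arguments.
Unset Strict Implicit.
Unset Printing Implicit Defensive.

Import GRing.Theory.
Local Open Scope ring_scope.

(** * Rewriting in noncommutative rings *)

Section NcRewriting.
Variable R : pzRingType.

(** Reflected syntax: an equation is proved by computing the difference of its sides as a list of
    integer multiples of words and rewriting the words until all collected coefficients vanish. *)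
Inductive ncexpr :=
  | NCvar of nat | NCone | NCzero
  | NCadd of ncexpr & ncexpr | NCmul of ncexpr & ncexpr | NCopp of ncexpr.

Notation ncpoly := (seq (int * seq nat)).

Variable v : nat -> R.

Fixpoint nceval (t : ncexpr) : R :=
  match t with
  | NCvar i => v i
  | NCone => 1
  | NCzero => 0
  | NCadd a b => nceval a + nceval b
  | NCmul a b => nceval a * nceval b
  | NCopp a => - nceval a
  end.

Definition ncword (s : seq nat) : R := foldr (fun i => *%R (v i)) 1 s.
Definition ncpval (p : ncpoly) : R :=
  foldr (fun m => +%R (ncword m.2 *~ m.1)) 0 p.

Lemma ncword_cat s t : ncword (s ++ t) = ncword s * ncword t.
Proof. by elim: s => [|i s IHs] /=; rewrite ?mul1r // IHs mulrA. Qed.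

Lemma ncpval_cat p q : ncpval (p ++ q) = ncpval p + ncpval q.
Proof. by elim: p => [|m p IHp] /=; rewrite ?add0r // IHp addrA. Qed.

(** The raw [intRing.mulz], like [eqn], [eqseq] and [intZmod.addz] below, keeps the computation free
    of structure instances. *)
Definition ncscale (c : int) (s t : seq nat) (p : ncpoly) : ncpoly :=
  [seq (intRing.mulz c m.1, s ++ m.2 ++ t) | m <- p].

Lemma ncpval_scale c s t p :
  ncpval (ncscale c s t p) = (ncword s * ncpval p * ncword t) *~ c.
Proof.
elim: p => [|m p IHp] /=; first by rewrite mulr0 mul0r mul0rz.
rewrite IHp mulrDr mulrDl mulrzDl !ncword_cat mulrA; congr (_ + _).
by rewrite -[intRing.mulz _ _]/(c * m.1) mulrC mulrzA mulrzAr mulrzAl.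
Qed.

Definition ncpmul (p q : ncpoly) : ncpoly :=
  flatten [seq ncscale m.1 m.2 [::] q | m <- p].

Fixpoint ncflat (t : ncexpr) : ncpoly :=
  match t with
  | NCvar i => [:: (Posz 1, [:: i])]
  | NCone => [:: (Posz 1, [::])]
  | NCzero => [::]
  | NCadd a b => ncflat a ++ ncflat b
  | NCmul a b => ncpmul (ncflat a) (ncflat b)
  | NCopp a => ncscale (Negz 0) [::] [::] (ncflat a)
  end.

Lemma ncflatP t : ncpval (ncflat t) = nceval t.
Proof.
elim: t => //= [i||a <- b <-|a <- b <-|a <-].
- by rewrite mulr1 addr0.
- by rewrite addr0.
- exact: ncpval_cat.
- rewrite /ncpmul; elim: (ncflat a) => [|m p IHp] /=; first by rewrite mul0r.
  by rewrite ncpval_cat ncpval_scale IHp mulr1 mulrDl mulrzAl.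
- by rewrite ncpval_scale mul1r mulr1 NegzE mulrNz.
Qed.

Variable rules : seq (seq nat * ncpoly).

Fixpoint nccut (l s : seq nat) : option (seq nat) :=
  match l, s with
  | [::], _ => Some s
  | i :: l', j :: s' => if eqn i j then nccut l' s' else None
  | _, _ => None
  end.

Fixpoint ncmatch (rs : seq (seq nat * ncpoly)) (s : seq nat) :=
  if rs is r :: rs' then
    if nccut r.1 s is Some t then Some (r.2, t) else ncmatch rs' s
  else None.

Fixpoint ncfind (pre s : seq nat) : option ncpoly :=
  if ncmatch rules s is Some (p, t) then
    Some (ncscale (Posz 1) (rev pre) t p)
  else if s is i :: s' then ncfind (i :: pre) s' else None.

Fixpoint ncaddmon (c : int) (s : seq nat) (p : ncpoly) : ncpoly :=
  if p is m :: p' then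
    if eqseq m.2 s then (intZmod.addz c m.1, m.2) :: p'
    else m :: ncaddmon c s p'
  else [:: (c, s)].

(** The head of [work] is rewritten once, or collected in [acc] when no rule matches. When the fuel
    runs out everything left is returned, so the value is preserved for any fuel and soundness rests
    on the validity of the rules alone. *)
Fixpoint ncreduce (fuel : nat) (work acc : ncpoly) : ncpoly :=
  if fuel is f.+1 then
    if work is m :: p then
      if ncfind [::] m.2 is Some q then
        ncreduce f (ncscale m.1 [::] [::] q ++ p) acc
      else ncreduce f p (ncaddmon m.1 m.2 acc)
    else acc
  else work ++ acc.

Definition ncvalid : Prop :=
  foldr (fun r => and (ncword r.1 = ncpval r.2)) True rules.
Hypothesis rulesP : ncvalid.

Lemma nccutP l s t : nccut l s = Some t -> s = l ++ t.
Proof.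
elim: l s => [|i l IHl] [|j s] //= => [[] //|[] //|].
by case: eqnP => // -> /IHl ->.
Qed.

Lemma ncmatchP s p t : ncmatch rules s = Some (p, t) ->
  ncword s = ncpval p * ncword t.
Proof.
move: rulesP; rewrite /ncvalid; elim: rules => //= r rs IHrs [Er /IHrs IH].
by case Ec: nccut => [t'|] // [<- <-]; rewrite (nccutP Ec) ncword_cat Er.
Qed.

Lemma ncfindP pre s p : ncfind pre s = Some p ->
  ncword (rev pre) * ncword s = ncpval p.
Proof.
elim: s pre => [|i s IHs] pre /=.
  case Em: ncmatch => [[q t]|] // [<-].
  by rewrite ncpval_scale mulr1z -mulrA -(ncmatchP Em).
case Em: ncmatch => [[q t]|] => [[<-]|/IHs <-].
  by rewrite ncpval_scale mulr1z -mulrA -(ncmatchP Em).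
by rewrite rev_cons -cats1 ncword_cat /= mulr1 mulrA.
Qed.

Lemma ncaddmonP c s p : ncpval (ncaddmon c s p) = ncword s *~ c + ncpval p.
Proof.
elim: p => //= m p IHp; rewrite -[eqseq _ _]/(m.2 == s); case: eqP => [->|_] /=.
  by rewrite -[intZmod.addz _ _]/(c + m.1) mulrzDr addrA.
by rewrite IHp addrCA.
Qed.

Lemma ncreduceP f p acc : ncpval (ncreduce f p acc) = ncpval p + ncpval acc.
Proof.
elim: f p acc => [|f IHf] p acc /=; first by rewrite ncpval_cat.
case: p => [|m p] /=; first by rewrite add0r.
case Ef: ncfind => [q|]; rewrite IHf.
  rewrite ncpval_cat ncpval_scale mul1r mulr1.
  by rewrite -(ncfindP Ef) mul1r.
by rewrite ncaddmonP addrCA addrA.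
Qed.

Definition nczero (p : ncpoly) : bool :=
  all (fun m : int * seq nat => if m.1 is Posz 0 then true else false) p.

Lemma ncrewrite (f : nat) (a b : ncexpr) :
  nczero (ncreduce f (ncflat (NCadd a (NCopp b))) [::]) -> nceval a = nceval b.
Proof.
move=> p0; apply/eqP; rewrite -subr_eq0 -[_ - _]/(nceval (NCadd a (NCopp b))).
rewrite -ncflatP -[ncpval _]addr0 -[0]/(ncpval [::]) -(ncreduceP f).
by elim: (ncreduce _ _ _) p0 => //= -[[[|c]|c] s] p IHp //= /IHp; rewrite add0r.
Qed.

End NcRewriting.

Ltac nc_index x vs :=
  lazymatch vs with
  | x :: _ => constr:(O)
  | _ :: ?t => let i := nc_index x t in constr:(S i)
  end.

Ltac nc_reify vs t :=
  lazymatch t with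
  | (?a + ?b)%R =>
      let a' := nc_reify vs a in let b' := nc_reify vs b in
      constr:(NCadd a' b')
  | (?a * ?b)%R =>
      let a' := nc_reify vs a in let b' := nc_reify vs b in
      constr:(NCmul a' b')
  | (- ?a)%R => let a' := nc_reify vs a in constr:(NCopp a')
  | 1%R => constr:(NCone)
  | 0%R => constr:(NCzero)
  | _ => let i := nc_index t vs in constr:(NCvar i)
  end.

(* Proves an equation between noncommutative polynomials in the atoms [vs]    *)
(* by rewriting with the rules justified by [ok : ncvalid (nth 0 vs) rules].  *)
Ltac ncring vs ok :=
  lazymatch goal with
  | |- ?a = ?b =>
      let a' := nc_reify vs a in let b' := nc_reify vs b in
      refine (@ncrewrite _ (nth 0%R vs) _ ok 5000 a' b' _);
      vm_compute; exact isT
  end.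

(** * Gradings *)

Lemma big_uniq_support (I : eqType) (M : nmodType) (r s : seq I) (F : I -> M) :
  uniq r -> uniq s -> {subset r <= s} -> (forall i, i \notin r -> F i = 0) ->
  \sum_(i <- r) F i = \sum_(i <- s) F i.
Proof.
move=> ur us rs F0; rewrite [RHS](bigID (mem r)) /= [X in _ + X]big1 //.
rewrite addr0 -[RHS]big_filter; apply: perm_big; apply: uniq_perm => //.
  exact: filter_uniq.
by move=> i; rewrite mem_filter /=; case: (boolP (i \in r)) => // /rs ->.
Qed.

Section GradingTheory.
Variables (M : zmodType) (G : int -> M -> Prop).

(** Degrees may repeat in [s], so these sums are closed under addition by concatenation;
    [homogeneous_sum_split] collects equal degrees afterwards. *)
Definition homogeneous_sum (x : M) : Prop :=
  exists2 s : seq (int * M), {in s, forall p, G p.1 p.2} &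
    x = \sum_(p <- s) p.2.

Lemma homogeneous_sum0 : homogeneous_sum 0.
Proof. by exists [::]; rewrite ?big_nil. Qed.

Lemma homogeneous_sumG j x : G j x -> homogeneous_sum x.
Proof.
by exists [:: (j, x)]; rewrite ?big_seq1 // => p; rewrite inE => /eqP->.
Qed.

Lemma homogeneous_sumD x y :
  homogeneous_sum x -> homogeneous_sum y -> homogeneous_sum (x + y).
Proof.
move=> [s Gs ->] [t Gt ->]; exists (s ++ t); last by rewrite big_cat.
by move=> p; rewrite mem_cat => /orP[/Gs|/Gt].
Qed.

Lemma homogeneous_sum_big (I : eqType) (r : seq I) (F : I -> M) :
  {in r, forall i, homogeneous_sum (F i)} -> homogeneous_sum (\sum_(i <- r) F i).
Proof.
move=> HF; rewrite big_seq; elim/big_rec: _ => [|i x /HF Hi Hx].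
  exact: homogeneous_sum0.
exact: homogeneous_sumD.
Qed.

Lemma homogeneous_sum_split x : (forall j, G j 0) ->
  (forall j x y, G j x -> G j y -> G j (x + y)) -> homogeneous_sum x ->
  exists (s : seq int) (f : int -> M), (forall j, G j (f j)) /\ x = \sum_(j <- s) f j.
Proof.
move=> G0 GD [s Gs ->].
exists (undup [seq p.1 | p <- s]), (fun j => \sum_(p <- s | p.1 == j) p.2).
split=> [j|].
  rewrite big_seq_cond; elim/big_ind: _ => // [|[i y] /= /andP[/Gs Gp /eqP<- //]].
  by move=> *; apply: GD.
rewrite (exchange_big_dep predT) //= [LHS]big_seq [RHS]big_seq.
apply: eq_bigr => p ps; rewrite big_mkcond (bigD1_seq p.1) ?undup_uniq //=; last first.
  by rewrite mem_undup map_f.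
by rewrite eqxx big1 ?addr0 // => j; rewrite eq_sym; case: eqP.
Qed.

(** Applying [pr j] to a vanishing sum of homogeneous terms isolates the term of degree [j], so
    projections give uniqueness of components and only spanning has to be shown. *)
Lemma grading_of_proj (pr : int -> M -> M) :
  (forall j, G j 0) -> (forall j x y, G j x -> G j y -> G j (x - y)) ->
  (forall j, {morph pr j : x y / x + y}) ->
  (forall j x, G j x -> pr j x = x) ->
  (forall i j x, G i x -> i != j -> pr j x = 0) ->
  (forall x, homogeneous_sum x) -> is_grading G.
Proof.
move=> G0 GB prD pr_id pr_0 span.
have GD j x y : G j x -> G j y -> G j (x + y).
  by move=> Gx Gy; rewrite -[y]opprK -[- y]sub0r; apply: (GB) => //; apply: GB.
have pr0 j : pr j 0 = 0 by apply: (addIr (pr j 0)); rewrite -prD !add0r.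
have pr_sum j I (r : seq I) (F : I -> M) :
    pr j (\sum_(i <- r) F i) = \sum_(i <- r) pr j (F i).
  by elim: r => [|i r IHr]; rewrite ?big_nil // !big_cons prD IHr.
split=> // [x | s f us Gf f0 j js].
  exact: homogeneous_sum_split.
have := congr1 (pr j) f0; rewrite pr0 pr_sum (bigD1_seq j) //= big1_seq.
  by rewrite addr0 pr_id.
by move=> i /andP[ij _]; apply: pr_0 ij.
Qed.

Hypothesis gG : is_grading G.

Lemma grading0 j : G j 0. Proof. by case: gG. Qed.

Lemma gradingB j x y : G j x -> G j y -> G j (x - y).
Proof. by case: gG => _ + _ _; apply. Qed.

Lemma gradingN j x : G j x -> G j (- x).
Proof. by rewrite -sub0r => Gx; apply: gradingB => //; apply: grading0. Qed.

Lemma gradingD j x y : G j x -> G j y -> G j (x + y).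
Proof. by move=> Gx Gy; rewrite -[y]opprK; apply/gradingB/gradingN. Qed.

Lemma grading_sum j I (r : seq I) (P : pred I) (F : I -> M) :
  (forall i, P i -> G j (F i)) -> G j (\sum_(i <- r | P i) F i).
Proof.
by move=> GF; elim/big_ind: _ => //; [apply: grading0 | apply: gradingD].
Qed.

Lemma grading_mulrn j x m : G j x -> G j (x *+ m).
Proof.
by move=> Gx; elim: m => [|m IHm]; rewrite ?mulrS; [apply: grading0 | apply: gradingD].
Qed.

Lemma grading_uniq (s t : seq int) (f g : int -> M) :
  (forall j, G j (f j)) -> (forall j, G j (g j)) -> uniq s -> uniq t ->
  (forall j, j \notin s -> f j = 0) -> (forall j, j \notin t -> g j = 0) ->
  \sum_(j <- s) f j = \sum_(j <- t) g j -> f =1 g.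
Proof.
move=> Gf Gg us ut f0 g0 fg.
pose r := undup (s ++ t).
have ur : uniq r by apply: undup_uniq.
have sr : {subset s <= r} by move=> j js; rewrite mem_undup mem_cat js.
have tr : {subset t <= r} by move=> j jt; rewrite mem_undup mem_cat jt orbT.
rewrite (big_uniq_support us ur) // (big_uniq_support ut ur) // in fg => j.
case: (boolP (j \in r)) => jr.
  case: gG => _ _ _ /(_ r (fun j => f j - g j) ur) H.
  apply: subr0_eq; apply: (H _ _ j jr) => [i|]; first exact: gradingB.
  by rewrite big_split /= sumrN fg subrr.
by rewrite f0 1?g0 //; apply: contra jr; (apply: tr || apply: sr).
Qed.

(** Components are picked by choice; their additivity follows from uniqueness of the
    decomposition. *)
Lemma grading_proj : exists pr : int -> M -> M,
  [/\ forall j, {morph pr j : x y / x + y}, forall j x, G j (pr j x),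
      forall i j x, G i x -> pr j x = if j == i then x else 0 &
      forall x, exists2 s, uniq s &
        x = \sum_(j <- s) pr j x /\ forall j, j \notin s -> pr j x = 0].
Proof.
have dec x : exists f : int -> M, (forall j, G j (f j)) /\ exists2 s, uniq s &
    x = \sum_(j <- s) f j /\ forall j, j \notin s -> f j = 0.
  case: gG => _ _ /(_ x)[s [f [Gf ->]]] _.
  (* The degrees in [s] may repeat, so each term is multiplied by its multiplicity and duplicates
     are removed from the list. *)
  exists (fun j => f j *+ count_mem j s); split=> [j|].
    exact: grading_mulrn.
  exists (undup s); rewrite ?undup_uniq //; split=> [|j].
    rewrite big_undup_iterop_count; apply: eq_bigr => j _ /=.
    by case: (count_mem j s) => // m; rewrite Monoid.iteropE -iterop_addr.
  by rewrite mem_undup => /count_memPn ->.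
have [pr Ppr] := choice dec.
exists (fun j x => pr x j).
have prP x s f : uniq s -> (forall j, G j (f j)) -> 
    (forall j, j \notin s -> f j = 0) -> x = \sum_(j <- s) f j -> pr x =1 f.
  move=> us Gf f0 Ex; have [Gpr [t ut [Ext pr0]]] := Ppr x.
  by apply: (grading_uniq Gpr Gf ut us) => //; rewrite -Ext.
split=> [j x y|j x|i j x Gx|x]; last 1 first.
- by have [_] := Ppr x.
- have [Gx [s us [Ex x0]]] := Ppr x; have [Gy [t ut [Ey y0]]] := Ppr y.
  apply: (prP _ (undup (s ++ t)) (fun j => pr x j + pr y j)); rewrite ?undup_uniq //.
  + by move=> {}j; apply: gradingD.
  + move=> {}j; rewrite mem_undup mem_cat negb_or => /andP[js jt].
    by rewrite x0 // y0 // addr0.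
  rewrite big_split /= {1}Ex {1}Ey; congr (_ + _); apply: big_uniq_support;
    rewrite ?undup_uniq // => i ir; rewrite mem_undup mem_cat ir ?orbT //.
- by have [] := Ppr x.
rewrite (prP x [:: i] (fun j => if j == i then x else 0)) // => [{}j|{}j|].
- by case: eqP => [->|_] //; apply: grading0.
- by rewrite inE => /negPf ->.
by rewrite big_seq1 eqxx.
Qed.

End GradingTheory.

Section GradedMaps.
Variables (M N : zmodType) (G : int -> M -> Prop) (H : int -> N -> Prop).
Hypotheses (gG : is_grading G) (gH : is_grading H).
Variable f : M -> N.
Hypotheses (fD : {morph f : x y / x + y}) (fG : forall j x, G j x -> H j (f x)).

Let f0 : f 0 = 0. Proof. by apply: (addIr (f 0)); rewrite -fD !add0r. Qed.

Let f_sum I (r : seq I) (F : I -> M) : f (\sum_(i <- r) F i) = \sum_(i <- r) f (F i).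
Proof. by elim: r => [|i r IHr]; rewrite ?big_nil // !big_cons fD IHr. Qed.

Lemma graded_map_lift t x : H t (f x) -> exists2 y, G t y & f y = f x.
Proof.
move=> Hfx; have [pr [_ Gpr _ prS]] := grading_proj gG.
have [s us [Ex x0]] := prS x; exists (pr t x) => //.
have ut : uniq [:: t] by [].
suff /(_ t) : (fun j => f (pr j x)) =1 (fun j => if j == t then f x else 0).
  by rewrite eqxx.
apply: (grading_uniq gH _ _ us ut) => [j|j|j /x0 ->|j|] //.
- exact: fG.
- by case: eqP => [->|_] //; apply: grading0.
- by rewrite inE => /negPf ->.
by rewrite -f_sum -Ex big_seq1 eqxx.
Qed.

Lemma graded_map_ker x : f x = 0 ->
  exists2 s : seq (int * M), {in s, forall p, G p.1 p.2 /\ f p.2 = 0} &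
    x = \sum_(p <- s) p.2.
Proof.
move=> fx0; have [pr [_ Gpr _ prS]] := grading_proj gG.
have [s us [Ex x0]] := prS x; exists [seq (j, pr j x) | j <- s]; last first.
  by rewrite big_map.
move=> p /mapP[j js ->] /=; split=> //.
case: gH => _ _ _ /(_ s (fun j => f (pr j x)) us) f_uniq.
by apply: f_uniq js => [i|]; [apply: fG | rewrite -f_sum -Ex].
Qed.

End GradedMaps.

Section GradedRows.
Variables (R : pzRingType) (gR : int -> R -> Prop).
Hypotheses (gG : is_grading gR)
  (gM : forall i j x y, gR i x -> gR j y -> gR (i + j) (x * y)).

(** Homogeneity in the graded free module whose basis vector [a] has degree [s a]; matrices in
    [hom_mx] act on such rows with degree zero. *)
Definition hom_row r (s : 'I_r -> int) (t : int) (x : 'rV[R]_r) : Prop :=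
  forall a, gR (t - s a) (x 0 a).

Definition hom_mx p q (s : 'I_p -> int) (s' : 'I_q -> int) (M : 'M[R]_(p, q)) :=
  forall a b, gR (s a - s' b) (M a b).

Lemma hom_row_mul p q (s : 'I_p -> int) (s' : 'I_q -> int) t x M :
  hom_row s t x -> hom_mx s s' M -> hom_row s' t (x *m M).
Proof.
move=> hx hM b; rewrite mxE; apply: grading_sum => // a _.
by rewrite -(subrKA (s a)); apply: gM.
Qed.

Lemma hom_row_grading r (s : 'I_r -> int) : is_grading (hom_row s).
Proof.
have [pr [prD prG prE prS]] := grading_proj gG.
pose pr' j (x : 'rV[R]_r) := \row_a pr (j - s a) (x 0 a).
apply: (@grading_of_proj _ _ pr').
- by move=> j a; rewrite mxE; apply: grading0.
- by move=> j x y Gx Gy a; rewrite !mxE; apply: gradingB.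
- by move=> j x y; apply/rowP => a; rewrite !mxE prD.
- by move=> j x Gx; apply/rowP => a; rewrite mxE (prE _ _ _ (Gx a)) eqxx.
- move=> i j x Gx ij; apply/rowP => a; rewrite !mxE (prE _ _ _ (Gx a)).
  by rewrite (inj_eq (addIr _)) eq_sym (negPf ij).
move=> x; rewrite (row_sum_delta x); apply: homogeneous_sum_big => a _.
have [S uS [-> _]] := prS (x 0 a); rewrite scaler_suml.
apply: homogeneous_sum_big => j _; apply: (@homogeneous_sumG _ _ (j + s a)) => b.
rewrite !mxE eqxx /=; case: eqP => [->|_]; rewrite ?mulr0 ?mulr1.
  by rewrite addrK.
exact: grading0.
Qed.

Lemma hom_row_lift p q (s : 'I_p -> int) (s' : 'I_q -> int) (M : 'M_(p, q)) t y :
  hom_mx s s' M -> hom_row s' t (y *m M) ->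
  exists2 x, hom_row s t x & y *m M = x *m M.
Proof.
move=> hM /(@graded_map_lift _ _ _ _ (hom_row_grading s) (hom_row_grading s')
  (mulmxr M))[x y'|j x hx|x hx Ex]; last by exists x.
  exact: mulmxDl.
exact: hom_row_mul.
Qed.

Lemma hom_row_ker p q (s : 'I_p -> int) (s' : 'I_q -> int) (M : 'M_(p, q)) x :
  hom_mx s s' M -> x *m M = 0 ->
  exists2 S : seq (int * 'rV[R]_p),
    {in S, forall p, hom_row s p.1 p.2 /\ p.2 *m M = 0} & x = \sum_(p <- S) p.2.
Proof.
move=> hM /(@graded_map_ker _ _ _ _ (hom_row_grading s) (hom_row_grading s')
  (mulmxr M)); apply=> [? ?|? ? ?]; first exact: mulmxDl.
exact: hom_row_mul.
Qed.

End GradedRows.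

(** * Complexes of modules cut out by idempotent matrices *)

Section IdempotentModule.
Variables (R : pzRingType) (r : nat) (E : 'M[R]_r).

(** For idempotent [E] this is the direct summand R^r E of the free module, presented by fixed rows
    so that maps between summands are plain matrices. *)
Definition idem_pred : {pred 'rV[R]_r} := fun x => x *m E == x.

Lemma idem_pred_submod : submod_closed idem_pred.
Proof.
split=> [|c x y /eqP Ex /eqP Ey]; first by rewrite /in_mem /= /idem_pred mul0mx.
by rewrite /in_mem /= /idem_pred mulmxDl -scalemxAl Ex Ey.
Qed.
HB.instance Definition _ := GRing.isSubmodClosed.Build R 'rV[R]_r idem_pred
  idem_pred_submod.

Record idem_rows := IdemRows { idem_val :> 'rV[R]_r; idemP : idem_val \in idem_pred }.
HB.instance Definition _ := [isSub for idem_val].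
HB.instance Definition _ := [Choice of idem_rows by <:].
HB.instance Definition _ := [SubChoice_isSubLmodule of idem_rows by <:].

Lemma idem_valE (x : idem_rows) : idem_val x *m E = idem_val x.
Proof. exact: (eqP (idemP x)). Qed.

Lemma idem_val_inj : injective idem_val.
Proof. exact: val_inj. Qed.

Lemma idem_valD (x y : idem_rows) : idem_val (x + y) = idem_val x + idem_val y.
Proof. exact: (raddfD val). Qed.

Lemma idem_valZ c (x : idem_rows) : idem_val (c *: x) = c *: idem_val x.
Proof. exact: GRing.valZ. Qed.

Lemma idem_val0 : idem_val 0 = 0.
Proof. exact: (raddf0 val). Qed.

Lemma idem_valB (x y : idem_rows) : idem_val (x - y) = idem_val x - idem_val y.
Proof. exact: (raddfB val). Qed.

Lemma idem_val_sum I (S : seq I) (F : I -> idem_rows) :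
  idem_val (\sum_(i <- S) F i) = \sum_(i <- S) idem_val (F i).
Proof. exact: (raddf_sum val). Qed.

Hypothesis EE : E *m E = E.

Lemma idem_row_subproof (x : 'rV[R]_r) : x *m E \in idem_pred.
Proof. by rewrite /in_mem /= /idem_pred -mulmxA EE. Qed.

Definition idem_row (x : 'rV[R]_r) : idem_rows := IdemRows (idem_row_subproof x).

Lemma idem_rowK (x : idem_rows) : idem_row (idem_val x) = x.
Proof. by apply: idem_val_inj; rewrite /= idem_valE. Qed.

Lemma idem_row_lin : linear idem_row.
Proof.
by move=> c x y; apply: idem_val_inj;
  rewrite idem_valD idem_valZ /= mulmxDl scalemxAl.
Qed.

Lemma idem_rowD x y : idem_row (x + y) = idem_row x + idem_row y.
Proof. by rewrite -[x]scale1r idem_row_lin !scale1r. Qed.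

Lemma idem_row_sum (x : idem_rows) :
  x = \sum_a (idem_val x) 0 a *: idem_row (delta_mx 0 a).
Proof.
apply: idem_val_inj; rewrite -{1}idem_valE {1}(row_sum_delta (idem_val x)).
rewrite mulmx_suml idem_val_sum; apply: eq_bigr => a _.
by rewrite idem_valZ -scalemxAl.
Qed.

End IdempotentModule.

Section IdempotentComplex.
Variables (R : pzRingType) (gR : int -> R -> Prop).
Hypotheses (gG : is_grading gR)
  (g1 : gR 0 1) (gM : forall i j x y, gR i x -> gR j y -> gR (i + j) (x * y)).

Section Module.
Variables (r : nat) (s : 'I_r -> int) (E : 'M[R]_r).
Hypotheses (EE : E *m E = E) (hE : hom_mx gR s s E).

Definition idem_deg (t : int) (x : idem_rows E) : Prop := hom_row gR s t (idem_val x).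

Lemma idem_row_deg t x : hom_row gR s t x -> idem_deg t (idem_row EE x).
Proof. by move=> hx; apply: hom_row_mul hE. Qed.

Lemma idem_graded : graded_module gR idem_deg.
Proof.
have [pr [prD prG prE prS]] := grading_proj (hom_row_grading gG s).
split; last first.
  move=> i j c x hc hx a; rewrite idem_valZ mxE -addrA.
  by apply: gM.
apply: (@grading_of_proj _ _ (fun j x => idem_row EE (pr j (idem_val x)))).
- by move=> j; rewrite /idem_deg idem_val0 => a; rewrite mxE; apply: grading0.
- move=> j x y hx hy a; rewrite idem_valB !mxE; apply: gradingB => //.
- by move=> j x y; rewrite idem_valD prD idem_rowD.
- by move=> j x hx; rewrite (prE j) // eqxx idem_rowK.
- move=> i j x hx ij; rewrite (prE i) // eq_sym (negPf ij).
  by apply: idem_val_inj; rewrite [LHS]mul0mx idem_val0.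
move=> x; have [S _ [Ex _]] := prS (idem_val x).
exists [seq (j, idem_row EE (pr j (idem_val x))) | j <- S].
  by move=> p /mapP[j _ ->]; apply: idem_row_deg.
apply: idem_val_inj; rewrite big_map -{1}(idem_valE x) {1}Ex mulmx_suml.
by elim: S {Ex} => [|j S IH]; rewrite ?big_nil ?idem_val0 // !big_cons idem_valD IH.
Qed.

Definition idem_grmod : grmod gR := GrMod idem_graded.

Lemma idem_lin_sum (V : lmodType R) (f : idem_rows E -> V) (x : idem_rows E) :
  linear f -> f x = \sum_a (idem_val x) 0 a *: f (idem_row EE (delta_mx 0 a)).
Proof.
move=> fl; have fD y z : f (y + z) = f y + f z by rewrite -[y]scale1r fl !scale1r.
have f0 : f 0 = 0 by apply: (addIr (f 0)); rewrite -fD !add0r.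
have fZ c y : f (c *: y) = c *: f y by rewrite -[c *: y]addr0 fl f0 addr0.
rewrite {1}(idem_row_sum EE x) (big_morph f fD f0).
by apply: eq_bigr => a _; rewrite fZ.
Qed.

(** Homogeneous lifts of the images of the basis rows, found by [graded_map_lift], are combined with
    the coordinates of [x] in the ambient free module. *)
Lemma idem_projective : graded_projective idem_grmod.
Proof.
move=> M N p f [pl hp] psurj [fl hf].
have [gMM scM] := grmodP M; have [gN _] := grmodP N.
have lift a : exists m, grdeg M (s a) m /\ p m = f (idem_row EE (delta_mx 0 a)).
  have [m pm] := psurj (f (idem_row EE (delta_mx 0 a))).
  have pD : {morph p : y z / y + z} by move=> y z; rewrite -[y]scale1r pl !scale1r.
  have pG j y : grdeg M j y -> grdeg N j (p y) by move/hp; rewrite addr0.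
  have hpm : grdeg N (s a) (p m).
    rewrite pm -[s a]addr0; apply: hf; apply: idem_row_deg => b.
    rewrite mxE eqxx /=; case: eqP => [->|_]; last exact: grading0.
    by rewrite subrr.
  have [m' hm' pm'] := graded_map_lift gMM gN pD pG hpm.
  by exists m'; rewrite pm' pm.
have [m hm] := choice lift; clear lift.
exists (fun x => \sum_a (idem_val x) 0 a *: m a); split; last first.
  move=> x; rewrite (idem_lin_sum _ fl).
  have pD : {morph p : y z / y + z} by move=> y z; rewrite -[y]scale1r pl !scale1r.
  have p0 : p 0 = 0 by apply: (addIr (p 0)); rewrite -pD !add0r.
  rewrite (big_morph p pD p0); apply: eq_bigr => a _.
  by have [_ <-] := hm a; rewrite -[_ *: m a]addr0 pl p0 addr0.
split=> [c x y|i x hx].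
  rewrite scaler_sumr -big_split; apply: eq_bigr => a _.
  by rewrite idem_valD idem_valZ !mxE scalerDl scalerA.
apply: grading_sum => // a _; have [hma _] := hm a.
by rewrite addr0 -(subrK (s a) i); apply: scM.
Qed.

Lemma hom_row_mulc t (c : 'cV[R]_r) x i :
  (forall a, gR (t + s a) (c a 0)) -> hom_row gR s i x -> gR (i + t) ((x *m c) 0 0).
Proof.
move=> hc hx; rewrite mxE; apply: grading_sum => // a _.
by rewrite -(subrK (s a) i) -addrA [s a + t]addrC; apply: gM.
Qed.

(** The column consists of the values at the projected basis rows. Conversely, finitely many entries
    involve finitely many degrees, so multiplication by a column is a finite sum of homogeneous
    functionals. *)
Lemma idem_cochainP (f : idem_rows E -> R^o) :
  graded_hom idem_deg (gR : int -> R^o -> Prop) f <->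
  exists2 c : 'cV[R]_r, E *m c = c & forall x, f x = (idem_val x *m c) 0 0.
Proof.
split=> [[m [j [h [hh Ef]]]] | [c Ec Ef]].
  have fl : linear f.
    move=> c x y; rewrite !Ef scaler_sumr -big_split; apply: eq_bigr => t _.
    by have [hl _] := hh t; rewrite hl.
  pose c := \col_a (f (idem_row EE (delta_mx 0 a)) : R).
  have fc x : f x = (idem_val x *m c) 0 0.
    rewrite (idem_lin_sum _ fl) mxE; apply: eq_bigr => a _.
    by rewrite mxE.
  exists c => //; apply/colP => a; rewrite [RHS]mxE fc /=.
  by rewrite -rowE -row_mul [RHS]mxE.
have [pr [prD prG prE prS]] := grading_proj gG.
have [S uS ES] : exists2 S : seq int, uniq S &
    forall a, c a 0 = \sum_(j <- S) pr (j + s a) (c a 0).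
  have /choice [Sa HSa] a : exists S, uniq S /\
      (c a 0 = \sum_(j <- S) pr j (c a 0) /\ forall j, j \notin S -> pr j (c a 0) = 0).
    by have [S uS ?] := prS (c a 0); exists S.
  (* The component of entry [a] in degree j belongs to a functional of degree [j - s a]; [S] gathers
     these degrees over all entries. *)
  pose S := undup (flatten [seq [seq j - s a | j <- Sa a] | a <- enum 'I_r]).
  exists S; first exact: undup_uniq.
  move=> a; have [uSa [Ea Sa0]] := HSa a.
  rewrite -(big_map (fun j => j + s a) predT (fun j => pr j (c a 0))) {1}Ea.
  apply: big_uniq_support => // [|j jS].
    by rewrite map_inj_uniq ?undup_uniq //; apply: addIr.
  apply/mapP; exists (j - s a); last by rewrite subrK.
  rewrite mem_undup; apply/flattenP; exists [seq j - s a | j <- Sa a].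
    by apply/mapP; exists a; rewrite ?mem_enum.
  by apply/mapP; exists j.
exists (size S), (fun t => nth 0 S t).
exists (fun t x => (idem_val x *m (\col_a pr (nth 0 S t + s a) (c a 0))) 0 0).
split=> [t|x].
  split=> [a x y|i x hx].
    by rewrite idem_valD idem_valZ mulmxDl -scalemxAl !mxE.
  by apply: hom_row_mulc hx => a; rewrite mxE.
rewrite Ef -summxE -mulmx_sumr; congr ((_ *m _) 0 0); apply/colP => a.
rewrite summxE [LHS]ES (big_nth 0) big_mkord; apply: eq_bigr => j _.
by rewrite mxE.
Qed.

End Module.

Variables (r : nat -> nat) (s : forall j, 'I_(r j) -> int).
Variables (E : forall j, 'M[R]_(r j)) (D : forall j, 'M[R]_(r j.+1, r j)).
Hypotheses (EE : forall j, E j *m E j = E j)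
  (hE : forall j, hom_mx gR (@s j) (@s j) (E j))
  (ED : forall j, E j.+1 *m D j = D j *m E j)
  (hD : forall j, hom_mx gR (@s j.+1) (@s j) (D j))
  (DD : forall j, D j.+1 *m D j = 0)
  (exD : forall j (x : 'rV_(r j.+1)), x *m D j = 0 -> exists y, x = y *m D j.+1).
Variables (L : lmodType R) (gL : int -> L -> Prop) (g : 'I_(r 0) -> L).
Hypotheses (gLG : is_grading gL)
  (gLM : forall i j c x, gR i c -> gL j x -> gL (i + j) (c *: x))
  (hg : forall a, gL (s a) (g a))
  (gE : forall a, \sum_b E 0 a b *: g b = g a)
  (gD : forall a, \sum_b D 0 a b *: g b = 0)
  (g_surj : forall y, exists x : 'rV_(r 0), y = \sum_a x 0 a *: g a)
  (g_ex : forall x : 'rV_(r 0), x *m E 0 = x -> \sum_a x 0 a *: g a = 0 ->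
    exists y, x = y *m D 0).

Let P j : grmod gR := idem_grmod (EE j) (@hE j).

Definition idem_d j (x : P j.+1) : P j := idem_row (EE j) (idem_val x *m D j).
Definition idem_eps (x : P 0) : L := \sum_a (idem_val x) 0 a *: g a.

Lemma idem_dE j (x : P j.+1) : idem_val (idem_d x) = idem_val x *m D j.
Proof. by rewrite /= -mulmxA -ED mulmxA idem_valE. Qed.

Lemma mulmx_gen q (N : 'M[R]_(q, r 0)) (x : 'rV_q) :
  \sum_a (x *m N) 0 a *: g a = \sum_b x 0 b *: (\sum_a N b a *: g a).
Proof.
under eq_bigr do rewrite mxE scaler_suml.
rewrite exchange_big; apply: eq_bigr => b _; rewrite scaler_sumr.
by apply: eq_bigr => a _; rewrite scalerA.
Qed.

Lemma idem_d_hom j : hom_deg (grdeg (P j.+1)) (grdeg (P j)) 0 (@idem_d j).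
Proof.
split=> [c x y|i x hx].
  apply: idem_val_inj; rewrite idem_valD idem_valZ !idem_dE idem_valD idem_valZ.
  by rewrite mulmxDl scalemxAl.
rewrite addr0 /= /idem_deg idem_dE.
exact: hom_row_mul (@hD j).
Qed.

Lemma idem_eps_hom : hom_deg (grdeg (P 0)) gL 0 idem_eps.
Proof.
split=> [c x y|i x hx].
  rewrite /idem_eps scaler_sumr -big_split; apply: eq_bigr => a _.
  by rewrite idem_valD idem_valZ !mxE scalerDl scalerA.
rewrite addr0; apply: grading_sum => // a _; rewrite -(subrK (s a) i).
exact: gLM.
Qed.

Lemma idem_eps_surj y : exists x, idem_eps x = y.
Proof.
have [x ->] := g_surj y; exists (idem_row (EE 0) x).
by rewrite /idem_eps mulmx_gen; apply: eq_bigr => a _; rewrite gE.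
Qed.

Lemma idem_exact0 x : idem_eps x = 0 <-> exists y, x = idem_d y.
Proof.
split=> [x0 | [y ->]].
  have [y Ey] := g_ex (idem_valE x) x0; exists (idem_row (EE 1) y).
  apply: idem_val_inj; rewrite idem_dE /= -mulmxA ED mulmxA -Ey.
  by rewrite idem_valE.
by rewrite /idem_eps idem_dE mulmx_gen big1 // => a _; rewrite gD scaler0.
Qed.

(** If x = y D on full rows and x is fixed by E, then x = x E = y D E = (y E) D, so exactness of
    full rows restricts to the summands. *)
Lemma idem_exact j (x : P j.+1) : idem_d x = 0 <-> exists y, x = idem_d y.
Proof.
split=> [/(congr1 (@idem_val _ _ _)) | [y ->]]; last first.
  by apply: idem_val_inj; rewrite !idem_dE -mulmxA DD mulmx0 idem_val0.
rewrite idem_dE idem_val0 => /exD[y Ey]; exists (idem_row (EE j.+2) y).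
by apply: idem_val_inj; rewrite idem_dE /= -mulmxA ED mulmxA -Ey idem_valE.
Qed.

Definition idem_resolution : resolution gR gL :=
  @Resolution R gR L gL P idem_d idem_eps (fun j => @idem_projective _ _ _ (EE j) (@hE j))
    idem_d_hom idem_eps_hom idem_eps_surj idem_exact0 idem_exact.

Lemma idem_resolution_finite m : (forall j, (m <= j)%N -> r j = 0) ->
  finite_fg_resolution idem_resolution.
Proof.
move=> r0; split=> [j|].
  exists (r j), (fun a => idem_row (EE j) (delta_mx 0 a)) => x.
  by exists (fun a => (idem_val x) 0 a); apply: idem_row_sum.
have row0 q (y : 'rV[R]_q) : q = 0%N -> y = 0.
  by move=> q0; move: y; rewrite q0 => y; apply: thinmx0.
by exists m => j /r0 rj0 x; apply: idem_val_inj; rewrite idem_val0; apply: row0.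
Qed.

Lemma idem_cocycleP j (f : idem_resolution j -> R^o) : cocycle f <->
  exists2 c : 'cV[R]_(r j), E j *m c = c /\ D j *m c = 0 &
    forall x, f x = (idem_val x *m c) 0 0.
Proof.
split=> [[/(idem_cochainP (@s j) (EE j))[c Ec Ef] fd] | [c [Ec Dc] Ef]].
  exists c => //; split=> //; apply/colP => a; rewrite [RHS]mxE.
  have := fd (idem_row (EE j.+1) (delta_mx 0 a)).
  by rewrite Ef idem_dE /= -!mulmxA (mulmxA (E _)) ED -(mulmxA (D j)) Ec -rowE mxE.
split; first by apply/(idem_cochainP (@s j) (EE j)); exists c.
by move=> y; rewrite Ef idem_dE -mulmxA Dc mulmx0 mxE.
Qed.

Lemma idem_coboundaryP j (f : idem_resolution j.+1 -> R^o) c :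
  E j.+1 *m c = c -> (forall x, f x = (idem_val x *m c) 0 0) ->
  coboundary f <-> exists c' : 'cV[R]_(r j), c = D j *m c'.
Proof.
move=> Ec Ef; split=> [[g' /(idem_cochainP (@s j) (EE j))[c' Ec' Eg] fg] | [c' Ec']].
  exists c'; apply/colP => a; have := fg (idem_row (EE j.+1) (delta_mx 0 a)).
  rewrite Ef Eg idem_dE /= -!mulmxA Ec (mulmxA (E _)) ED -(mulmxA (D j)) Ec'.
  by rewrite -!rowE !mxE.
exists (fun x : P j => (idem_val x *m (E j *m c')) 0 0 : R^o).
  apply/(idem_cochainP (@s j) (EE j)); exists (E j *m c') => //.
  by rewrite mulmxA EE.
move=> y; rewrite Ef idem_dE Ec' [in RHS]mulmxA -[in RHS](mulmxA _ _ (E j)).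
by rewrite -ED !mulmxA idem_valE.
Qed.

Lemma idem_Ext_zero0 :
  (forall c : 'cV[R]_(r 0), D 0 *m c = 0 -> c = 0) -> Ext_zero gR gL 0.
Proof.
move=> ex; exists idem_resolution => f /idem_cocycleP[c [_ /ex ->] Ef] y.
by rewrite Ef mulmx0 mxE.
Qed.

Lemma idem_Ext_zero j :
  (forall c : 'cV[R]_(r j.+1), D j.+1 *m c = 0 -> exists c', c = D j *m c') ->
  Ext_zero gR gL j.+1.
Proof.
move=> ex; exists idem_resolution => f /idem_cocycleP[c [Ec /ex Hc] Ef].
exact/(idem_coboundaryP Ec Ef).
Qed.

(** Cocycles are the columns fixed by [E] and killed by [D], coboundaries are the image of the
    previous [D], and the right action multiplies columns on the right; so Ext is determined by a
    suitable map [psi] on columns. *)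
Lemma idem_Ext_iso j (X : zmodType) (act : X -> R -> X) (gX : int -> X -> Prop)
    (psi : 'cV[R]_(r j.+1) -> X) :
  {morph psi : c c' / c + c'} ->
  (forall c b, psi (c *m b%:M) = act (psi c) b) ->
  (forall e, exists c, [/\ E j.+1 *m c = c, D j.+1 *m c = 0 & psi c = e]) ->
  (forall c, E j.+1 *m c = c -> D j.+1 *m c = 0 ->
     psi c = 0 <-> exists c', c = D j *m c') ->
  (forall t (c : 'cV[R]_(r j.+1)), (forall a, gR (s a + t) (c a 0)) -> gX t (psi c)) ->
  Ext_iso gR gL j.+1 act gX.
Proof.
move=> psiD psiM psi_surj psi_ker psi_deg.
pose col (f : P j.+1 -> R^o) : 'cV[R]_(r j.+1) :=
  \col_a (f (idem_row (EE j.+1) (delta_mx 0 a)) : R).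
have colE f c : E j.+1 *m c = c -> (forall x, f x = (idem_val x *m c) 0 0) -> col f = c.
  by move=> Ec Ef; apply/colP => a; rewrite mxE Ef /= -mulmxA Ec -rowE mxE.
exists idem_resolution, (fun f => psi (col f)); split.
- by move=> f h _ _; rewrite -psiD; congr psi; apply/colP => a; rewrite !mxE.
- move=> f b _; rewrite -psiM; congr psi; apply/colP => a; rewrite !mxE big_ord1.
  by rewrite !mxE.
- move=> e; have [c [Ec Dc <-]] := psi_surj e.
  exists (fun x : P j.+1 => (idem_val x *m c) 0 0 : R^o).
    by apply/idem_cocycleP; exists c.
  by rewrite (colE _ c).
- move=> f /idem_cocycleP[c [Ec Dc] Ef]; rewrite (colE _ _ Ec Ef) psi_ker //.
  exact: iff_sym (idem_coboundaryP Ec Ef).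
move=> t f _ [_ hf]; apply: psi_deg => a; rewrite mxE; apply: hf.
apply: idem_row_deg; rewrite // => b.
by rewrite mxE eqxx /=; case: eqP => [->|_]; [rewrite subrr | apply: grading0].
Qed.

End IdempotentComplex.

(** * The regular representation on PBW monomials *)

Lemma linear_morphs (k : pzRingType) (V W : lmodType k) (f : V -> W) :
  {morph f : x y / x + y} -> (forall c, {morph f : x / c *: x}) -> linear f.
Proof. by move=> fD fZ c x y; rewrite fD fZ. Qed.

Section LinearMaps.
Variables (k : pzRingType) (V W : lmodType k) (f : V -> W).
Hypothesis fl : linear f.

Lemma lin_morphD x y : f (x + y) = f x + f y.
Proof. by rewrite -[x]scale1r fl !scale1r. Qed.

Lemma lin_morph0 : f 0 = 0.
Proof. by apply: (addIr (f 0)); rewrite -lin_morphD !add0r. Qed.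

Lemma lin_morphZ c x : f (c *: x) = c *: f x.
Proof. by rewrite -[c *: x]addr0 fl lin_morph0 addr0. Qed.

End LinearMaps.

Lemma malg_lin_ext (k : fieldType) (K : choiceType) (W : lmodType k)
    (f g : {malg k[K]} -> W) :
  linear f -> linear g -> (forall p, f << p >> = g << p >>) -> f =1 g.
Proof.
move=> fl gl fg; apply: malg_ind => [|x y Ex Ey|c x Ex|//].
- by rewrite (lin_morph0 fl) (lin_morph0 gl).
- by rewrite (lin_morphD fl) (lin_morphD gl) Ex Ey.
by rewrite (lin_morphZ fl) (lin_morphZ gl) Ex.
Qed.

Section PeriodicAction.
Variables (k : fieldType) (I : k) (V : lmodType k) (T : Type) (n : nat).
Variables (co : T -> V -> k) (pv : 'I_n -> nat -> nat -> nat -> nat -> V).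
Variables (opU opD : V -> V) (opE : 'I_n -> V -> V).
Hypotheses (II : I * I = -1)
  (coD : forall t, {morph co t : x y / x + y})
  (coZ : forall t c x, co t (c *: x) = c * co t x)
  (co_inj : forall x y, (forall t, co t x = co t y) -> x = y)
  (pv_ext : forall f g : V -> V, linear f -> linear g ->
     (forall j a b m c, f (pv j a b m c) = g (pv j a b m c)) -> f =1 g)
  (opUD : {morph opU : x y / x + y}) (opUZ : forall c, {morph opU : x / c *: x})
  (opDD : {morph opD : x y / x + y}) (opDZ : forall c, {morph opD : x / c *: x})
  (opED : forall i, {morph opE i : x y / x + y})
  (opEZ : forall i c, {morph opE i : x / c *: x})
  (opU_pv : forall j a b m c, opU (pv j a b m c) = pv (ordS j) a b m c.+1)
  (opE_pv : forall i j a b m c,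
    opE i (pv j a b m c) = if j == i then pv j a b m c else 0)
  (opD0 : forall j a b m c, (c %% 4)%N = 0%N ->
    opD (pv j a b m c) = I ^+ b *: pv (ord_pred j) a.+1 b m c)
  (opD1 : forall j a b m c, (c %% 4)%N = 0%N -> opD (pv j a b m c.+1) =
    pv (ord_pred j) a b.+1 m c - (I * I ^+ b) *: pv (ord_pred j) a.+1 b m c.+1)
  (opD2 : forall j a b m c, (c %% 4)%N = 0%N -> opD (pv j a b m c.+2) =
    pv (ord_pred j) a b m.+1 c - I ^+ b *: pv (ord_pred j) a.+1 b m c.+2)
  (opD3 : forall j a b m c, (c %% 4)%N = 0%N -> opD (pv j a b m c.+3) =
    pv (ord_pred j) a b m.+1 c.+1 - pv (ord_pred j) a b.+1 m c.+2
    + (I * I ^+ b) *: pv (ord_pred j) a.+1 b m c.+3).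

Let coN t : {morph co t : x / - x}.
Proof. by move=> x; rewrite -scaleN1r coZ mulN1r. Qed.
Let opUN : {morph opU : x / - x}.
Proof. by move=> x; rewrite -scaleN1r opUZ scaleN1r. Qed.
Let opDN : {morph opD : x / - x}.
Proof. by move=> x; rewrite -scaleN1r opDZ scaleN1r. Qed.
Let opEN i : {morph opE i : x / - x}.
Proof. by move=> x; rewrite -scaleN1r opEZ scaleN1r. Qed.
Let op_U0 : opU 0 = 0. Proof. by rewrite -(scale0r 0) opUZ !scale0r. Qed.
Let op_D0 : opD 0 = 0. Proof. by rewrite -(scale0r 0) opDZ !scale0r. Qed.
Let op_E0 i : opE i 0 = 0. Proof. by rewrite -(scale0r 0) opEZ !scale0r. Qed.

Let c8 c : (c %% 4)%N = 0%N -> (c.+4 %% 4)%N = 0%N.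
Proof. by move=> c4; rewrite -addn4 -modnDml c4. Qed.

(** The formula for the action of [d] depends on the exponent of [u] modulo 4, so an identity is
    tested on four consecutive exponents starting at a multiple of 4. *)
Let ext4 (f g : V -> V) : linear f -> linear g ->
  (forall j a b m c, (c %% 4)%N = 0%N ->
    [/\ f (pv j a b m c) = g (pv j a b m c),
        f (pv j a b m c.+1) = g (pv j a b m c.+1),
        f (pv j a b m c.+2) = g (pv j a b m c.+2) &
        f (pv j a b m c.+3) = g (pv j a b m c.+3)]) -> f =1 g.
Proof.
move=> fl gl fg; apply: pv_ext => // j a b m c.
move: (c %/ 4 * 4)%N (divn_eq c 4) (modnMl (c %/ 4) 4) (ltn_pmod c (isT : 0 < 4)%N).
move=> q Ec q4; move: (c %% 4)%N Ec => r -> r4; have [E0 E1 E2 E3] := fg j a b m q q4.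
by case: r r4 => [|[|[|[|]]]] // _; rewrite ?addn0 ?addn1 ?addn2 ?addn3.
Qed.

Ltac op_linear := apply: linear_morphs;
  move=> ? ?; rewrite ?(opUD, opDD, opED, opUZ, opDZ, opEZ, opprD, scalerN) //.

Ltac period_simp c4 :=
  rewrite ?(opUD, opDD, opED, opUZ, opDZ, opEZ, opUN, opDN, opEN, opU_pv,
    ordSK, ord_predK, opD0 _ _ _ _ c4, opD1 _ _ _ _ c4, opD2 _ _ _ _ c4,
    opD3 _ _ _ _ c4, opD0 _ _ _ _ (c8 c4), opD1 _ _ _ _ (c8 c4),
    opD2 _ _ _ _ (c8 c4)).

Ltac period_ring :=
  let t := fresh "t" in apply: co_inj => t;
  rewrite ?(coD, coN, coZ, exprS); ring: II.

(** The operators act from the right, so the word d d u becomes [opU (opD (opD x))]. Read through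
    the coordinates [co], each case is a polynomial identity over the field modulo I^2 = -1. *)
Lemma periodic_rel1 x : opU (opD (opD x)) = - opD (opD (opU x)).
Proof.
apply: (ext4 (f := fun x => opU (opD (opD x)))
  (g := fun x => - opD (opD (opU x)))) x => [||j a b m c c4].
- by op_linear.
- by op_linear.
by split; period_simp c4; period_ring.
Qed.

Lemma periodic_rel2 x : opU (opU (opU (opD x))) =
  opU (opU (opD (opU x))) - opU (opD (opU (opU x))) + opD (opU (opU (opU x))).
Proof.
apply: (ext4 (f := fun x => opU (opU (opU (opD x)))) (g := fun x =>
  opU (opU (opD (opU x))) - opU (opD (opU (opU x))) + opD (opU (opU (opU x))))) x
  => [||j a b m c c4].
- by op_linear.
- apply: linear_morphs => [y z|s y].
    by rewrite !(opUD, opDD) opprD [RHS]addrACA; congr (_ + _); rewrite addrACA.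
  by rewrite !(opUZ, opDZ) scalerDr scalerBr.
by split; period_simp c4; period_ring.
Qed.

Lemma periodic_EU i x : opE (ordS i) (opU x) = opU (opE i x).
Proof.
apply: (pv_ext (f := fun x => opE (ordS i) (opU x))
  (g := fun x => opU (opE i x))) x => [||j a b m c].
- by op_linear.
- by op_linear.
rewrite opU_pv !opE_pv (inj_eq (can_inj (@ordSK n))).
by case: eqP => _; rewrite ?opU_pv ?op_U0.
Qed.

Lemma periodic_ED i x : opE i (opD x) = opD (opE (ordS i) x).
Proof.
apply: (ext4 (f := fun x => opE i (opD x))
  (g := fun x => opD (opE (ordS i) x))) x => [||j a b m c c4].
- by op_linear.
- by op_linear.
have opEi (p q r s : nat) : opE i (pv (ord_pred j) p q r s) =
    if j == ordS i then pv (ord_pred j) p q r s else 0.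
  by rewrite opE_pv -(inj_eq (can_inj (@ordSK n))) ord_predK.
have opD_if f : opD (if j == ordS i then f else 0) = if j == ordS i then opD f else 0.
  by case: eqP => // _; rewrite op_D0.
rewrite !opE_pv !opD_if; split; period_simp c4; rewrite !opEi;
  by case: eqP => // _; rewrite ?scaler0 ?subrr ?addr0.
Qed.

Lemma periodic_EE i i' x : opE i (opE i' x) = if i == i' then opE i x else 0.
Proof.
apply: (pv_ext (f := fun x => opE i (opE i' x))
  (g := fun x => if i == i' then opE i x else 0)) x => [||j a b m c].
- by op_linear.
- by case: eqP => _; [op_linear | apply: linear_morphs => ? ?; rewrite ?addr0 ?scaler0].
rewrite !opE_pv; case: eqP => [->|ji']; first by rewrite opE_pv [i' == i]eq_sym; case: eqP.
by rewrite op_E0; case: (i =P i') => // ->; case: eqP ji'.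
Qed.

Lemma periodic_E1 x : \sum_i opE i x = x.
Proof.
apply: (pv_ext (f := fun x => \sum_i opE i x) (g := id)) x => [||j a b m c].
- apply: linear_morphs => [y z|s y].
    by rewrite -big_split; apply: eq_bigr => i _; apply: opED.
  by rewrite scaler_sumr; apply: eq_bigr => i _; apply: opEZ.
- by [].
rewrite (bigD1 j) //= opE_pv eqxx big1 ?addr0 // => i ij.
by rewrite opE_pv eq_sym (negPf ij).
Qed.

End PeriodicAction.

Definition pbw (n : nat) : Type := 'I_n * nat * nat * nat * nat.
HB.instance Definition _ n := Choice.on (pbw n).

Definition pbw_deg n (p : pbw n) : nat :=
  let: (_, a, b, m, c) := p in (a + b.*2 + m * 3 + c)%N.

Section RegularRepresentation.
Variables (k : fieldType) (n : nat) (I : k).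
Hypothesis II : I * I = -1.

Local Notation V := {malg k[pbw n]}.

Definition pv (j : 'I_n) (a b m c : nat) : V := << (j, a, b, m, c) : pbw n >>.

Definition opU : V -> V :=
  plin (fun p => let: (j, a, b, m, c) := p in pv (ordS j) a b m c.+1).

(* Right multiplication by d on the monomials d^a z^b w^m u^c e_j: the letter  *)
(* d moves to the left of u^c by u^4 d = d u^4, u d = z - I d u,              *)
(* u^2 d = w - d u^2 and u^3 d = w u - z u^2 + I d u^3.                       *)
Definition opD : V -> V :=
  plin (fun p => let: (j, a, b, m, c) := p in let i := ord_pred j in
    match (c %% 4)%N with
    | 0 => I ^+ b *: pv i a.+1 b m c
    | 1 => pv i a b.+1 m c.-1 - (I * I ^+ b) *: pv i a.+1 b m c
    | 2 => pv i a b m.+1 c.-2 - I ^+ b *: pv i a.+1 b m c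
    | _ => pv i a b m.+1 c.-2 - pv i a b.+1 m c.-1
           + (I * I ^+ b) *: pv i a.+1 b m c
    end).

Definition opE (i : 'I_n) : V -> V :=
  plin (fun p => let: (j, a, b, m, c) := p in if j == i then pv j a b m c else 0).

Lemma opU_pv j a b m c : opU (pv j a b m c) = pv (ordS j) a b m c.+1.
Proof. exact: plinU. Qed.

Lemma opE_pv i j a b m c :
  opE i (pv j a b m c) = if j == i then pv j a b m c else 0.
Proof. exact: plinU. Qed.

Lemma opD_pv0 j a b m c : (c %% 4)%N = 0%N ->
  opD (pv j a b m c) = I ^+ b *: pv (ord_pred j) a.+1 b m c.
Proof. by move=> c4; rewrite [LHS]plinU c4. Qed.

Lemma opD_pv1 j a b m c : (c %% 4)%N = 0%N -> opD (pv j a b m c.+1) =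
  pv (ord_pred j) a b.+1 m c - (I * I ^+ b) *: pv (ord_pred j) a.+1 b m c.+1.
Proof.
move=> c4; have c4' : (c.+1 %% 4 = 1)%N by rewrite -addn1 -modnDml c4.
by rewrite [LHS]plinU c4'.
Qed.

Lemma opD_pv2 j a b m c : (c %% 4)%N = 0%N -> opD (pv j a b m c.+2) =
  pv (ord_pred j) a b m.+1 c - I ^+ b *: pv (ord_pred j) a.+1 b m c.+2.
Proof.
move=> c4; have c4' : (c.+2 %% 4 = 2)%N by rewrite -addn2 -modnDml c4.
by rewrite [LHS]plinU c4'.
Qed.

Lemma opD_pv3 j a b m c : (c %% 4)%N = 0%N -> opD (pv j a b m c.+3) =
  pv (ord_pred j) a b m.+1 c.+1 - pv (ord_pred j) a b.+1 m c.+2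
  + (I * I ^+ b) *: pv (ord_pred j) a.+1 b m c.+3.
Proof.
move=> c4; have c4' : (c.+3 %% 4 = 3)%N by rewrite -addn3 -modnDml c4.
by rewrite [LHS]plinU c4'.
Qed.

Let pv_ext (f g : V -> V) : linear f -> linear g ->
  (forall j a b m c, f (pv j a b m c) = g (pv j a b m c)) -> f =1 g.
Proof.
move=> fl gl fg; apply: malg_lin_ext => // -[[[[j a] b] m] c]; exact: fg.
Qed.

Let opUD : {morph opU : x y / x + y}. Proof. exact: plinD. Qed.
Let opUZ c : {morph opU : x / c *: x}. Proof. exact: plinZ. Qed.
Let opDD : {morph opD : x y / x + y}. Proof. exact: plinD. Qed.
Let opDZ c : {morph opD : x / c *: x}. Proof. exact: plinZ. Qed.
Let opED i : {morph opE i : x y / x + y}. Proof. exact: plinD. Qed.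
Let opEZ i c : {morph opE i : x / c *: x}. Proof. exact: plinZ. Qed.

Let coeffD (p : pbw n) : {morph (fun x : V => x@_p) : x y / x + y}.
Proof. by move=> x y; apply: mcoeffD. Qed.
Let coeffZ (p : pbw n) s (x : V) : (s *: x)@_p = s * x@_p.
Proof. exact: mcoeffZ. Qed.
Let coeff_inj (x y : V) : (forall p, x@_p = y@_p) -> x = y.
Proof. by move=> xy; apply/malgP. Qed.

Lemma op_rel1 x : opU (opD (opD x)) = - opD (opD (opU x)).
Proof.
exact: (@periodic_rel1 k I V _ n _ pv opU opD II coeffD coeffZ coeff_inj pv_ext
  opUD opUZ opDD opDZ opU_pv opD_pv0 opD_pv1 opD_pv2 opD_pv3).
Qed.

Lemma op_rel2 x : opU (opU (opU (opD x))) =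
  opU (opU (opD (opU x))) - opU (opD (opU (opU x))) + opD (opU (opU (opU x))).
Proof.
exact: (@periodic_rel2 k I V _ n _ pv opU opD II coeffD coeffZ coeff_inj pv_ext
  opUD opUZ opDD opDZ opU_pv opD_pv0 opD_pv1 opD_pv2 opD_pv3).
Qed.

Lemma op_EU i x : opE (ordS i) (opU x) = opU (opE i x).
Proof. exact: (periodic_EU pv_ext opUD opUZ opED opEZ opU_pv opE_pv). Qed.

Lemma op_ED i x : opE i (opD x) = opD (opE (ordS i) x).
Proof.
exact: (periodic_ED pv_ext opDD opDZ opED opEZ opE_pv opD_pv0 opD_pv1 opD_pv2 opD_pv3).
Qed.

Lemma op_EE i j x : opE i (opE j x) = if i == j then opE i x else 0.
Proof. exact: (periodic_EE pv_ext opED opEZ opE_pv). Qed.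

Lemma op_E1 x : \sum_i opE i x = x.
Proof. exact: (periodic_E1 pv_ext opED opEZ opE_pv). Qed.

End RegularRepresentation.

(** * The algebra D, its two relations, and its action on the monomials *)

Section CyclicWords.
Variables (R : pzRingType) (n : nat) (e uu dd : 'I_n -> R) (u d : R).
Hypotheses (ee : forall i j, e i * e j = if i == j then e i else 0)
  (eu : forall i, e i * u = uu i) (ue : forall i, u * e (ordS i) = uu i)
  (ed : forall i, e (ordS i) * d = dd i) (de : forall i, d * e i = dd i).

Let u_word i x : u * (e (ordS i) * x) = e i * (u * x).
Proof. by rewrite !mulrA ue eu. Qed.

Let d_word i x : d * (e i * x) = e (ordS i) * (d * x).
Proof. by rewrite !mulrA de ed. Qed.

Let e_word i x : e i * (e i * x) = e i * x.
Proof. by rewrite mulrA ee eqxx. Qed.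

(** Each arrow is [u] or [d] cut by an idempotent, and the idempotents can all be pushed to the left
    end of a word, where they merge into the one of the starting vertex [ordS i]. *)
Lemma cyclic_rel1 i : let i0 := ord_pred i in let i1 := ordS i in
  dd i * dd i0 * uu i0 - (- (uu i1 * dd i1 * dd i)) =
  e i1 * (d * d * u + u * d * d).
Proof.
move=> /=; move: (ord_pred i) (ord_predK i) => i0 <-.
by rewrite opprK mulrDr -!ed -!eu -!mulrA !(d_word, u_word, e_word).
Qed.

Lemma cyclic_rel2 i : let i1 := ordS i in let i2 := ordS i1 in let i3 := ordS i2 in
  dd i * uu i * uu i1 * uu i2
    - (uu i1 * dd i1 * uu i1 * uu i2 - uu i1 * uu i2 * dd i2 * uu i2
       + uu i1 * uu i2 * uu i3 * dd i3) =
  e i1 * (d * u * u * u - (u * d * u * u - u * u * d * u + u * u * u * d)).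
Proof.
rewrite /= !mulrBr mulrDr mulrBr -!ed -!eu -!mulrA.
by rewrite !(u_word, d_word, e_word).
Qed.

End CyclicWords.

Section AlgebraD.
Variables (k : fieldType) (n : nat).

Local Notation PA := (pathalg k (Qbar n)).

Definition pe (i : 'I_n) : PA := << vpath (i : vertex (Qbar n)) >>.
Definition pu : PA := \sum_i u_ k i.
Definition pd : PA := \sum_i d_ k i.

Lemma arr_startE i a : pe i * arr k a = if source a == i then arr k a else 0.
Proof.
rewrite [LHS]pathmulUU; case: eqP => [<-|/eqP ne]; last first.
  by rewrite pcat_None // eq_sym.
have [|r -> Er] := @pcat_Some _ (vpath (source a)) (apath a); first exact: eqxx.
by congr (<< _ >>); apply: val_inj; rewrite Er.
Qed.

Lemma arr_endE i a : arr k a * pe i = if target a == i then arr k a else 0.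
Proof.
rewrite [LHS]pathmulUU; case: eqP => [<-|/eqP ne]; last by rewrite pcat_None.
have [|r -> Er] := @pcat_Some _ (apath a) (vpath (target a)); first exact: eqxx.
by congr (<< _ >>); apply: val_inj; rewrite Er.
Qed.

Lemma sum_delta_ord (M : nmodType) (f : 'I_n -> 'I_n) (F : 'I_n -> M) i j :
  injective f -> f i = j ->
  \sum_l (if f l == j then F l else 0) = F i.
Proof.
move=> f_inj <-; rewrite (bigD1 i) //= eqxx big1 ?addr0 // => l li.
by rewrite (inj_eq f_inj) (negPf li).
Qed.

Lemma pe_pu i : pe i * pu = u_ k i.
Proof.
rewrite mulr_sumr; under eq_bigr do rewrite arr_startE.
exact: (@sum_delta_ord _ id).
Qed.

Lemma pu_pe i : pu * pe (ordS i) = u_ k i.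
Proof.
rewrite mulr_suml; under eq_bigr do rewrite arr_endE.
exact/(@sum_delta_ord _ (@ordS n))/erefl/can_inj/ordSK.
Qed.

Lemma pe_pd i : pe (ordS i) * pd = d_ k i.
Proof.
rewrite mulr_sumr; under eq_bigr do rewrite arr_startE.
exact/(@sum_delta_ord _ (@ordS n))/erefl/can_inj/ordSK.
Qed.

Lemma pd_pe i : pd * pe i = d_ k i.
Proof.
rewrite mulr_suml; under eq_bigr do rewrite arr_endE.
exact: (@sum_delta_ord _ id).
Qed.

Lemma pe_pe i j : pe i * pe j = if i == j then pe i else 0.
Proof.
rewrite [LHS]pathmulUU; case: eqP => [<-|/eqP ne]; last by rewrite pcat_None.
have [|r -> Er] := @pcat_Some _ (vpath (i : vertex (Qbar n))) (vpath (i : vertex (Qbar n))).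
  exact: eqxx.
by congr (<< _ >>); apply: val_inj; rewrite Er.
Qed.

Lemma pe_sum : \sum_i pe i = 1.
Proof. by []. Qed.

Lemma D_rel1E i : let i0 := ord_pred i in let i1 := ordS i in
  d_ k i * d_ k i0 * u_ k i0 - (- (u_ k i1 * d_ k i1 * d_ k i)) =
  pe i1 * (pd * pd * pu + pu * pd * pd).
Proof. exact: (cyclic_rel1 pe_pe pe_pu pu_pe pe_pd pd_pe). Qed.

Lemma D_rel2E i : let i1 := ordS i in let i2 := ordS i1 in let i3 := ordS i2 in
  d_ k i * u_ k i * u_ k i1 * u_ k i2
    - (u_ k i1 * d_ k i1 * u_ k i1 * u_ k i2 - u_ k i1 * u_ k i2 * d_ k i2 * u_ k i2
       + u_ k i1 * u_ k i2 * u_ k i3 * d_ k i3) =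
  pe i1 * (pd * pu * pu * pu
    - (pu * pd * pu * pu - pu * pu * pd * pu + pu * pu * pu * pd)).
Proof. exact: (cyclic_rel2 pe_pe pe_pu pu_pe pe_pd pd_pe). Qed.

End AlgebraD.

Lemma malg_bilin_ext (k : fieldType) (K K' : choiceType) (W : lmodType k)
    (F G : {malg k[K]} -> {malg k[K']} -> W) :
  (forall y, linear (F^~ y)) -> (forall x, linear (F x)) ->
  (forall y, linear (G^~ y)) -> (forall x, linear (G x)) ->
  (forall p q, F << p >> << q >> = G << p >> << q >>) -> F =2 G.
Proof.
move=> Fl Fr Gl Gr FG x y; move: x; apply: malg_lin_ext => // p.
by move: y; apply: malg_lin_ext.
Qed.

Section PathProduct.
Variables (k : fieldType) (Q : quiver).

Lemma pathmul_linl (y : pathalg k Q) : linear (fun x : pathalg k Q => pathmul x y).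
Proof.
by apply: linear_morphs => [x x'|c x]; [rewrite pathmulDl | rewrite pathmulZl].
Qed.

Lemma pathmul_linr (x : pathalg k Q) : linear (pathmul x).
Proof.
by apply: linear_morphs => [y y'|c y]; [rewrite pathmulDr | rewrite pathmulZr].
Qed.

End PathProduct.

Lemma ring_map_rels (R S : pzRingType) (f : R -> S) :
  (forall x y, f x + f y = f (x + y)) -> (forall x y, f x * f y = f (x * y)) ->
  (forall x, - f x = f (- x)) -> forall e d u,
  f e * (f d * f d * f u + f u * f d * f d) = f (e * (d * d * u + u * d * d)) /\
  f e * (f d * f u * f u * f u -
    (f u * f d * f u * f u - f u * f u * f d * f u + f u * f u * f u * f d)) =
  f (e * (d * u * u * u - (u * d * u * u - u * u * d * u + u * u * u * d))).
Proof. by move=> fD fM fN e d u; rewrite !(fM, fN, fD, fM). Qed.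

Section QuotientMap.
Variables (k : fieldType) (n : nat).
Local Notation Dpi := (quot_pi (@D_rel k n)).

Lemma DpiM x y : Dpi x * Dpi y = Dpi (x * y).
Proof. exact: quot_mulE. Qed.

Lemma DpiD x y : Dpi x + Dpi y = Dpi (x + y).
Proof. exact: quot_addE. Qed.

Lemma DpiN x : - Dpi x = Dpi (- x).
Proof. exact: quot_oppE. Qed.

Lemma DpiZ c x : kscale c (Dpi x) = Dpi (kscale c x).
Proof. exact: quot_scaleE. Qed.

End QuotientMap.

Section PathAction.
Variables (k : fieldType) (n : nat) (V : lmodType k).
Variables (opU opD : V -> V) (opE : 'I_n -> V -> V).
Hypotheses
  (opUD : {morph opU : x y / x + y}) (opUZ : forall c, {morph opU : x / c *: x})
  (opDD : {morph opD : x y / x + y}) (opDZ : forall c, {morph opD : x / c *: x})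
  (opED : forall i, {morph opE i : x y / x + y})
  (opEZ : forall i c, {morph opE i : x / c *: x})
  (opEE : forall i j x, opE i (opE j x) = if i == j then opE i x else 0)
  (opE1 : forall x, \sum_i opE i x = x)
  (opEU : forall i x, opE (ordS i) (opU x) = opU (opE i x))
  (opEDr : forall i x, opE i (opD x) = opD (opE (ordS i) x))
  (op_rel1 : forall x, opU (opD (opD x)) = - opD (opD (opU x)))
  (op_rel2 : forall x, opU (opU (opU (opD x))) =
     opU (opU (opD (opU x))) - opU (opD (opU (opU x))) + opD (opU (opU (opU x)))).
Local Notation PA := (pathalg k (Qbar n)).

Let opU0 : opU 0 = 0. Proof. by rewrite -(scale0r 0) opUZ !scale0r. Qed.
Let opD0 : opD 0 = 0. Proof. by rewrite -(scale0r 0) opDZ !scale0r. Qed.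
Let opE0 i : opE i 0 = 0. Proof. by rewrite -(scale0r 0) opEZ !scale0r. Qed.

Definition act_arrow (v : V) (a : 'I_n + 'I_n) : V :=
  match a with inl i => opU (opE i v) | inr i => opD (opE (ordS i) v) end.

Definition act_path (v : V) (p : qpath (Qbar n)) : V :=
  foldl act_arrow (opE (pstart p) v) (val p).2.

Definition path_act (v : V) (x : PA) : V := plin (act_path v) x.

Lemma act_arrow_source v a : act_arrow (opE (source (a : arrow (Qbar n))) v) a = act_arrow v a.
Proof. by case: a => i /=; rewrite opEE eqxx. Qed.

Lemma act_arrow_target v (a : arrow (Qbar n)) i :
  opE i (act_arrow v a) = if i == target a then act_arrow v a else 0.
Proof.
case: a => j /=.
  have [->|ne] := eqVneq; first by rewrite opEU opEE eqxx.
  by rewrite -[i](ord_predK) opEU opEE -(inj_eq (can_inj (@ordSK n))) ord_predK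
    (negPf ne) opU0.
by rewrite opEDr opEE (inj_eq (can_inj (@ordSK n))); case: eqP => [->|_] //;
  rewrite opD0.
Qed.

Lemma act_arrowD v v' a : act_arrow (v + v') a = act_arrow v a + act_arrow v' a.
Proof. by case: a => i /=; rewrite opED ?opUD ?opDD. Qed.

Lemma act_arrowZ c v a : act_arrow (c *: v) a = c *: act_arrow v a.
Proof. by case: a => i /=; rewrite opEZ ?opUZ ?opDZ. Qed.

Lemma act_arrow0 a : act_arrow 0 a = 0.
Proof. by case: a => i /=; rewrite opE0 (opU0, opD0). Qed.

Lemma act_pathD v v' p : act_path (v + v') p = act_path v p + act_path v' p.
Proof.
rewrite /act_path opED; elim: (val p).2 (opE _ v) (opE _ v') => [//|a s IHs] x y /=.
by rewrite act_arrowD IHs.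
Qed.

Lemma act_pathZ c v p : act_path (c *: v) p = c *: act_path v p.
Proof.
rewrite /act_path opEZ; elim: (val p).2 (opE _ v) => [//|a s IHs] x /=.
by rewrite act_arrowZ IHs.
Qed.

Lemma act_path_end v p i :
  opE i (act_path v p) = if i == pend p then act_path v p else 0.
Proof.
rewrite /act_path /pend /pstart; case: p => -[j s] /= _.
have : opE i (opE j v) = if i == j then opE j v else 0 by rewrite opEE; case: eqP => // ->.
elim: s j (opE j v) => [//|a s IHs] j x _ /=; apply: IHs.
exact: act_arrow_target.
Qed.

Lemma path_actD v : {morph path_act v : x y / x + y}.
Proof. exact: plinD. Qed.
Lemma path_actZ v c : {morph path_act v : x / c *: x}.
Proof. exact: plinZ. Qed.
Lemma path_actDl x v v' : path_act (v + v') x = path_act v x + path_act v' x.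
Proof. by rewrite -plin_addf; apply: plin_ext => p; apply: act_pathD. Qed.
Lemma path_actZl x c v : path_act (c *: v) x = c *: path_act v x.
Proof. by rewrite -plin_scalef; apply: plin_ext => p; apply: act_pathZ. Qed.
Lemma path_act0 v : path_act v 0 = 0. Proof. exact: plin0. Qed.
Lemma path_act0l x : path_act 0 x = 0.
Proof. by rewrite -(scale0r 0) path_actZl !scale0r. Qed.

Lemma path_act_linear v : linear (path_act v).
Proof. exact: linear_morphs (path_actD v) (path_actZ v). Qed.

(** Composable paths act by concatenation of their arrows. For other pairs the end idempotent of the
    first and the start idempotent of the second annihilate each other, as the product of the paths
    does. *)
Lemma path_actM v x y : path_act v (pathmul x y) = path_act (path_act v x) y.
Proof.
apply: (malg_bilin_ext (F := fun x y => path_act v (pathmul x y))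
  (G := fun x y => path_act (path_act v x) y)) x y => [y c x x'|x c y y'|y c x x'|x|p q].
- exact: etrans (congr1 _ (pathmul_linl y c x x')) (path_act_linear v _ _ _).
- exact: etrans (congr1 _ (pathmul_linr x c y y')) (path_act_linear v _ _ _).
- apply: (etrans (congr1 (path_act^~ y) (path_act_linear v c x x'))).
  exact: (etrans (path_actDl _ _ _) (congr1 (+%R^~ _) (path_actZl _ _ _))).
- exact: path_act_linear.
rewrite pathmulUU {2}/path_act plinU {2}/path_act plinU.
rewrite -[RHS]/(foldl act_arrow (opE (pstart q) (act_path v p)) (val q).2).
rewrite act_path_end [pstart q == _]eq_sym.
case: eqP => [Epq|/eqP ne]; last first.
  rewrite pcat_None //= path_act0; elim: (val q).2 => [//|a s IHs] /=.
  by rewrite act_arrow0.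
have [|r -> Er] := @pcat_Some _ p q; first exact/eqP.
by rewrite [LHS]plinU /act_path /pstart Er foldl_cat.
Qed.

Lemma path_act1 v : path_act v 1 = v.
Proof.
rewrite /path_act [1]/(pathone k (Qbar n)) /pathone plin_sum.
under eq_bigr do rewrite plinU.
rewrite /act_path /pstart /=.
exact: opE1.
Qed.

Lemma path_act_pe v i : path_act v (pe k i) = opE i v.
Proof. by rewrite [LHS]plinU. Qed.

Lemma path_act_arr v a : path_act v (arr k a) = act_arrow v a.
Proof. by rewrite [LHS]plinU /act_path /= act_arrow_source. Qed.

Lemma path_act_pu v : path_act v (pu k n) = opU v.
Proof.
rewrite -[pu k n]mul1r path_actM path_act1 /pu /path_act plin_sum.
under eq_bigr do rewrite -[plin _ _]/(path_act _ _) path_act_arr /=.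
rewrite -{2}[v]path_act1 /path_act [1]/(pathone k (Qbar n)) /pathone plin_sum.
rewrite (big_morph _ opUD (id1 := 0)) //.
by apply: eq_bigr => i _; rewrite plinU.
Qed.

Lemma path_act_pd v : path_act v (pd k n) = opD v.
Proof.
rewrite /pd /path_act plin_sum.
under eq_bigr do rewrite -[plin _ _]/(path_act _ _) path_act_arr /=.
rewrite -{2}[v]path_act1 /path_act [1]/(pathone k (Qbar n)) /pathone plin_sum.
rewrite (big_morph _ opDD (id1 := 0)) //.
rewrite [RHS](reindex_inj (can_inj (@ordSK n))).
by apply: eq_bigr => i _; rewrite plinU.
Qed.

Lemma path_act_prod v x y : path_act v (x * y) = path_act (path_act v x) y.
Proof. exact: path_actM. Qed.

Lemma path_act_linB v x y : path_act v (x - y) = path_act v x - path_act v y.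
Proof. by rewrite path_actD -[- y]scaleN1r path_actZ scaleN1r. Qed.

Let act_rels (R : pzRingType) (act : V -> R -> V) (u d e : R) :
  (forall v, {morph act v : x y / x + y}) -> (forall v, {morph act v : x y / x - y}) ->
  (forall v x y, act v (x * y) = act (act v x) y) ->
  (forall v, act v u = opU v) -> (forall v, act v d = opD v) ->
  forall v, act v (e * (d * d * u + u * d * d)) = 0 /\
    act v (e * (d * u * u * u - (u * d * u * u - u * u * d * u + u * u * u * d))) = 0.
Proof.
move=> actD actB actM actu actd v; rewrite !actM; move: (act v e) => {e}v.
by rewrite !(actB, actD, actM, actu, actd) op_rel1 op_rel2 addNr subrr.
Qed.

(** The elements acting as zero on every vector form a two-sided ideal, and it contains the
    relations. *)
Lemma path_act_rel v x : gen_ideal (@D_rel k n) x -> path_act v x = 0.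
Proof.
move=> Ix; move: v; apply: (Ix (fun x => forall v, path_act v x = 0)) => [|y [i]].
  split=> [v|y z y0 z0 v|a y y0 v|a y y0 v]; first exact: path_act0.
  - by rewrite path_actD y0 z0 addr0.
  - by rewrite path_act_prod y0.
  by rewrite path_act_prod y0 path_act0l.
have rels := act_rels (pe k (ordS i)) path_actD path_act_linB path_act_prod
  path_act_pu path_act_pd.
case=> Ey v; have [rel1 rel2] := rels v.
  by rewrite (etrans Ey (D_rel1E k i)); exact: rel1.
by rewrite (etrans Ey (D_rel2E k i)); exact: rel2.
Qed.

Local Notation Dpi := (quot_pi (@D_rel k n)).

Definition quot_act (v : V) (x : algD k n) : V := path_act v (repr x).

Lemma quot_act_pi v x : quot_act v (Dpi x) = path_act v x.
Proof.
by apply: subr0_eq; rewrite -path_act_linB path_act_rel //; apply: repr_quot.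
Qed.

Lemma quot_actD v x y : quot_act v (x + y) = quot_act v x + quot_act v y.
Proof.
elim/quot_ind: x => x; elim/quot_ind: y => y.
by rewrite DpiD !quot_act_pi path_actD.
Qed.

Lemma quot_actZ v c x : quot_act v (kscale c x) = c *: quot_act v x.
Proof.
elim/quot_ind: x => x.
by rewrite DpiZ !quot_act_pi path_actZ.
Qed.

Lemma quot_actM v x y : quot_act v (x * y) = quot_act (quot_act v x) y.
Proof.
elim/quot_ind: x => x; elim/quot_ind: y => y.
by rewrite DpiM !quot_act_pi path_act_prod.
Qed.

Lemma quot_act1 v : quot_act v 1 = v.
Proof. exact: etrans (quot_act_pi _ _) (path_act1 _). Qed.

Lemma quot_act_pu v : quot_act v (Dpi (pu k n)) = opU v.
Proof. exact: etrans (quot_act_pi _ _) (path_act_pu _). Qed.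

Lemma quot_act_pd v : quot_act v (Dpi (pd k n)) = opD v.
Proof. exact: etrans (quot_act_pi _ _) (path_act_pd _). Qed.

Lemma quot_act_pe v i : quot_act v (Dpi (pe k i)) = opE i v.
Proof. exact: etrans (quot_act_pi _ _) (path_act_pe _ _). Qed.

Lemma path_act_deg (vdeg : nat -> V -> Prop) t v x (j : nat) :
  (forall t, vdeg t 0) -> (forall t x y, vdeg t x -> vdeg t y -> vdeg t (x + y)) ->
  (forall t c x, vdeg t x -> vdeg t (c *: x)) ->
  (forall t x, vdeg t x -> vdeg t.+1 (opU x)) ->
  (forall t x, vdeg t x -> vdeg t.+1 (opD x)) ->
  (forall t i x, vdeg t x -> vdeg t (opE i x)) ->
  vdeg t v -> path_deg j x -> vdeg (t + j)%N (path_act v x).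
Proof.
move=> d0 dD dZ dU dDn dE dv dx; rewrite /path_act /plin big_seq.
elim/big_rec: _ => [|p y /dx [<-] dy]; first exact: d0.
apply: dD dy; apply: dZ; rewrite /act_path /plength.
elim: (val p).2 (opE _ v) (t) (dE _ (pstart p) _ dv) => [|a s IHs] /= w r dw.
  by rewrite addn0.
by rewrite addnS -addSn; apply: IHs; case: a => i /=; [apply/dU/dE | apply/dDn/dE].
Qed.

End PathAction.

Section DRelations.
Variables (k : fieldType) (n : nat).
Local Notation Dpi := (quot_pi (@D_rel k n)).

Definition Du : algD k n := Dpi (pu k n).
Definition Dd : algD k n := Dpi (pd k n).
Definition De (i : 'I_n) : algD k n := Dpi (pe k i).

Lemma De_De i j : De i * De j = if i == j then De i else 0.
Proof.
by rewrite [LHS]DpiM pe_pe; case: eqP.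
Qed.

Lemma Dpi_sum I (r : seq I) (F : I -> pathalg k (Qbar n)) :
  Dpi (\sum_(i <- r) F i) = \sum_(i <- r) Dpi (F i).
Proof.
by elim: r => [|i r IHr]; rewrite ?big_nil // !big_cons -IHr DpiD.
Qed.

Lemma De_sum : \sum_i De i = 1.
Proof. by rewrite -Dpi_sum pe_sum. Qed.

Lemma De_Du i : De i * Du = Du * De (ordS i).
Proof. by rewrite !DpiM pe_pu pu_pe. Qed.

Lemma De_Dd i : De (ordS i) * Dd = Dd * De i.
Proof. by rewrite !DpiM pe_pd pd_pe. Qed.

Lemma D_rel0 x : D_rel x -> Dpi x = 0.
Proof.
move=> rx; apply/quot_piP; rewrite subr0; move=> J _ rJ; exact: rJ.
Qed.

Lemma sum_De0 (x : algD k n) : (forall i, De (ordS i) * x = 0) -> x = 0.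
Proof.
move=> ex; rewrite -[x]mul1r -De_sum mulr_suml big1 // => i _.
by rewrite -[i]ord_predK ex.
Qed.

Lemma D_rel1 : Dd * Dd * Du = - (Du * Dd * Dd).
Proof.
apply: subr0_eq; rewrite opprK; apply: sum_De0 => i.
have [E _] := ring_map_rels (@DpiD k n) (@DpiM k n) (@DpiN k n)
  (pe k (ordS i)) (pd k n) (pu k n).
apply: (etrans E); apply: (etrans (congr1 _ (esym (D_rel1E k i)))).
by apply: D_rel0; exists i; left.
Qed.

Lemma D_rel2 : Dd * Du * Du * Du =
  Du * Dd * Du * Du - Du * Du * Dd * Du + Du * Du * Du * Dd.
Proof.
apply: subr0_eq; apply: sum_De0 => i.
have [_ E] := ring_map_rels (@DpiD k n) (@DpiM k n) (@DpiN k n)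
  (pe k (ordS i)) (pd k n) (pu k n).
apply: (etrans E); apply: (etrans (congr1 _ (esym (D_rel2E k i)))).
by apply: D_rel0; exists i; right.
Qed.

End DRelations.

(** * Algebras with the PBW basis *)

Section HomogeneousVectors.
Variables (k : fieldType) (n : nat) (I : k).
Local Notation V := {malg k[pbw n]}.

Definition pv_deg (t : nat) (x : V) : Prop := forall p, x@_p != 0 -> pbw_deg p = t.

Lemma pv_degP t j a b m c :
  pbw_deg ((j, a, b, m, c) : pbw n) = t -> pv_deg t (pv k j a b m c).
Proof. by move=> <- p; rewrite mcoeffU; case: (eqVneq _ p) => [<-|]; rewrite ?eqxx. Qed.

Lemma pv_deg0 t : pv_deg t 0.
Proof. by move=> p; rewrite mcoeff0 eqxx. Qed.

Lemma pv_degD t x y : pv_deg t x -> pv_deg t y -> pv_deg t (x + y).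
Proof.
move=> hx hy p; rewrite mcoeffD; have [->|/hx //] := eqVneq x@_p 0.
by rewrite add0r => /hy.
Qed.

Lemma pv_degZ t s x : pv_deg t x -> pv_deg t (s *: x).
Proof. by move=> hx p; rewrite mcoeffZ mulf_eq0 negb_or => /andP[_ /hx]. Qed.

Lemma pv_degN t x : pv_deg t x -> pv_deg t (- x).
Proof. by move=> hx p; rewrite mcoeffN oppr_eq0 => /hx. Qed.

Lemma pv_deg_plin (g : pbw n -> V) t t' x :
  pv_deg t x -> (forall p, pbw_deg p = t -> pv_deg t' (g p)) -> pv_deg t' (plin g x).
Proof.
move=> hx hg; rewrite /plin big_seq; elim/big_rec: _ => [|p y ps hy].
  exact: pv_deg0.
by apply: pv_degD hy; apply/pv_degZ/hg/hx; rewrite mcoeff_neq0.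
Qed.

Lemma pv_deg_opU t x : pv_deg t x -> pv_deg t.+1 (opU x).
Proof.
move=> hx; apply: pv_deg_plin hx _ => -[[[[j a] b] m] c] <-.
by apply: pv_degP; rewrite /= addnS.
Qed.

Lemma pv_deg_opE t i x : pv_deg t x -> pv_deg t (opE i x).
Proof.
move=> hx; apply: pv_deg_plin hx _ => -[[[[j a] b] m] c] <-.
by case: eqP => _; [apply: pv_degP | apply: pv_deg0].
Qed.

Lemma pv_deg_opD t x : pv_deg t x -> pv_deg t.+1 (opD I x).
Proof.
move=> hx; apply: pv_deg_plin hx _ => -[[[[j a] b] m] c] <-.
have h0 s : pv_deg (pbw_deg ((j, a, b, m, c) : pbw n)).+1
    (s *: pv k (ord_pred j) a.+1 b m c).
  by apply/pv_degZ/pv_degP.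
have h1 : (0 < c)%N -> pv_deg (pbw_deg ((j, a, b, m, c) : pbw n)).+1
    (pv k (ord_pred j) a b.+1 m c.-1).
  by move=> c0; apply: pv_degP; rewrite /=; lia.
have h2 : (1 < c)%N -> pv_deg (pbw_deg ((j, a, b, m, c) : pbw n)).+1
    (pv k (ord_pred j) a b m.+1 c.-2).
  by move=> c0; apply: pv_degP; rewrite /=; lia.
case E: (c %% 4)%N => [|[|[|r]]].
- exact: h0.
- by apply: pv_degD (pv_degN (h0 _)); apply: h1; move: E; case: (c).
- by apply: pv_degD (pv_degN (h0 _)); apply: h2; move: E; case: (c) => [|[]].
apply: pv_degD (h0 _); apply: pv_degD.
  by apply: h2; move: E; case: (c) => [|[]].
by apply/pv_degN/h1; move: E; case: (c).
Qed.

End HomogeneousVectors.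

Section PathDegree.
Variables (k : fieldType) (Q : quiver).
Local Notation PA := (pathalg k Q).

Lemma path_degU p : path_deg (plength p) (<< p >> : PA).
Proof.
by move=> q; rewrite -mcoeff_neq0 mcoeffU; case: (eqVneq p q) => [->|]; rewrite ?eqxx.
Qed.

Lemma path_deg0 j : path_deg j (0 : PA).
Proof. by move=> p; rewrite -mcoeff_neq0 mcoeff0 eqxx. Qed.

Lemma path_degD j (x y : PA) : path_deg j x -> path_deg j y -> path_deg j (x + y).
Proof.
move=> dx dy p; rewrite -mcoeff_neq0 mcoeffD.
have [->|x0 _] := eqVneq x@_p 0; last by apply: dx; rewrite -mcoeff_neq0.
by rewrite add0r => y0; apply: dy; rewrite -mcoeff_neq0.
Qed.

Lemma path_degZ j c (x : PA) : path_deg j x -> path_deg j (c *: x).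
Proof.
move=> dx p; rewrite -mcoeff_neq0 mcoeffZ mulf_eq0 negb_or => /andP[_ x0].
by apply: dx; rewrite -mcoeff_neq0.
Qed.

Lemma path_deg_sum j I (r : seq I) (F : I -> PA) :
  (forall i, path_deg j (F i)) -> path_deg j (\sum_(i <- r) F i).
Proof.
by move=> dF; elim/big_rec: _ => [|i x _]; [exact: path_deg0 | apply: path_degD].
Qed.

Lemma path_deg_plin i j (g : qpath Q -> PA) (x : PA) : path_deg i x ->
  (forall p, (plength p)%:Z = i -> path_deg j (g p)) -> path_deg j (plin g x).
Proof.
move=> dx dg; rewrite /plin big_seq; elim/big_rec: _ => [|p y /dx /dg dp dy].
  exact: path_deg0.
by apply: path_degD dy; apply: path_degZ.
Qed.

Lemma path_degM i j (x y : PA) :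
  path_deg i x -> path_deg j y -> path_deg (i + j) (pathmul x y).
Proof.
move=> dx dy; apply: path_deg_plin dx _ => p <-; apply: path_deg_plin dy _ => q <-.
case: (boolP (pend p == pstart q)) => pq; last by rewrite pcat_None //; exact: path_deg0.
have [r -> Er] := pcat_Some pq; rewrite -PoszD.
have -> : (plength p + plength q)%N = plength r by rewrite /plength Er size_cat.
exact: path_degU.
Qed.

End PathDegree.

(* [coord] takes coordinates in the PBW basis d^a z^b w^m u^c e_j, on which   *)
(* the generators act from the right.                                         *)
Record pbw_algebra (k : fieldType) (n : nat) := PbwAlgebra {
  pbw_alg :> pzAlgType k;
  pbw_i : k;
  gu : pbw_alg;
  gd : pbw_alg;
  ge : 'I_n -> pbw_alg;
  coord : pbw_alg -> {malg k[pbw n]};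
  gr : int -> pbw_alg -> Prop;
  pbw_ii : pbw_i * pbw_i = -1;
  ge_ge : forall i j, ge i * ge j = if i == j then ge i else 0;
  ge_sum : \sum_i ge i = 1;
  ge_gu : forall i, ge i * gu = gu * ge (ordS i);
  ge_gd : forall i, ge (ordS i) * gd = gd * ge i;
  g_rel1 : gd * gd * gu = - (gu * gd * gd);
  g_rel2 : gd * gu * gu * gu = gu * gd * gu * gu - gu * gu * gd * gu + gu * gu * gu * gd;
  coordD : {morph coord : x y / x + y};
  coordZ : forall c x, coord (kscale c x) = c *: coord x;
  coord1 : coord 1 = \sum_i pv k i 0 0 0 0;
  coord_gu : forall x, coord (x * gu) = opU (coord x);
  coord_gd : forall x, coord (x * gd) = opD pbw_i (coord x);
  coord_ge : forall x i, coord (x * ge i) = opE i (coord x);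
  pbw_alg_ind : forall P : pbw_alg -> Prop, P 1 ->
    (forall x y, P x -> P y -> P (x + y)) -> (forall c x, P x -> P (kscale c x)) ->
    (forall x, P x -> P (x * gu)) -> (forall x, P x -> P (x * gd)) ->
    (forall x i, P x -> P (x * ge i)) -> forall x, P x;
  gr1 : gr 0 1;
  gr_gu : gr 1 gu;
  gr_gd : gr 1 gd;
  gr_ge : forall i, gr 0 (ge i);
  gr0 : forall j, gr j 0;
  grD : forall j x y, gr j x -> gr j y -> gr j (x + y);
  grZ : forall c j x, gr j x -> gr j (kscale c x);
  grM : forall i j x y, gr i x -> gr j y -> gr (i + j) (x * y);
  gr_coord : forall j x, gr j x -> forall p, (coord x)@_p != 0 -> (pbw_deg p)%:Z = j
}.

Section AlgebraDPbw.
Variables (k : fieldType) (n : nat) (I : k).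
Hypothesis II : I * I = -1.
Local Notation V := {malg k[pbw n]}.
Local Notation Dpi := (quot_pi (@D_rel k n)).

Let opUD : {morph @opU k n : x y / x + y}. Proof. exact: plinD. Qed.
Let opUZ c : {morph @opU k n : x / c *: x}. Proof. exact: plinZ. Qed.
Let opDD : {morph @opD k n I : x y / x + y}. Proof. exact: plinD. Qed.
Let opDZ c : {morph @opD k n I : x / c *: x}. Proof. exact: plinZ. Qed.
Let opED i : {morph @opE k n i : x y / x + y}. Proof. exact: plinD. Qed.
Let opEZ i c : {morph @opE k n i : x / c *: x}. Proof. exact: plinZ. Qed.

Definition Dact : V -> algD k n -> V := quot_act (@opU k n) (@opD k n I) (@opE k n).
(** The sum of the [pv k i 0 0 0 0] is the vector of 1, and coordinates are what an element makes of
    it; so they are defined before the monomials are known to span. *)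
Definition Dcoord : algD k n -> V := Dact (\sum_i pv k i 0 0 0 0).

Let ED := @op_ED k n I.

Let DactM v x y : Dact v (x * y) = Dact (Dact v x) y.
Proof.
exact: (quot_actM opUD opUZ opDD opDZ opED opEZ (@op_EE k n) (@op_E1 k n)
  (@op_EU k n) ED (op_rel1 II) (op_rel2 II)).
Qed.

(** An arrow is a vertex idempotent times [Du] or [Dd], so every path is reached from 1 by right
    multiplications, one arrow at a time. *)
Lemma Dalg_ind (P : algD k n -> Prop) : P 1 ->
  (forall x y, P x -> P y -> P (x + y)) -> (forall c x, P x -> P (kscale c x)) ->
  (forall x, P x -> P (x * Du k n)) -> (forall x, P x -> P (x * Dd k n)) ->
  (forall x i, P x -> P (x * De k i)) -> forall x, P x.
Proof.
move=> P1 PD PZ Pu Pd Pe.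
have Pa x (a : arrow (Qbar n)) : P x -> P (x * Dpi (arr k a)).
  move=> Px; case: a => i.
    by rewrite -[arr k _]pe_pu -DpiM mulrA; apply/Pu/Pe.
  by rewrite -[arr k _]pe_pd -DpiM mulrA; apply/Pd/Pe.
have Pp (s : seq (arrow (Qbar n))) v (sv : walk (v, s).1 (v, s).2) x :
    P x -> P (x * Dpi << exist _ (v, s) sv >>).
  elim: s v sv x => [|a s IHs] v sv x Px.
    have -> : << exist _ (v, [::]) sv >> = pe k v.
      by congr (<< _ >>); apply: val_inj.
    exact: Pe.
  have [/eqP Ea sa] := andP sv.
  have -> : << exist _ (v, a :: s) sv >> =
      arr k a * (<< exist _ (target a, s) sa >> : pathalg k (Qbar n)).
    rewrite [RHS]pathmulUU.
    have [|r -> Er] := @pcat_Some _ (apath a) (exist _ (target a, s) sa).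
      by rewrite /pend /pstart /=.
    by congr (<< _ >>); apply: val_inj; rewrite Er; congr (_, _).
  rewrite -DpiM mulrA.
  by apply: IHs; apply: Pa.
elim/quot_ind => x.
elim/malg_ind: x => [|x y Px Py|c x Px|[[v s] sv]].
- have := PZ 0 _ P1; congr P; rewrite -[1](quot_piK).
  by rewrite DpiZ; congr Dpi; apply: scale0r.
- by rewrite -DpiD; apply: PD.
- by have := PZ c _ Px; rewrite DpiZ.
by have := Pp s v sv 1 P1; rewrite mul1r.
Qed.

Lemma Dcoord_deg j x : @algD_deg k n j x ->
  forall p, (Dcoord x)@_p != 0 -> (pbw_deg p)%:Z = j.
Proof.
case=> y dy -> p.
rewrite /Dcoord /Dact (quot_act_pi opUD opUZ opDD opDZ opED opEZ (@op_EE k n)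
  (@op_E1 k n) (@op_EU k n) ED (op_rel1 II) (op_rel2 II)).
(* Paths have nonnegative length, so in a negative degree the representative [y] is 0. *)
case: j dy => [j|j] dy; last first.
  have -> : y = 0.
    by apply/malgP => q; rewrite mcoeff0; apply: mcoeff_outdom; apply/negP => /dy.
  by rewrite path_act0 mcoeff0 eqxx.
move=> y0; congr Posz; move: p y0; rewrite -/(pv_deg j _) -[j in pv_deg j]add0n.
apply: path_act_deg dy.
- exact: pv_deg0.
- exact: pv_degD.
- exact: pv_degZ.
- exact: pv_deg_opU.
- exact: pv_deg_opD.
- exact: pv_deg_opE.
by elim/big_rec: _ => [|i x' _]; [apply: pv_deg0 | apply: pv_degD; apply: pv_degP].
Qed.

Let DcoordD : {morph Dcoord : x y / x + y}.
Proof.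
exact: (quot_actD opUD opUZ opDD opDZ opED opEZ (@op_EE k n) (@op_E1 k n)
  (@op_EU k n) ED (op_rel1 II) (op_rel2 II)).
Qed.

Let DcoordZ c x : Dcoord (kscale c x) = c *: Dcoord x.
Proof.
exact: (quot_actZ opUD opUZ opDD opDZ opED opEZ (@op_EE k n) (@op_E1 k n)
  (@op_EU k n) ED (op_rel1 II) (op_rel2 II)).
Qed.

Let Dcoord1 : Dcoord 1 = \sum_i pv k i 0 0 0 0.
Proof.
exact: (quot_act1 opUD opUZ opDD opDZ opED opEZ (@op_EE k n) (@op_E1 k n)
  (@op_EU k n) ED (op_rel1 II) (op_rel2 II)).
Qed.

Let Dcoord_u x : Dcoord (x * Du k n) = opU (Dcoord x).
Proof.
apply: etrans (DactM _ _ _) _.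
exact: (quot_act_pu opUD opUZ opDD opDZ opED opEZ (@op_EE k n) (@op_E1 k n)
  (@op_EU k n) ED (op_rel1 II) (op_rel2 II)).
Qed.

Let Dcoord_d x : Dcoord (x * Dd k n) = opD I (Dcoord x).
Proof.
apply: etrans (DactM _ _ _) _.
exact: (quot_act_pd opUD opUZ opDD opDZ opED opEZ (@op_EE k n) (@op_E1 k n)
  (@op_EU k n) ED (op_rel1 II) (op_rel2 II)).
Qed.

Let Dcoord_e x i : Dcoord (x * De k i) = opE i (Dcoord x).
Proof.
apply: etrans (DactM _ _ _) _.
exact: (quot_act_pe opUD opUZ opDD opDZ opED opEZ (@op_EE k n) (@op_E1 k n)
  (@op_EU k n) ED (op_rel1 II) (op_rel2 II)).
Qed.

Let Ddeg1 : @algD_deg k n 0 (1 : algD k n).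
Proof. by exists 1 => //; apply: path_deg_sum => i; apply: path_degU. Qed.

Let Ddeg_u : @algD_deg k n 1 (Du k n).
Proof. by exists (pu k n) => //; apply: path_deg_sum => i; apply: path_degU. Qed.

Let Ddeg_d : @algD_deg k n 1 (Dd k n).
Proof. by exists (pd k n) => //; apply: path_deg_sum => i; apply: path_degU. Qed.

Let Ddeg_e i : @algD_deg k n 0 (De k i).
Proof. by exists (pe k i) => //; apply: path_degU. Qed.

Let Ddeg0 j : @algD_deg k n j (0 : algD k n).
Proof. by exists 0 => //; apply: path_deg0. Qed.

Let DdegD j (x y : algD k n) : @algD_deg k n j x -> @algD_deg k n j y -> @algD_deg k n j (x + y).
Proof.
move=> [x' dx ->] [y' dy ->]; exists (x' + y'); first exact: path_degD.
exact: DpiD.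
Qed.

Let DdegZ c j (x : algD k n) : @algD_deg k n j x -> @algD_deg k n j (kscale c x).
Proof.
move=> [x' dx ->]; exists (kscale c x'); first exact: path_degZ.
exact: DpiZ.
Qed.

Let DdegM i j (x y : algD k n) :
  algD_deg i x -> @algD_deg k n j y -> @algD_deg k n (i + j) (x * y).
Proof.
move=> [x' dx ->] [y' dy ->]; exists (x' * y'); first exact: path_degM.
exact: DpiM.
Qed.

(** The rest of the argument works with an arbitrary [pbw_algebra], which keeps the quotient
    construction out of sight. *)
Definition algD_pbw : pbw_algebra k n :=
  @PbwAlgebra k n (algD k n) I (Du k n) (Dd k n) (@De k n) Dcoord (@algD_deg k n)
    II (@De_De k n) (@De_sum k n) (@De_Du k n) (@De_Dd k n) (@D_rel1 k n) (@D_rel2 k n)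
    DcoordD DcoordZ Dcoord1 Dcoord_u Dcoord_d Dcoord_e Dalg_ind
    Ddeg1 Ddeg_u Ddeg_d Ddeg_e Ddeg0 DdegD DdegZ DdegM Dcoord_deg.

End AlgebraDPbw.

(** * The elements w and z, and the PBW basis *)

Section CentralElement.
Variables (R : pzRingType) (u d : R).
Hypotheses (rel1 : d * d * u = - (u * d * d))
  (rel2 : d * u * u * u = u * d * u * u - u * u * d * u + u * u * u * d).

Let w := u * u * d + d * u * u.

Let ok12 : ncvalid (nth 0 [:: u; d])
  [:: ([:: 1; 1; 0], [:: (Negz 0, [:: 0; 1; 1])]);
      ([:: 1; 0; 0; 0], [:: (Posz 1, [:: 0; 1; 0; 0]); (Negz 0, [:: 0; 0; 1; 0]);
                            (Posz 1, [:: 0; 0; 0; 1])])]%N.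
Proof.
rewrite /ncvalid /ncword /ncpval /= !mulr1 !addr0 !mulr1z !NegzE !mulrNz !mulr1z.
by rewrite !mulrA rel1 rel2 addrA.
Qed.

(** Commutation of [w] with [u] is the second relation rearranged; commutation with [d] follows from
    two applications of the first. *)
Lemma central_u : u * w = w * u.
Proof. rewrite /w; ncring [:: u; d] ok12. Qed.

Lemma central_d : d * w = w * d.
Proof. rewrite /w; ncring [:: u; d] ok12. Qed.

End CentralElement.

(* Confluent presentation with the normal element w adjoined as a letter;     *)
(* the letter J stands for the scalar i.                                      *)
Definition pbw_rules : seq (seq nat * seq (int * seq nat)) :=
  [:: ([:: 1; 1; 0], [:: (Negz 0, [:: 0; 1; 1])]);
      ([:: 1; 0; 0], [:: (Posz 1, [:: 2]); (Negz 0, [:: 0; 0; 1])]);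
      ([:: 0; 2], [:: (Posz 1, [:: 2; 0])]);
      ([:: 1; 2], [:: (Posz 1, [:: 2; 1])]);
      ([:: 0; 3], [:: (Posz 1, [:: 3; 0])]);
      ([:: 1; 3], [:: (Posz 1, [:: 3; 1])]);
      ([:: 2; 3], [:: (Posz 1, [:: 3; 2])]);
      ([:: 3; 3], [:: (Negz 0, [::])])]%N.

Lemma pbw_rules_valid (R : pzRingType) (u d w J : R) :
  d * d * u = - (u * d * d) -> d * u * u = w - u * u * d -> u * w = w * u ->
  d * w = w * d -> (forall x, x * J = J * x) -> J * J = -1 ->
  ncvalid (nth 0 [:: u; d; w; J]) pbw_rules.
Proof.
move=> rel1 rel2 uw dw cJ JJ.
rewrite /ncvalid /ncword /ncpval /= !mulr1 !addr0 !mulr1z !NegzE !mulrNz !mulr1z.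
by rewrite !mulrA rel1 rel2 uw dw !cJ JJ.
Qed.

Section KModule.
Variables (k : pzRingType) (A : pzAlgType k).

(** The scaling [kscale] of a [pzAlgType] is turned into a module structure on a copy of [A], to
    which linear maps and [plin] apply. *)
Definition kmod : Type := A.
HB.instance Definition _ := GRing.Zmodule.on kmod.
HB.instance Definition _ := GRing.Zmodule_isLmodule.Build k kmod
  (@kscaleA k A) (@kscale1 k A) (@kscaleDr k A) (fun x a b => kscaleDl x a b).

Lemma kscale0l (x : A) : kscale 0 x = 0.
Proof. exact: (@scale0r k kmod). Qed.

Lemma kscaleNl c (x : A) : kscale (- c) x = - kscale c x.
Proof. exact: (@scaleNr k kmod). Qed.

Lemma kscale_comm c (x : A) : x * kscale c 1 = kscale c 1 * x.
Proof. by rewrite -kscaleAr -kscaleAl mulr1 mul1r. Qed.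

End KModule.

Section PbwElements.
Variables (k : fieldType) (n : nat) (A : pbw_algebra k n).

Local Notation u := (gu A).
Local Notation d := (gd A).
Local Notation e := (@ge k n A).
Local Notation I := (pbw_i A).

Definition gw : A := u * u * d + d * u * u.
Definition gJ : A := kscale I 1.
Definition gz : A := u * d + gJ * (d * u).

Local Notation w := gw.
Local Notation J := gJ.
Local Notation z := gz.

Lemma gu_gw : u * w = w * u.
Proof. exact: central_u (g_rel1 A) (g_rel2 A). Qed.

Lemma gd_gw : d * w = w * d.
Proof. exact: central_d (g_rel1 A) (g_rel2 A). Qed.

Lemma gJ_comm x : x * J = J * x.
Proof. exact: kscale_comm. Qed.

Lemma gJ_gJ : J * J = -1.
Proof. by rewrite /gJ -kscaleAl mul1r kscaleA pbw_ii kscaleNl kscale1. Qed.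

Lemma pbw_ok : ncvalid (nth 0 [:: u; d; w; J]) pbw_rules.
Proof.
apply: pbw_rules_valid; [exact: g_rel1 | | exact: gu_gw | exact: gd_gw | exact: gJ_comm
  | exact: gJ_gJ].
by rewrite /gw addrAC subrr add0r.
Qed.

Ltac pbw_ring := rewrite /gz; ncring [:: u; d; w; J] pbw_ok.

Lemma gz_gd : z * d = J * (d * z). Proof. pbw_ring. Qed.
Lemma gz_gw : z * w = w * z. Proof. pbw_ring. Qed.
Lemma gu4_gd : u * u * u * u * d = d * (u * u * u * u). Proof. pbw_ring. Qed.

End PbwElements.

Lemma lin_comp (k : pzRingType) (U V W : lmodType k) (f : V -> W) (g : U -> V) :
  linear f -> linear g -> linear (fun x => f (g x)).
Proof. by move=> fl gl c x y; rewrite gl fl. Qed.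

Section PbwBasis.
Variables (k : fieldType) (n : nat) (A : pbw_algebra k n).

Local Notation u := (gu A).
Local Notation d := (gd A).
Local Notation e := (@ge k n A).
Local Notation I := (pbw_i A).
Local Notation w := (gw A).
Local Notation J := (gJ A).
Local Notation z := (gz A).

Definition pbwT (a b m : nat) : A := d ^+ a * z ^+ b * w ^+ m.

Definition bas (p : pbw n) : A :=
  let: (j, a, b, m, c) := p in pbwT a b m * u ^+ c * e j.

Lemma gJE x : J * x = kscale I x.
Proof. by rewrite /gJ -kscaleAl mul1r. Qed.

Lemma gzX_gd b : z ^+ b * d = kscale (I ^+ b) (d * z ^+ b).
Proof.
elim: b => [|b IHb]; first by rewrite !expr0 mul1r mulr1 kscale1.
rewrite exprS -mulrA IHb -kscaleAr (mulrA z) gz_gd gJE -kscaleAl kscaleA -mulrA.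
by rewrite exprS mulrC.
Qed.

Lemma gw_comm_d m : d * w ^+ m = w ^+ m * d.
Proof. exact/commrX/gd_gw. Qed.

Lemma pbwT_gd a b m : pbwT a b m * d = kscale (I ^+ b) (pbwT a.+1 b m).
Proof.
by rewrite /pbwT -mulrA -gw_comm_d mulrA -(mulrA (d ^+ a)) gzX_gd -kscaleAr
  -kscaleAl mulrA -exprSr.
Qed.

Lemma pbwT_gz a b m : pbwT a b m * z = pbwT a b.+1 m.
Proof.
rewrite /pbwT -mulrA; have -> : w ^+ m * z = z * w ^+ m.
  by apply/esym/commrX/gz_gw.
by rewrite mulrA -(mulrA (d ^+ a)) -exprSr.
Qed.

Lemma pbwT_gw a b m : pbwT a b m * w = pbwT a b m.+1.
Proof. by rewrite /pbwT -mulrA -exprSr. Qed.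

Lemma gu4X_comm x c : (c %% 4)%N = 0%N -> u * u * u * u * x = x * (u * u * u * u) ->
  u ^+ c * x = x * u ^+ c.
Proof.
move=> c4 xu; have -> : c = (4 * (c %/ 4))%N by rewrite mulnC {1}(divn_eq c 4) c4 addn0.
rewrite exprM; apply/esym/commrX; rewrite /GRing.comm.
by have -> : u ^+ 4 = u * u * u * u by rewrite !exprS expr0 mulr1 !mulrA.
Qed.

Lemma gu4_gw : u * u * u * u * w = w * (u * u * u * u).
Proof. ncring [:: u; d; w; J] (pbw_ok A). Qed.

(** Letter 4 is a power of [u] with exponent divisible by 4, which commutes with all of [u], [d],
    [w], [J]; letter 5 is an arbitrary element, which commutes with the scalar [J] only. *)
Definition pbw_power_rules := pbw_rules ++
  [:: ([:: 4; 0], [:: (Posz 1, [:: 0; 4])]); ([:: 4; 1], [:: (Posz 1, [:: 1; 4])]);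
      ([:: 4; 2], [:: (Posz 1, [:: 2; 4])]); ([:: 4; 3], [:: (Posz 1, [:: 3; 4])]);
      ([:: 5; 3], [:: (Posz 1, [:: 3; 5])])]%N.

Section Period.
Variables (c : nat) (T : A).
Hypothesis c4 : (c %% 4)%N = 0%N.

Let ok : ncvalid (nth 0 [:: u; d; w; J; u ^+ c; T]) pbw_power_rules.
Proof.
have [ok1 [ok2 [ok3 [ok4 [ok5 [ok6 [ok7 [ok8 _]]]]]]]] := pbw_ok A.
do 8 (split; first by []); rewrite /ncword /= !mulr1 !addr0 !mulr1z.
rewrite -exprSr -exprS gJ_comm (gu4X_comm c4 (gu4_gd A)) (gu4X_comm c4 gu4_gw).
by rewrite gJ_comm.
Qed.

(** With [T] equal to d^a z^b w^m, this and the next three identities are the four cases in the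
    definition of [opD]. *)
Lemma guX_gd0 : T * u ^+ c * d = T * d * u ^+ c.
Proof. ncring [:: u; d; w; J; u ^+ c; T] ok. Qed.

Lemma guX_gd1 : T * u ^+ c.+1 * d = T * z * u ^+ c - J * (T * d * u ^+ c.+1).
Proof. rewrite exprSr /gz; ncring [:: u; d; w; J; u ^+ c; T] ok. Qed.

Lemma guX_gd2 : T * u ^+ c.+2 * d = T * w * u ^+ c - T * d * u ^+ c.+2.
Proof. rewrite !exprSr; ncring [:: u; d; w; J; u ^+ c; T] ok. Qed.

Lemma guX_gd3 : T * u ^+ c.+3 * d =
  T * w * u ^+ c.+1 - T * z * u ^+ c.+2 + J * (T * d * u ^+ c.+3).
Proof. rewrite !exprSr /gz; ncring [:: u; d; w; J; u ^+ c; T] ok. Qed.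

End Period.

Lemma rmul_linear (x : A) : linear (fun y : kmod A => y * x : kmod A).
Proof. by move=> c y y'; rewrite mulrDl -kscaleAl. Qed.

Section Coordinates.
Variables (V : lmodType k) (pv : 'I_n -> nat -> nat -> nat -> nat -> V).
Variables (opU opD : V -> V) (opE : 'I_n -> V -> V).
Hypotheses
  (pv_ext : forall (W : lmodType k) (f g : V -> W), linear f -> linear g ->
     (forall j a b m c, f (pv j a b m c) = g (pv j a b m c)) -> f =1 g)
  (opUD : {morph opU : x y / x + y}) (opUZ : forall c, {morph opU : x / c *: x})
  (opDD : {morph opD : x y / x + y}) (opDZ : forall c, {morph opD : x / c *: x})
  (opED : forall i, {morph opE i : x y / x + y})
  (opEZ : forall i c, {morph opE i : x / c *: x})
  (opU_pv : forall j a b m c, opU (pv j a b m c) = pv (ordS j) a b m c.+1)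
  (opE_pv : forall i j a b m c,
    opE i (pv j a b m c) = if j == i then pv j a b m c else 0)
  (opD0 : forall j a b m c, (c %% 4)%N = 0%N ->
    opD (pv j a b m c) = I ^+ b *: pv (ord_pred j) a.+1 b m c)
  (opD1 : forall j a b m c, (c %% 4)%N = 0%N -> opD (pv j a b m c.+1) =
    pv (ord_pred j) a b.+1 m c - (I * I ^+ b) *: pv (ord_pred j) a.+1 b m c.+1)
  (opD2 : forall j a b m c, (c %% 4)%N = 0%N -> opD (pv j a b m c.+2) =
    pv (ord_pred j) a b m.+1 c - I ^+ b *: pv (ord_pred j) a.+1 b m c.+2)
  (opD3 : forall j a b m c, (c %% 4)%N = 0%N -> opD (pv j a b m c.+3) =
    pv (ord_pred j) a b m.+1 c.+1 - pv (ord_pred j) a b.+1 m c.+2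
    + (I * I ^+ b) *: pv (ord_pred j) a.+1 b m c.+3).
Variables (co : A -> V) (val : V -> kmod A).
Hypotheses (coD : {morph co : x y / x + y})
  (coZ : forall c x, co (kscale c x) = c *: co x)
  (co1 : co 1 = \sum_i pv i 0 0 0 0)
  (co_u : forall x, co (x * u) = opU (co x))
  (co_d : forall x, co (x * d) = opD (co x))
  (co_e : forall x i, co (x * e i) = opE i (co x))
  (val_lin : linear val)
  (val_pv : forall j a b m c, val (pv j a b m c) = pbwT a b m * u ^+ c * e j).

Let valD := lin_morphD val_lin.
Let valZ := lin_morphZ val_lin.
Let valN x : val (- x) = - val x.
Proof. by rewrite -scaleN1r valZ scaleN1r. Qed.

Lemma val_opU v : val (opU v) = val v * u.
Proof.
apply: (pv_ext (f := fun v => val (opU v)) (g := fun v => val v * u : kmod A)) v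
  => [||j a b m c].
- exact: lin_comp val_lin (linear_morphs opUD opUZ).
- exact: lin_comp (rmul_linear u) val_lin.
by rewrite opU_pv !val_pv -(mulrA _ (e j)) ge_gu exprSr !mulrA.
Qed.

Lemma val_opE i v : val (opE i v) = val v * e i.
Proof.
apply: (pv_ext (f := fun v => val (opE i v)) (g := fun v => val v * e i : kmod A)) v
  => [||j a b m c].
- exact: lin_comp val_lin (linear_morphs (opED i) (opEZ i)).
- exact: lin_comp (rmul_linear (e i)) val_lin.
rewrite opE_pv val_pv -mulrA ge_ge.
by case: eqP => _; rewrite ?val_pv // mulr0 (lin_morph0 val_lin).
Qed.

Lemma val_opD v : val (opD v) = val v * d.
Proof.
apply: (pv_ext (f := fun v => val (opD v)) (g := fun v => val v * d : kmod A)) v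
  => [||j a b m c].
- exact: lin_comp val_lin (linear_morphs opDD opDZ).
- exact: lin_comp (rmul_linear d) val_lin.
have Ed : e j * d = d * e (ord_pred j) by rewrite -ge_gd ord_predK.
have kE s (x : kmod A) : s *: x = kscale s (x : A) by [].
rewrite val_pv -mulrA Ed mulrA.
move: (c %/ 4 * 4)%N (divn_eq c 4) (modnMl (c %/ 4) 4) (ltn_pmod c (isT : 0 < 4)%N).
move=> q Ec c4; move: (c %% 4)%N Ec => r -> r4.
case: r r4 => [|[|[|[|]]]] // _; rewrite ?addn0 ?addn1 ?addn2 ?addn3.
- by rewrite opD0 // valZ val_pv guX_gd0 // pbwT_gd kE -!kscaleAl.
- by rewrite opD1 // valD valN valZ !val_pv guX_gd1 // pbwT_gd pbwT_gz gJE kE mulrBl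
    -!kscaleAl kscaleA.
- by rewrite opD2 // valD valN valZ !val_pv guX_gd2 // pbwT_gd pbwT_gw kE mulrBl
    -!kscaleAl.
by rewrite opD3 // !valD valN valZ !val_pv guX_gd3 // pbwT_gd pbwT_gw pbwT_gz gJE kE
  mulrDl mulrBl -!kscaleAl kscaleA.
Qed.

(** Evaluation of coordinates fixes 1 and commutes with right multiplication by the generators,
    which reach everything. This is the spanning half of the basis theorem. *)
Lemma val_co x : val (co x) = x.
Proof.
elim/pbw_alg_ind: x => [|x y Ex Ey|c x Ex|x Ex|x Ex|x i Ex].
- rewrite co1 (big_morph val valD (lin_morph0 val_lin)) -[RHS](ge_sum A).
  by apply: eq_bigr => i _; rewrite val_pv /pbwT !expr0 !mul1r.
- by rewrite coD valD Ex Ey.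
- by rewrite coZ valZ Ex.
- by rewrite co_u val_opU Ex.
- by rewrite co_d val_opD Ex.
by rewrite co_e val_opE Ex.
Qed.

Let S a b m c := \sum_i pv i a b m c.

Let opU_S a b m c : opU (S a b m c) = S a b m c.+1.
Proof.
rewrite /S (big_morph opU opUD (lin_morph0 (linear_morphs opUD opUZ))).
by rewrite [RHS](reindex_inj (can_inj (@ordSK n))); apply: eq_bigr => i _; rewrite opU_pv.
Qed.

Let opD_sum (F : 'I_n -> V) : opD (\sum_i F i) = \sum_i opD (F i).
Proof. exact: (big_morph opD opDD (lin_morph0 (linear_morphs opDD opDZ))). Qed.

Let S_pred a b m c : \sum_i pv (ord_pred i) a b m c = S a b m c.
Proof. by rewrite [RHS](reindex_inj (can_inj (@ord_predK n))). Qed.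

Let opD_S0 a b m : opD (S a b m 0) = I ^+ b *: S a.+1 b m 0.
Proof.
rewrite opD_sum -(S_pred a.+1) scaler_sumr.
by apply: eq_bigr => i _; rewrite opD0.
Qed.

Let opD_S1 a b m : opD (S a b m 1) = S a b.+1 m 0 - (I * I ^+ b) *: S a.+1 b m 1.
Proof.
rewrite opD_sum -(S_pred a.+1) -(S_pred a) scaler_sumr -sumrB.
by apply: eq_bigr => i _; rewrite opD1.
Qed.

Let opD_S2 a b m : opD (S a b m 2) = S a b m.+1 0 - I ^+ b *: S a.+1 b m 2.
Proof.
rewrite opD_sum -(S_pred a.+1) -(S_pred a) scaler_sumr -sumrB.
by apply: eq_bigr => i _; rewrite opD2.
Qed.

Let co_z x : co (x * z) = opD (opU (co x)) + I *: opU (opD (co x)).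
Proof. by rewrite /gz gJE mulrDr -kscaleAr coD coZ !mulrA co_d !co_u co_d. Qed.

Let co_w x : co (x * w) = opD (opU (opU (co x))) + opU (opU (opD (co x))).
Proof. by rewrite /gw mulrDr coD !mulrA co_d !co_u co_d. Qed.

(** The independence half: the monomial is built from the vector of 1 letter by letter, and the
    correction terms in the action of [z] and [w] cancel, so each letter raises exactly one
    exponent. *)
Lemma co_bas j a b m c : co (pbwT a b m * u ^+ c * e j) = pv j a b m c.
Proof.
have coa : co (d ^+ a) = S a 0 0 0.
  elim: a => [|a IHa]; first by rewrite expr0.
  by rewrite exprSr co_d IHa opD_S0 expr0 scale1r.
have cob : co (d ^+ a * z ^+ b) = S a b 0 0.
  elim: b => [|b IHb]; first by rewrite expr0 mulr1.
  rewrite exprSr mulrA co_z IHb opU_S opD_S1 opD_S0 opUZ opU_S scalerA.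
  by rewrite subrK.
have com : co (pbwT a b m) = S a b m 0.
  rewrite /pbwT; elim: m => [|m IHm]; first by rewrite expr0 mulr1.
  by rewrite exprSr mulrA co_w IHm !opU_S opD_S2 opD_S0 !opUZ !opU_S subrK.
have coc : co (pbwT a b m * u ^+ c) = S a b m c.
  elim: c => [|c IHc]; first by rewrite expr0 mulr1.
  by rewrite exprSr mulrA co_u IHc opU_S.
rewrite co_e coc /S (big_morph (opE j) (opED j) (lin_morph0 (linear_morphs (opED j) (opEZ j)))).
rewrite (bigD1 j) //= opE_pv eqxx big1 ?addr0 // => i ij.
by rewrite opE_pv (negPf ij).
Qed.

End Coordinates.

Local Notation V := {malg k[pbw n]}.

Definition pbw_val (v : V) : kmod A := plin (bas : pbw n -> kmod A) v.

Lemma pbw_val_linear : linear pbw_val.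
Proof. by apply: linear_morphs => [x y|c x]; [apply: plinD | apply: plinZ]. Qed.

Let pbw_val_pv j a b m c : pbw_val (pv k j a b m c) = pbwT a b m * u ^+ c * e j.
Proof. exact: plinU. Qed.

Let pv_ext (W : lmodType k) (f g : V -> W) : linear f -> linear g ->
  (forall j a b m c, f (pv k j a b m c) = g (pv k j a b m c)) -> f =1 g.
Proof.
move=> fl gl fg; apply: malg_lin_ext => // -[[[[j a] b] m] c]; exact: fg.
Qed.

Let opUD : {morph @opU k n : x y / x + y}. Proof. exact: plinD. Qed.
Let opUZ c : {morph @opU k n : x / c *: x}. Proof. exact: plinZ. Qed.
Let opDD : {morph @opD k n I : x y / x + y}. Proof. exact: plinD. Qed.
Let opDZ c : {morph @opD k n I : x / c *: x}. Proof. exact: plinZ. Qed.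
Let opED i : {morph @opE k n i : x y / x + y}. Proof. exact: plinD. Qed.
Let opEZ i c : {morph @opE k n i : x / c *: x}. Proof. exact: plinZ. Qed.

Lemma pbw_val_coord x : pbw_val (coord x) = x.
Proof.
exact: (val_co pv_ext opUD opUZ opDD opDZ opED opEZ (@opU_pv k n) (@opE_pv k n)
  (@opD_pv0 k n I) (@opD_pv1 k n I) (@opD_pv2 k n I) (@opD_pv3 k n I)
  (@coordD k n A) (@coordZ k n A) (@coord1 k n A) (@coord_gu k n A) (@coord_gd k n A)
  (@coord_ge k n A) pbw_val_linear pbw_val_pv).
Qed.

Lemma coord_bas p : coord (bas p) = << p >>.
Proof.
case: p => [[[[j a] b] m] c].
exact: (co_bas opUD opUZ opDD opDZ opED opEZ (@opU_pv k n) (@opE_pv k n)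
  (@opD_pv0 k n I) (@opD_pv1 k n I) (@opD_pv2 k n I)
  (@coordD k n A) (@coordZ k n A) (@coord1 k n A) (@coord_gu k n A) (@coord_gd k n A)
  (@coord_ge k n A)).
Qed.

End PbwBasis.

(** * Coordinates, the grading, and division by u, w and z *)

Section PbwSupport.
Variables (k : fieldType) (n : nat) (A : pbw_algebra k n).

Local Notation u := (gu A).
Local Notation d := (gd A).
Local Notation e := (@ge k n A).
Local Notation I := (pbw_i A).
Local Notation w := (gw A).
Local Notation J := (gJ A).
Local Notation z := (gz A).

Definition cf (x : A) (p : pbw n) : k := (coord x)@_p.
Definition cfsupp (x : A) : seq (pbw n) := msupp (coord x).

Lemma cfD x y p : cf (x + y) p = cf x p + cf y p.
Proof. by rewrite /cf coordD mcoeffD. Qed.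

Lemma cfZ c x p : cf (kscale c x) p = c * cf x p.
Proof. by rewrite /cf coordZ mcoeffZ. Qed.

Lemma cf0 p : cf 0 p = 0.
Proof. by apply: (addIr (cf 0 p)); rewrite -cfD !add0r. Qed.

Lemma cfN x p : cf (- x) p = - cf x p.
Proof. by apply: (addIr (cf x p)); rewrite -cfD !addNr cf0. Qed.

Lemma cf_sum T (r : seq T) (P : pred T) (F : T -> A) p :
  cf (\sum_(i <- r | P i) F i) p = \sum_(i <- r | P i) cf (F i) p.
Proof. by apply: (big_morph (cf^~ p)) => [x y|]; rewrite ?cfD ?cf0. Qed.

Lemma cf_bas p q : cf (bas A p) q = (p == q)%:R.
Proof. by rewrite /cf coord_bas; apply: mcoeffU. Qed.

Lemma cfsupp_uniq x : uniq (cfsupp x). Proof. exact: fset_uniq. Qed.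

Lemma mem_cfsupp x p : (p \in cfsupp x) = (cf x p != 0).
Proof. by rewrite /cf mcoeff_neq0. Qed.

Lemma cf_expand x : x = \sum_(p <- cfsupp x) kscale (cf x p) (bas A p).
Proof. by rewrite -[LHS]pbw_val_coord. Qed.

Lemma cf_eq0 x : (forall p, cf x p = 0) -> x = 0.
Proof. by move=> x0; rewrite [x]cf_expand big1 // => p _; rewrite x0 kscale0l. Qed.

Lemma bas_gr p : gr (pbw_deg p)%:Z (bas A p).
Proof.
have grX (x : A) s t : gr s%:Z x -> gr (s * t)%:Z (x ^+ t).
  move=> gx; elim: t => [|t IHt]; first by rewrite muln0 expr0; apply: gr1.
  by rewrite mulnS PoszD exprS; apply: grM.
have grz : gr 2%:Z z.
  apply: grD; first exact: grM (gr_gu A) (gr_gd A).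
  by rewrite gJE; apply: grZ; apply: grM (gr_gd A) (gr_gu A).
have grw : gr 3%:Z w.
  apply: grD; first exact: grM (grM (gr_gu A) (gr_gu A)) (gr_gd A).
  exact: grM (grM (gr_gd A) (gr_gu A)) (gr_gu A).
case: p => [[[[j a] b] m] c] /=.
have -> : (a + b.*2 + m * 3 + c)%N =
    (1 * a)%N%:Z + (2 * b)%N%:Z + (3 * m)%N%:Z + (1 * c)%N%:Z + 0 :> int by lia.
apply: grM; last exact: gr_ge.
apply: grM; last exact/grX/gr_gu.
by rewrite /pbwT; apply: grM; [apply: grM; [exact/grX/gr_gd | exact: grX] | exact: grX].
Qed.

(** Every basis monomial is homogeneous, so homogeneity is visible on coordinates; this is what
    makes [gr] a grading in [gr_grading]. *)
Lemma gr_cfP j x : gr j x <-> forall p, cf x p != 0 -> (pbw_deg p)%:Z = j.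
Proof.
split=> [|hx]; first exact: gr_coord.
rewrite [x]cf_expand big_seq; elim/big_rec: _ => [|p y px gy]; first exact: gr0.
by apply: grD gy; apply: grZ; rewrite -(hx p) -?mem_cfsupp //; apply: bas_gr.
Qed.

Lemma gr_grading : is_grading (@gr k n A).
Proof.
pose pr j (x : A) : A := \sum_(p <- cfsupp x | (pbw_deg p)%:Z == j) kscale (cf x p) (bas A p).
have prE j x p : cf (pr j x) p = if (pbw_deg p)%:Z == j then cf x p else 0.
  rewrite cf_sum big_mkcond; under eq_bigr => q _ do rewrite cfZ cf_bas.
  have [px|] := boolP (p \in cfsupp x).
    rewrite (bigD1_seq p) ?cfsupp_uniq //= eqxx mulr1 big1 ?addr0 // => q qp.
    by rewrite (negPf qp) mulr0 if_same.
  rewrite mem_cfsupp negbK => /eqP cf0; rewrite cf0 if_same big1_seq // => q /andP[_ qx].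
  have [Eqp|_] := eqVneq q p; last by rewrite mulr0 if_same.
  by move: qx; rewrite Eqp mem_cfsupp cf0 eqxx.
have cf_inj x y : (forall p, cf x p = cf y p) -> x = y.
  by move=> xy; apply: subr0_eq; apply: cf_eq0 => p; rewrite cfD cfN xy subrr.
apply: (@grading_of_proj _ _ pr).
- exact: gr0.
- move=> j x y gx gy; apply: grD => //; rewrite -[y](kscale1) -kscaleNl.
  exact: grZ.
- by move=> j x y; apply: cf_inj => p; rewrite cfD !prE cfD; case: eqP; rewrite ?addr0.
- move=> j x /gr_cfP gx; apply: cf_inj => p; rewrite prE.
  by case: eqP => // /eqP; have [->|/gx ->] := eqVneq (cf x p) 0; rewrite ?eqxx.
- move=> i j x /gr_cfP gx ij; apply: cf_eq0 => p; rewrite prE.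
  case: eqP => // Ej; have [//|/gx Ei] := eqVneq (cf x p) 0.
  by rewrite -Ei Ej eqxx in ij.
move=> x; rewrite [x]cf_expand; apply: homogeneous_sum_big => p _.
by apply: (homogeneous_sumG (j := (pbw_deg p)%:Z)); apply: grZ; apply: bas_gr.
Qed.

Definition supported (P : pred (pbw n)) (x : A) : Prop := forall p, cf x p != 0 -> P p.

Lemma supportedD P x y : supported P x -> supported P y -> supported P (x + y).
Proof.
move=> hx hy p; rewrite cfD; have [->|/hx //] := eqVneq (cf x p) 0.
by rewrite add0r => /hy.
Qed.

Lemma supportedN P x : supported P x -> supported P (- x).
Proof. by move=> hx p; rewrite cfN oppr_eq0 => /hx. Qed.

Lemma supportedZ P c x : supported P x -> supported P (kscale c x).
Proof. by move=> hx p; rewrite cfZ mulf_eq0 negb_or => /andP[_ /hx]. Qed.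

Lemma supported0 P : supported P 0.
Proof. by move=> p; rewrite cf0 eqxx. Qed.

Section Shift.
Variables (P P' : pred (pbw n)) (sh : pbw n -> pbw n) (s : pbw n -> k) (g : A).
Hypotheses (shE : forall p, P p -> bas A p * g = kscale (s p) (bas A (sh p)))
  (s0 : forall p, s p != 0) (sh_inj : injective sh).

(** In this section right multiplication by [g] sends the basis monomials in [P] to nonzero
    multiples of distinct basis monomials. Hence it is injective on their span ([shift_inj]), and
    sums with its image are direct ([shift_uniq]) or exhaustive ([shift_dec]) according to the sets
    of monomials involved. *)
Lemma cf_shift x p : supported P x -> cf (x * g) (sh p) = s p * cf x p.
Proof.
move=> hx; rewrite {1}[x]cf_expand mulr_suml cf_sum.
transitivity (\sum_(q <- cfsupp x) cf x q * (s q * (q == p)%:R)).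
  apply: eq_big_seq => q qx; rewrite -kscaleAl shE; last by apply: hx; rewrite -mem_cfsupp.
  by rewrite kscaleA cfZ cf_bas (inj_eq sh_inj) mulrA.
have [px|] := boolP (p \in cfsupp x).
  rewrite (bigD1_seq p) ?cfsupp_uniq //= eqxx mulr1 big1 ?addr0 1?mulrC // => q qp.
  by rewrite (negPf qp) !mulr0.
rewrite mem_cfsupp negbK => /eqP cfp; rewrite cfp mulr0 big1_seq // => q /andP[_ qx].
have [Eqp|_] := eqVneq q p; last by rewrite !mulr0.
by move: qx; rewrite Eqp mem_cfsupp cfp eqxx.
Qed.

Lemma supported_shift (Q : pred (pbw n)) x : (forall p, P p -> Q (sh p)) -> supported P x ->
  supported Q (x * g).
Proof.
move=> PQ hx q; rewrite {1}[x]cf_expand mulr_suml cf_sum => cq.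
have [p px Eq] : exists2 p, p \in cfsupp x & sh p = q.
  have [/hasP[p px /eqP Ep]|/hasPn no] := boolP (has (fun p => sh p == q) (cfsupp x)).
    by exists p.
  case/eqP: cq; rewrite big1_seq // => p /andP[_ px].
  rewrite -kscaleAl shE; last by apply: hx; rewrite -mem_cfsupp.
  by rewrite kscaleA cfZ cf_bas (negPf (no p px)) mulr0.
by rewrite -Eq; apply: PQ; apply: hx; rewrite -mem_cfsupp.
Qed.

Lemma shift_uniq x x' : (forall p, P p -> ~~ P' (sh p)) ->
  supported P' x -> supported P x' -> x + x' * g = 0 -> x = 0 /\ x' = 0.
Proof.
move=> disj hx hx' xx'0.
have x'0 : x' = 0.
  apply: cf_eq0 => p; apply/eqP; apply/negPn/negP => cp.
  have := congr1 (cf^~ (sh p)) xx'0; rewrite cf0 cfD cf_shift //.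
  have -> : cf x (sh p) = 0.
    apply/eqP; apply/negPn/negP => /hx; apply/negP/disj; exact: hx'.
  by rewrite add0r => /eqP; rewrite mulf_eq0 (negPf (s0 p)) (negPf cp).
by split=> //; move: xx'0; rewrite x'0 mul0r addr0.
Qed.

Lemma shift_inj x : supported P x -> x * g = 0 -> x = 0.
Proof.
move=> hx xg0; apply: cf_eq0 => p; have := cf_shift p hx.
by rewrite xg0 cf0 => /esym/eqP; rewrite mulf_eq0 (negPf (s0 p)) => /eqP.
Qed.

Lemma shift_dec x : (forall q, P q -> P' q \/ exists2 p, P p & q = sh p) ->
  supported P x -> exists x0 x', [/\ supported P' x0, supported P x' & x = x0 + x' * g].
Proof.
move=> cov hx; rewrite [x]cf_expand.
have : {in cfsupp x, forall p, P p} by move=> p; rewrite mem_cfsupp => /hx.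
elim: (cfsupp x) => [|q r IHr] Pr.
  exists 0, 0; split; [exact: supported0 | exact: supported0|].
  by rewrite big_nil mul0r addr0.
have [|x0 [x' [hx0 hx' E]]] := IHr.
  by move=> p pr; apply: Pr; rewrite inE pr orbT.
rewrite big_cons {}E.
have sb p c (Q : pred (pbw n)) : Q p -> supported Q (kscale c (bas A p)).
  move=> Qp; apply: supportedZ => p'.
  by rewrite cf_bas; case: (eqVneq p p') => [<-|]; rewrite ?eqxx.
have [/(sb q (cf x q)) hq|[p Pp ->]] := cov q (Pr q (mem_head _ _)).
  exists (kscale (cf x q) (bas A q) + x0), x'; split; rewrite ?addrA //.
  exact: supportedD.
exists x0, (kscale (cf x (sh p) / s p) (bas A p) + x'); split=> //.
  by apply: supportedD hx'; apply: sb.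
rewrite mulrDl -kscaleAl shE // kscaleA divfK //.
by rewrite addrCA.
Qed.

End Shift.

End PbwSupport.

Section OneSidedExactness.
Variables (k : fieldType) (n : nat) (A : pbw_algebra k n).

Local Notation u := (gu A).
Local Notation d := (gd A).
Local Notation e := (@ge k n A).
Local Notation I := (pbw_i A).
Local Notation w := (gw A).
Local Notation J := (gJ A).
Local Notation z := (gz A).

(** The spans T, T1 and T2 of the monomials d^a z^b w^m, of the d^a z^b, and of the d^a, each times
    the vertex idempotents, are cut out by these three predicates. *)
Definition pbw_c0 : pred (pbw n) := fun p => let: (_, _, _, _, c) := p in c == 0%N.
Definition pbw_mc0 : pred (pbw n) :=
  fun p => let: (_, _, _, m, c) := p in (m == 0%N) && (c == 0%N).
Definition pbw_bmc0 : pred (pbw n) :=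
  fun p => let: (_, _, b, m, c) := p in [&& b == 0%N, m == 0%N & c == 0%N].

Definition sh_u (p : pbw n) : pbw n :=
  let: (j, a, b, m, c) := p in (ordS j, a, b, m, c.+1).
Definition sh_w (p : pbw n) : pbw n :=
  let: (j, a, b, m, c) := p in (ordS j, a, b, m.+1, c).
Definition sh_z (p : pbw n) : pbw n :=
  let: (j, a, b, m, c) := p in (j, a, b.+1, m, c).
Definition sh_d (p : pbw n) : pbw n :=
  let: (j, a, b, m, c) := p in (ord_pred j, a.+1, b, m, c).
Definition scale_d (p : pbw n) : k := let: (_, _, b, _, _) := p in I ^+ b.

Lemma ge_gd_pred j : e j * d = d * e (ord_pred j).
Proof. by rewrite -ge_gd ord_predK. Qed.

Lemma ge_gz j : e j * z = z * e j.
Proof.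
rewrite /gz gJE mulrDr mulrDl -kscaleAr -kscaleAl !mulrA; congr (_ + kscale _ _).
  by rewrite ge_gu -(mulrA u) ge_gd mulrA.
by rewrite ge_gd_pred -(mulrA d) ge_gu ord_predK mulrA.
Qed.

Lemma ge_gw j : e j * w = w * e (ordS j).
Proof.
rewrite /gw mulrDr mulrDl !mulrA; congr (_ + _).
  by rewrite ge_gu -(mulrA u) ge_gu mulrA -(mulrA _ _ d) ge_gd mulrA.
by rewrite ge_gd_pred -(mulrA d) ge_gu ord_predK mulrA -(mulrA _ _ u) ge_gu mulrA.
Qed.

Lemma bas_gu p : predT p -> bas A p * u = kscale 1 (bas A (sh_u p)).
Proof.
case: p => [[[[j a] b] m] c] _; rewrite kscale1 /= -mulrA ge_gu.
by rewrite exprSr !mulrA.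
Qed.

Lemma bas_gw p : pbw_c0 p -> bas A p * w = kscale 1 (bas A (sh_w p)).
Proof.
case: p => [[[[j a] b] m] c] /= /eqP ->; rewrite kscale1 expr0 !mulr1 -mulrA ge_gw.
by rewrite mulrA pbwT_gw.
Qed.

Lemma bas_gz p : pbw_c0 p -> bas A p * z = kscale 1 (bas A (sh_z p)).
Proof.
case: p => [[[[j a] b] m] c] /= /eqP ->; rewrite kscale1 expr0 !mulr1 -mulrA ge_gz.
by rewrite mulrA pbwT_gz.
Qed.

Lemma bas_gd p : pbw_c0 p -> bas A p * d = kscale (scale_d p) (bas A (sh_d p)).
Proof.
case: p => [[[[j a] b] m] c] /= /eqP ->; rewrite expr0 !mulr1 -mulrA ge_gd_pred.
by rewrite mulrA pbwT_gd -kscaleAl.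
Qed.

Lemma pbw_i_neq0 : I != 0.
Proof.
by apply/negP => /eqP I0; have /eqP := pbw_ii A; rewrite I0 mul0r eq_sym oppr_eq0 oner_eq0.
Qed.

Let one0 (p : pbw n) : (1 : k) != 0. Proof. exact: oner_neq0. Qed.
Let scale_d0 p : scale_d p != 0.
Proof. by case: p => [[[[j a] b] m] c]; apply/expf_neq0/pbw_i_neq0. Qed.

Let sh_u_inj : injective sh_u.
Proof.
case=> [[[[j a] b] m] c] [[[[j' a'] b'] m'] c'] [Ej -> -> -> ->].
have -> : j = j'; last by [].
by apply: (can_inj (@ordSK n)); apply: val_inj.
Qed.
Let sh_w_inj : injective sh_w.
Proof.
case=> [[[[j a] b] m] c] [[[[j' a'] b'] m'] c'] [Ej -> -> -> ->].
have -> : j = j'; last by [].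
by apply: (can_inj (@ordSK n)); apply: val_inj.
Qed.
Let sh_z_inj : injective sh_z.
Proof. by case=> [[[[j a] b] m] c] [[[[j' a'] b'] m'] c'] [-> -> -> -> ->]. Qed.
Let sh_d_inj : injective sh_d.
Proof.
case=> [[[[j a] b] m] c] [[[[j' a'] b'] m'] c'] [Ej -> -> -> ->].
have -> : j = j'; last by [].
by apply: (can_inj (@ord_predK n)); apply: val_inj.
Qed.

Let le_mc0 p : pbw_mc0 p -> pbw_c0 p.
Proof. by case: p => [[[[j a] b] m] c] /andP[]. Qed.
Let le_bmc0 p : pbw_bmc0 p -> pbw_mc0 p.
Proof. by case: p => [[[[j a] b] m] c] /and3P[_ m0 c0]; apply/andP. Qed.

Local Notation inT := (@supported k n A pbw_c0).
Local Notation inT1 := (@supported k n A pbw_mc0).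
Local Notation inT2 := (@supported k n A pbw_bmc0).

(** With the uniqueness lemmas that follow: A is the direct sum of T and A u, T of T1 and T w, T1 of
    T2 and T1 z. Since [u] stands at the right of a monomial, multiplication by it raises an
    exponent on all of A; for [w], [z] and [d] this is clear only on T. *)
Lemma u_dec (x : A) : exists x0 x', inT x0 /\ x = x0 + x' * u.
Proof.
have [||x0 [x' [h0 _ E]]] := shift_dec (P' := pbw_c0) bas_gu one0 (x := x); last by exists x0, x'.
  case=> [[[[j a] b] m] [|c]] _; [by left | right].
  by exists (ord_pred j, a, b, m, c); rewrite //= ord_predK.
by [].
Qed.

Lemma u_uniq (x x' : A) : inT x -> x + x' * u = 0 -> x = 0 /\ x' = 0.
Proof.
move=> hx; apply: (shift_uniq bas_gu one0 sh_u_inj (P' := pbw_c0)) => //.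
by case=> [[[[j a] b] m] c].
Qed.

Lemma u_reg (x : A) : x * u = 0 -> x = 0.
Proof. by apply: (shift_inj bas_gu one0 sh_u_inj). Qed.

Lemma w_dec (x : A) : inT x -> exists x0 x', [/\ inT1 x0, inT x' & x = x0 + x' * w].
Proof.
apply: (shift_dec bas_gw one0) => -[[[[j a] b] [|m]] c] /= c0; [by left | right].
by exists (ord_pred j, a, b, m, c); rewrite //= ord_predK.
Qed.

Lemma w_uniq (x x' : A) : inT1 x -> inT x' -> x + x' * w = 0 -> x = 0 /\ x' = 0.
Proof. by apply: (shift_uniq bas_gw one0 sh_w_inj) => -[[[[j a] b] m] c]. Qed.

Lemma z_dec (x : A) : inT1 x -> exists x0 x', [/\ inT2 x0, inT1 x' & x = x0 + x' * z].
Proof.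
apply: (shift_dec (sh := sh_z) (s := fun=> 1)) => // [p /le_mc0|].
  exact: bas_gz.
move=> [[[[j a] [|b]] m] c] /= mc0; [by left | right].
by exists (j, a, b, m, c).
Qed.

Lemma z_uniq (x x' : A) : inT2 x -> inT1 x' -> x + x' * z = 0 -> x = 0 /\ x' = 0.
Proof.
apply: (shift_uniq (sh := sh_z) (s := fun=> 1)) => // [p /le_mc0|].
  exact: bas_gz.
by move=> [[[[j a] b] m] c].
Qed.

Lemma d_reg (x : A) : inT x -> x * d = 0 -> x = 0.
Proof. exact: (shift_inj bas_gd scale_d0 sh_d_inj). Qed.

Lemma inT_d (x : A) : inT x -> inT (x * d).
Proof. by apply: (supported_shift bas_gd) => -[[[[j a] b] m] c]. Qed.
Lemma inT1_d (x : A) : inT1 x -> inT1 (x * d).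
Proof.
apply: (supported_shift (sh := sh_d) (s := scale_d)) => [p /le_mc0|]; first exact: bas_gd.
by move=> [[[[j a] b] m] c].
Qed.
Lemma inT2_d (x : A) : inT2 x -> inT2 (x * d).
Proof.
apply: (supported_shift (sh := sh_d) (s := scale_d)) => [p /le_bmc0/le_mc0|]; first exact: bas_gd.
by move=> [[[[j a] b] m] c].
Qed.
Lemma inT_w (x : A) : inT x -> inT (x * w).
Proof. by apply: (supported_shift bas_gw) => -[[[[j a] b] m] c]. Qed.
Lemma inT_z (x : A) : inT x -> inT (x * z).
Proof. by apply: (supported_shift bas_gz) => -[[[[j a] b] m] c]. Qed.
Lemma inT1_z (x : A) : inT1 x -> inT1 (x * z).
Proof.
apply: (supported_shift (sh := sh_z) (s := fun=> 1)) => [p /le_mc0|]; first exact: bas_gz.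
by move=> [[[[j a] b] m] c].
Qed.

End OneSidedExactness.

(** * The one-sided complex *)

(** Letters 4 to 9 are unknown elements, past which only the scalar letter 3 may be moved. *)
Definition pbw_letter_rules := pbw_rules ++
  [seq ([:: i; 3], [:: (Posz 1, [:: 3; i])]) | i <- iota 4 6]%N.

Section OneSidedComplex.
Variables (k : fieldType) (n : nat) (A : pbw_algebra k n).

Local Notation u := (gu A).
Local Notation d := (gd A).
Local Notation w := (gw A).
Local Notation J := (gJ A).
Local Notation z := (gz A).
Local Notation inT := (@supported k n A (@pbw_c0 n)).
Local Notation inT1 := (@supported k n A (@pbw_mc0 n)).
Local Notation inT2 := (@supported k n A (@pbw_bmc0 n)).

Lemma pbw_letters_ok (xs : seq A) :
  ncvalid (nth 0 [:: u, d, w, J & xs]) pbw_letter_rules.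
Proof.
have [ok1 [ok2 [ok3 [ok4 [ok5 [ok6 [ok7 [ok8 _]]]]]]]] := pbw_ok A.
do 8 (split; first by []); rewrite /ncword /= !mulr1 !addr0 !mulr1z.
by rewrite !gJ_comm.
Qed.

Ltac letter_ring xs := rewrite /gz;
  lazymatch xs with [:: ?a] => ncring [:: u; d; w; J; a] (pbw_letters_ok xs)
  | [:: ?a; ?b] => ncring [:: u; d; w; J; a; b] (pbw_letters_ok xs)
  | [:: ?a; ?b; ?c] => ncring [:: u; d; w; J; a; b; c] (pbw_letters_ok xs)
  | [:: ?a; ?b; ?c; ?f] => ncring [:: u; d; w; J; a; b; c; f] (pbw_letters_ok xs)
  | [:: ?a; ?b; ?c; ?f; ?g] =>
      ncring [:: u; d; w; J; a; b; c; f; g] (pbw_letters_ok xs)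
  end.

Let dd_reg (x : A) : inT x -> x * d * d = 0 -> x = 0.
Proof. by move=> hx /d_reg h; apply: d_reg => //; apply: h; apply: inT_d. Qed.

(** Modulo A u the second equation is x0 d d = 0, so x = t u. Then the first equation becomes (y - t
    d) u^3 = 0 up to sign. *)
Lemma one_sided_exact3 (x y : A) :
  x * (w - u * d * u) - y * (u * u * u) = 0 -> x * d * d + y * d * u = 0 ->
  exists t, x = t * u /\ y = t * d.
Proof.
move=> H1 H2; have [x0 [t [hx0 Ex]]] := u_dec x; exists t.
have [||x00 _] := @u_uniq _ _ A (x0 * d * d) (y * d - t * d * d).
- by do 2 apply: inT_d.
- by rewrite -H2 Ex; letter_ring [:: x0; t; y].
have {}x00 : x0 = 0 by apply: dd_reg.
rewrite x00 add0r in Ex; split=> //; apply: subr0_eq; do 3 apply: u_reg.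
by rewrite -[RHS]oppr0 -H1 Ex; letter_ring [:: x; t; y].
Qed.

(** Modulo A u the first equation is x0 d d = y0 w. Splitting x0 along T = T1 + T w gives x0 = p w
    and y0 = p d d. After subtracting [p] times the first row, both entries are right multiples of
    [u] and the division continues. *)
Lemma one_sided_exact2 (x y : A) :
  x * d * d + y * (u * d * u - w) = 0 -> x * u * d + y * (u * u * u) = 0 ->
  exists p q, x = p * (w - u * d * u) - q * (u * u * u) /\ y = p * d * d + q * d * u.
Proof.
move=> H1 H2; have [x0 [x1 [hx0 Ex]]] := u_dec x; have [y0 [y1 [hy0 Ey]]] := u_dec y.
have [||E0 _] := @u_uniq _ _ A (x0 * d * d - y0 * w)
    (- (x1 * d * d) + y0 * u * d + y1 * u * u * d - y1 * w).
- by apply: supportedD; [do 2 apply: inT_d | apply/supportedN/inT_w].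
- by rewrite -H1 Ex Ey; letter_ring [:: x0; x1; y0; y1].
have [p0 [p [hp0 hp Ex0]]] := w_dec hx0.
have [|||E1 E2] := @w_uniq _ _ A (p0 * d * d) (p * d * d - y0).
- by do 2 apply: inT1_d.
- by apply: supportedD; [do 2 apply: inT_d | apply: supportedN].
- by rewrite -E0 Ex0; letter_ring [:: p0; p; y0].
have {}E1 : p0 = 0.
  by apply: dd_reg => // q /hp0; case: q => [[[[j a] b] m] c] /andP[].
have {}E2 : y0 = p * d * d by apply/esym/subr0_eq.
rewrite E1 add0r in Ex0.
(* [X * u] is what remains of [x] after the subtraction; [X] itself will turn out to be divisible by
   u^2. *)
pose X := x1 + p * u * d.
have EX : x - p * (w - u * d * u) = X * u.
  by rewrite Ex Ex0 /X; letter_ring [:: x1; p].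
have EY : y - p * d * d = y1 * u by rewrite Ey E2; letter_ring [:: y1; p].
have F : X * d * d + y1 * d * u * u = 0.
  apply: u_reg; rewrite -[RHS]oppr0 -H1 Ex Ey Ex0 E2 /X.
  by letter_ring [:: x1; p; y1].
have [X0 [X1 [hX0 EX0]]] := u_dec X.
have [||F0 F1] := @u_uniq _ _ A (X0 * d * d) (- (X1 * d * d) + y1 * d * u).
- by do 2 apply: inT_d.
- by rewrite -F EX0; letter_ring [:: X0; X1; y1].
have {F0} X00 : X0 = 0 by apply: dd_reg.
have [X2 [X3 [hX2 EX1]]] := u_dec X1.
have [||F2 F3] := @u_uniq _ _ A (- (X2 * d * d)) (X3 * d * d + y1 * d).
- by apply: supportedN; do 2 apply: inT_d.
- by rewrite -F1 EX1; letter_ring [:: X2; X3; y1].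
have {F2} X20 : X2 = 0 by apply: dd_reg => //; rewrite -[LHS]opprK F2 oppr0.
have EX3 : X = X3 * u * u by rewrite EX0 X00 EX1 X20 !add0r.
(* The second equation, with [x] and [y] written through [X3] and [y1], is (y1 + X3 d) u^4 = 0. *)
have F4 : y1 = - (X3 * d).
  apply: subr0_eq; rewrite opprK; do 4 apply: u_reg.
  rewrite -H2 -[x](subrK (p * (w - u * d * u))) -[y](subrK (p * d * d)) EX EY EX3.
  by letter_ring [:: X3; p; y1].
exists p, (- X3); split.
  by rewrite -[x](subrK (p * (w - u * d * u))) EX EX3; letter_ring [:: X3; p].
by rewrite -[y](subrK (p * d * d)) EY F4; letter_ring [:: X3; p].
Qed.

(** Reduction modulo [w], then modulo [z], leaves c0 d = 0 with [d] regular on T. The parameters are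
    the Koszul relations, deformed by z d = J d z. *)
Lemma koszul_exact (y0 y1 y2 : A) : inT y0 -> inT y1 -> inT y2 ->
  y0 * d + y1 * z + y2 * w = 0 -> exists p0 p1 p2,
  [/\ y0 = p0 * z + p1 * w, y1 = - (J * (p0 * d)) + p2 * w & y2 = - (p1 * d) - p2 * z].
Proof.
move=> h0 h1 h2 H; have [a0 [b0 [ha0 hb0 E0]]] := w_dec h0.
have [a1 [b1 [ha1 hb1 E1]]] := w_dec h1.
have [|||F0 F1] := @w_uniq _ _ A (a0 * d + a1 * z) (b0 * d + b1 * z + y2).
- by apply: supportedD; [apply: inT1_d | apply: inT1_z].
- by apply: supportedD => //; apply: supportedD; [apply: inT_d | apply: inT_z].
- by rewrite -H E0 E1; letter_ring [:: a0; b0; a1; b1; y2].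
have [c0 [c1 [hc0 hc1 Ea0]]] := z_dec ha0.
have [|||F2 F3] := @z_uniq _ _ A (c0 * d) (J * (c1 * d) + a1).
- exact: inT2_d.
- by apply: supportedD => //; rewrite gJE; apply: supportedZ; apply: inT1_d.
- by rewrite -F0 Ea0; letter_ring [:: c0; c1; a1].
have c00 : c0 = 0.
  by apply: d_reg F2 => q /hc0; case: q => [[[[j a] b] m] c] /and3P[].
exists c1, b0, b1; split.
- by rewrite E0 Ea0 c00 add0r.
- by rewrite E1; congr (_ + _); apply/eqP; rewrite -addr_eq0 addrC F3.
by apply: subr0_eq; rewrite -F1; letter_ring [:: b0; b1; y2].
Qed.

(** Write y as y0 + y1 u + y2 u^2 + y3 u^3. Moving [d] to the left of the powers of [u], the part of
    x u + y d outside A u is y0 d + y1 z + y2 w, to which [koszul_exact] applies. Once [p] and [q]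
    match [y], cancelling [u] gives [x]. *)
Lemma one_sided_exact1 (x y : A) : x * u + y * d = 0 ->
  exists p q, x = p * d * d + q * (u * d * u - w) /\ y = p * u * d + q * (u * u * u).
Proof.
move=> H; have [y0 [y' [h0 Ey]]] := u_dec y.
have [y1 [y'' [h1 Ey']]] := u_dec y'; have [y2 [y3 [h2 Ey'']]] := u_dec y''.
have Ey3 : y = y0 + y1 * u + y2 * u * u + y3 * (u * u * u).
  by rewrite Ey Ey' Ey''; letter_ring [:: y0; y1; y2; y3].
have [||E _] := @u_uniq _ _ A (y0 * d + y1 * z + y2 * w)
  (x - y1 * J * d - y2 * d * u + y3 * (w - u * d * u)).
- by apply: supportedD; [apply: supportedD; [apply: inT_d | apply: inT_z] | apply: inT_w].
- by rewrite -H Ey3; letter_ring [:: x; y0; y1; y2; y3].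
have [p0 [p1 [p2 [E0 E1 E2]]]] := koszul_exact h0 h1 h2 E.
(* Expanding p u d in powers of [u] produces the Koszul expressions in degrees 0, 1, 2 and J p2 d in
   front of u^3, which [q] compensates. *)
pose p := p0 + p1 * u + p2 * u * u; pose q := y3 - J * (p2 * d).
have Eq : y = p * u * d + q * (u * u * u).
  by rewrite Ey3 E0 E1 E2 /p /q; letter_ring [:: p0; p1; p2; y3].
exists p, q; split=> //; apply: subr0_eq; apply: u_reg.
by rewrite -H Eq; letter_ring [:: x; p; q].
Qed.

Lemma one_sided_exact4 (x : A) : x * u = 0 -> x = 0.
Proof. exact: u_reg. Qed.

End OneSidedComplex.

(** * The enveloping algebra *)

Section EnvCoordinates.
Variables (k : fieldType) (n : nat) (A : pbw_algebra k n).
Local Notation R := (env A).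
Local Notation deg := (@pbw_deg n).
Local Notation ed := (env_deg (@gr k n A)).

Lemma epureDl (a a' b : A) : epure (a + a') b = epure a b + epure a' b.
Proof. by have [] := @epure_balanced k A. Qed.
Lemma epureDr (a b b' : A) : epure a (b + b') = epure a b + epure a b'.
Proof. by have [] := @epure_balanced k A. Qed.
Lemma epureZ (a b : A) c : epure (kscale c a) b = epure a (kscale c b).
Proof. by have [_ _] := @epure_balanced k A. Qed.
Lemma epure0l (b : A) : epure 0 b = 0.
Proof. by apply: (addIr (epure 0 b)); rewrite -epureDl !add0r. Qed.
Lemma epure0r (a : A) : epure a 0 = 0.
Proof. by apply: (addIr (epure a 0)); rewrite -epureDr !add0r. Qed.
Lemma epure_suml T (r : seq T) (F : T -> A) b :
  epure (\sum_(i <- r) F i) b = \sum_(i <- r) epure (F i) b.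
Proof. by apply: (big_morph (fun a => epure a b)) => [x y|]; rewrite ?epureDl ?epure0l. Qed.
Lemma epureNl (a b : A) : epure (- a) b = - epure a b.
Proof. by apply: (addIr (epure a b)); rewrite -epureDl !addNr epure0l. Qed.
Lemma epureM (a b a' b' : A) : epure a b * epure a' b' = epure (a * a') (b' * b).
Proof. exact: env_mulE. Qed.

(** A (x) A is the direct sum of the copies of A attached to the basis elements of the right-hand
    factor; [rc r p] is the component of [r] at [p]. *)
Definition rc_fun (p : pbw n) (a b : A) : A := kscale (cf b p) a.

Lemma rc_balanced p : balanced (fun (a : A) (c : k) => kscale c a)
  (fun (c : k) (b : A) => kscale c b) (rc_fun p).
Proof.
split=> [a a' b|a b b'|a c b]; rewrite /rc_fun.
- exact: kscaleDr.
- by rewrite cfD kscaleDl.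
by rewrite cfZ kscaleA mulrC.
Qed.

Definition rc (r : R) (p : pbw n) : A := tlift (rc_fun p) r.

Lemma rcD r s p : rc (r + s) p = rc r p + rc s p.
Proof. exact: tliftD (rc_balanced p) r s. Qed.

Lemma rc0 p : rc 0 p = 0.
Proof. by apply: (addIr (rc 0 p)); rewrite -rcD !add0r. Qed.

Lemma rcN r p : rc (- r) p = - rc r p.
Proof. by apply: (addIr (rc r p)); rewrite -rcD !addNr rc0. Qed.

Lemma rc_sum T (r : seq T) (P : pred T) (F : T -> R) p :
  rc (\sum_(i <- r | P i) F i) p = \sum_(i <- r | P i) rc (F i) p.
Proof. by apply: (big_morph (rc^~ p)) => [x y|]; rewrite ?rcD ?rc0. Qed.

Lemma rc_pure a b p : rc (epure a b) p = kscale (cf b p) a.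
Proof. exact: tlift_pure (rc_balanced p). Qed.

Lemma rc_bas a p q : rc (epure a (bas A p)) q = if p == q then a else 0.
Proof. by rewrite rc_pure cf_bas; case: eqP; rewrite (kscale1, kscale0l). Qed.

Lemma rc_expand r : exists2 S, uniq S & (forall p, p \notin S -> rc r p = 0) /\
  r = \sum_(p <- S) epure (rc r p) (bas A p).
Proof.
elim/env_ind: r => [|r s [S uS [S0 ES]] [T uT [T0 ET]]|a b].
- by exists [::] => //; rewrite big_nil; split=> // p _; rewrite rc0.
- exists (undup (S ++ T)); rewrite ?undup_uniq //; split=> [p|].
    by rewrite mem_undup mem_cat negb_or rcD => /andP[/S0 -> /T0 ->]; rewrite addr0.
  transitivity (\sum_(p <- undup (S ++ T)) (epure (rc r p) (bas A p)
      + epure (rc s p) (bas A p))); last by apply: eq_bigr => p _; rewrite rcD epureDl.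
  rewrite big_split /= {1}ES {1}ET; congr (_ + _); apply: big_uniq_support;
    rewrite ?undup_uniq // => p.
  + by rewrite mem_undup mem_cat => ->.
  + by move=> /S0 ->; rewrite epure0l.
  + by rewrite mem_undup mem_cat => ->; rewrite orbT.
  by move=> /T0 ->; rewrite epure0l.
exists (cfsupp b); first exact: cfsupp_uniq.
split=> [p|]; first by rewrite mem_cfsupp negbK rc_pure => /eqP ->; rewrite kscale0l.
rewrite {1}[b]cf_expand (big_morph (epure a) (epureDr a) (epure0r a)).
by apply: eq_bigr => p _; rewrite rc_pure epureZ.
Qed.

Lemma rc_inj r s : (forall p, rc r p = rc s p) -> r = s.
Proof.
move=> rs; apply: subr0_eq; have [S _ [_ ->]] := rc_expand (r - s).
by rewrite big1 // => p _; rewrite rcD rcN rs subrr epure0l.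
Qed.

Lemma rc_mull r a p : rc (r * epure a 1) p = rc r p * a.
Proof.
elim/env_ind: r => [|r s Er Es|x y]; first by rewrite mul0r rc0 mul0r.
  by rewrite mulrDl !rcD Er Es mulrDl.
by rewrite epureM !rc_pure mul1r kscaleAl.
Qed.

Lemma gr_neg (j : nat) (x : A) t : gr (t - j%:Z) x -> (t < j%:Z)%R -> x = 0.
Proof.
move=> /gr_cfP gx tj; apply: cf_eq0 => p; apply/eqP; apply/negPn/negP => /gx.
lia.
Qed.

(** This reduces the tensor grading to the grading of A one coefficient at a time; [env_grading]
    takes uniqueness of components from it. *)
Lemma env_degP t r : ed t r <-> forall p, gr (t - (deg p)%:Z) (rc r p).
Proof.
have gsum T (S : seq T) (F : T -> A) j : (forall i, gr j (F i)) -> gr j (\sum_(i <- S) F i).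
  by move=> gF; elim/big_rec: _ => [|i x _]; [exact: gr0 | apply: grD].
split=> [[m [a [b [i [j [hab ->]]]]]] p|hr].
  rewrite rc_sum; apply: gsum => l; rewrite rc_pure; have [ga /gr_cfP gb <-] := hab l.
  have [->|/gb <-] := eqVneq (cf (b l) p) 0; first by rewrite kscale0l; apply: gr0.
  by rewrite addrK; apply: grZ.
have [S _ [_ Er]] := rc_expand r.
case: S Er => [|p0 S] Er.
  by exists 0%N, (fun=> 0), (fun=> 0), (fun=> t), (fun=> 0); split=> [[]|] //;
    rewrite big_ord0 Er big_nil.
exists (size (p0 :: S)), (fun l => rc r (nth p0 (p0 :: S) l)),
  (fun l => bas A (nth p0 (p0 :: S) l)),
  (fun l => t - (deg (nth p0 (p0 :: S) l))%:Z), (fun l => (deg (nth p0 (p0 :: S) l))%:Z).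
split=> [l|]; first by split; [exact: hr | exact: bas_gr | rewrite subrK].
by rewrite {1}Er (big_nth p0) big_mkord.
Qed.

Lemma env_deg_pure i j a b : gr i a -> gr j b -> ed (i + j) (epure a b).
Proof.
move=> ga gb; exists 1%N, (fun=> a), (fun=> b), (fun=> i), (fun=> j); split=> //.
by rewrite big_ord1.
Qed.

Lemma env_deg0 t : ed t 0.
Proof. by apply/env_degP => p; rewrite rc0; apply: gr0. Qed.

Lemma env_degD t r s : ed t r -> ed t s -> ed t (r + s).
Proof. by move=> /env_degP hr /env_degP hs; apply/env_degP => p; rewrite rcD; apply: grD. Qed.

Lemma grN j (x : A) : gr j x -> gr j (- x).
Proof. by move=> gx; rewrite -[x]kscale1 -kscaleNl; apply: grZ. Qed.

Lemma env_degN t r : ed t r -> ed t (- r).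
Proof. by move=> /env_degP hr; apply/env_degP => p; rewrite rcN; apply: grN. Qed.

Lemma env_degM s t x y : ed s x -> ed t y -> ed (s + t) (x * y).
Proof.
move=> [m [a [b [i [j [hab ->]]]]]] [m' [a' [b' [i' [j' [hab' ->]]]]]].
rewrite mulr_suml; elim/big_rec: _ => [|l r _]; first exact: env_deg0.
apply: env_degD; rewrite mulr_sumr; elim/big_rec: _ => [|l' r' _]; first exact: env_deg0.
apply: env_degD; rewrite epureM.
have [ga gb <-] := hab l; have [ga' gb' <-] := hab' l'.
have -> : i l + j l + (i' l' + j' l') = (i l + i' l') + (j' l' + j l).
  by rewrite addrACA [j l + _]addrC.
by apply: env_deg_pure; apply: grM.
Qed.

Lemma env_deg1 : ed 0 1.
Proof. by rewrite -[0]addr0; apply: env_deg_pure; apply: gr1. Qed.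

Lemma env_grading : is_grading ed.
Proof.
have gA := gr_grading A; split.
- exact: env_deg0.
- by move=> j x y hx hy; apply/env_degD/env_degN.
- move=> r; have [S uS [S0 Er]] := rc_expand r.
  apply: homogeneous_sum_split; [exact: env_deg0 | exact: env_degD |].
  rewrite Er; apply: homogeneous_sum_big => p _.
  have [pr [_ prG _ prS]] := grading_proj gA; have [s us [Es _]] := prS (rc r p).
  rewrite Es epure_suml.
  apply: homogeneous_sum_big => j _; apply: homogeneous_sumG.
  by apply: env_deg_pure (prG j _) (bas_gr A p).
move=> s f us gf f0 j js; apply: rc_inj => p; rewrite rc0.
have -> : rc (f j) p = rc (f (j - (deg p)%:Z + (deg p)%:Z)) p by rewrite subrK.
case: gA => _ _ _ /(_ [seq i - (deg p)%:Z | i <- s] (fun i => rc (f (i + (deg p)%:Z)) p)) H.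
apply: (H) => [|i||].
- by rewrite map_inj_uniq //; apply: addIr.
- by have /env_degP/(_ p) := gf (i + (deg p)%:Z); rewrite addrK.
- rewrite big_map; under eq_bigr do rewrite subrK.
  by rewrite -rc_sum f0 rc0.
by apply/mapP; exists j.
Qed.

End EnvCoordinates.

(** * Lifting exactness along the degree of the right-hand factor *)

Section Filtration.
Variables (k : fieldType) (n : nat) (A : pbw_algebra k n).
Local Notation R := (env A).
Local Notation deg := (@pbw_deg n).
Local Notation ed := (env_deg (@gr k n A)).

(* Filtration of [A (x) A] by the degree of the right-hand factor.            *)
Definition rfil (N : nat) (r : R) : Prop := forall p, (deg p < N)%N -> rc r p = 0.

Lemma rfil0 N : rfil N 0. Proof. by move=> p _; rewrite rc0. Qed.
Lemma rfilD N r s : rfil N r -> rfil N s -> rfil N (r + s).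
Proof. by move=> hr hs p pN; rewrite rcD hr ?hs ?addr0. Qed.
Lemma rfilN N r : rfil N r -> rfil N (- r).
Proof. by move=> hr p pN; rewrite rcN hr ?oppr0. Qed.
Lemma rfil_sum N T (r : seq T) (P : pred T) (F : T -> R) :
  (forall i, P i -> rfil N (F i)) -> rfil N (\sum_(i <- r | P i) F i).
Proof. by move=> hF; elim/big_ind: _ => //; [exact: rfil0 | exact: rfilD]. Qed.

(** Since (x (x) y)(a (x) b) = x a (x) b y, the degree of the right-hand factor grows by that of
    [b]. *)
Lemma rfil_mul N j r a b : gr j%:Z b -> rfil N r -> rfil (N + j) (r * epure a b).
Proof.
move=> gb hr; have [S _ [_ ->]] := rc_expand r; rewrite mulr_suml.
apply: rfil_sum => p _; have [pN|pN] := ltnP (deg p) N.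
  by rewrite hr // epure0l mul0r; apply: rfil0.
move=> q qN; rewrite epureM rc_pure.
have [->|] := eqVneq (cf (b * bas A p) q) 0; first by rewrite kscale0l.
by have /gr_cfP h := grM gb (bas_gr A p) => /h; lia.
Qed.

(* [r] is congruent to [a (x) 1] modulo right-hand factors of positive degree *)
Definition leads (r : R) (a : A) : Prop := forall N x, rfil N x ->
  rfil N (x * r) /\ rfil N.+1 (x * r - x * epure a 1).

Lemma rfil_pure1 N x a : rfil N x -> rfil N (x * epure a 1).
Proof. by move=> hx; rewrite -[N]addn0; apply: rfil_mul => //; apply: gr1. Qed.

Lemma rfilS N x : rfil N.+1 x -> rfil N x.
Proof. by move=> hx p pN; apply: hx; apply: ltnW. Qed.

Lemma leads_of r a : (forall N x, rfil N x -> rfil N.+1 (x * r - x * epure a 1)) ->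
  leads r a.
Proof.
move=> H N x hx; split; last exact: H.
rewrite -[x * r](subrK (x * epure a 1)); apply: rfilD; last exact: rfil_pure1.
by apply/rfilS/H.
Qed.

Lemma leads_l a : leads (epure a 1) a.
Proof. by apply: leads_of => N x _; rewrite subrr; apply: rfil0. Qed.

Lemma leads_r j b : gr j%:Z b -> (0 < j)%N -> leads (epure 1 b) 0.
Proof.
move=> gb j0; apply: leads_of => N x hx; rewrite epure0l mulr0 subr0 => p pN.
by apply: (rfil_mul 1 gb hx); lia.
Qed.

Lemma leadsD r s a b : leads r a -> leads s b -> leads (r + s) (a + b).
Proof.
move=> hr hs; apply: leads_of => N x hx.
have [_ h1] := hr N x hx; have [_ h2] := hs N x hx.
by rewrite epureDl !mulrDr opprD addrACA; apply: rfilD.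
Qed.

Lemma leadsN r a : leads r a -> leads (- r) (- a).
Proof.
move=> hr; apply: leads_of => N x hx; have [_ h1] := hr N x hx.
by rewrite epureNl !mulrN -opprD; apply: rfilN.
Qed.

Lemma leadsM r s a b : leads r a -> leads s b -> leads (r * s) (a * b).
Proof.
move=> hr hs; apply: leads_of => N x hx; have [_ h1] := hr N x hx.
have -> : epure (a * b) 1 = epure a 1 * epure b 1 by rewrite epureM mulr1.
rewrite !mulrA -[X in rfil _ X](subrKA (x * epure a 1 * s)); apply: rfilD.
  by rewrite -mulrBl; have [] := hs _ _ h1.
by have [] := hs _ _ (rfil_pure1 a hx).
Qed.

Section Lift.
Variables (p q r : nat) (sp : 'I_p -> int) (sq : 'I_q -> int) (sr : 'I_r -> int).
Variables (M' : 'M[R]_(p, q)) (M : 'M[R]_(q, r)) (f' : 'M[A]_(p, q)) (f : 'M[A]_(q, r)).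
Hypotheses (sq0 : forall a, 0 <= sq a)
  (hM' : hom_mx ed sp sq M') (hM : hom_mx ed sq sr M) (hf' : hom_mx (@gr k n A) sp sq f')
  (M'M : M' *m M = 0) (Mf' : forall a b, leads (M' a b) (f' a b))
  (Mf : forall a b, leads (M a b) (f a b))
  (exf : forall x : 'rV_q, x *m f = 0 -> exists y, x = y *m f').

Definition row_coef (t : nat) (x : 'rV[R]_t) (b : pbw n) : 'rV[A]_t :=
  \row_a rc (x 0 a) b.

Lemma leads_coef t t' (N : 'M[R]_(t, t')) (g : 'M[A]_(t, t')) (x : 'rV_t) b :
  (forall a c, leads (N a c) (g a c)) -> (forall a, rfil (deg b) (x 0 a)) ->
  row_coef (x *m N) b = row_coef x b *m g.
Proof.
move=> Ng hx; apply/rowP => c; rewrite !mxE rc_sum; apply: eq_bigr => a _.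
rewrite mxE -rc_mull; apply: subr0_eq; rewrite -rcN -rcD.
by have [_ h] := Ng a c _ _ (hx a); apply: h.
Qed.

(* The coefficients of [x] in right-hand degree N form a cycle of the         *)
(* one-sided complex, because modulo right-hand degree > N every matrix acts  *)
(* through its leading part.                                                  *)
Lemma lift_step t N (x : 'rV[R]_q) : hom_row ed sq t x ->
  (forall a, rfil N (x 0 a)) -> x *m M = 0 ->
  exists y, hom_row ed sp t y /\ forall a, rfil N.+1 ((x - y *m M') 0 a).
Proof.
move=> hx xN xM.
have gA := gr_grading A.
have /choice [Y HY] b : exists y, hom_row (@gr k n A) sp (t - (deg b)%:Z) y /\
    (deg b = N -> row_coef x b = y *m f').
  have [Eb|] := eqVneq (deg b) N; last first.
    move=> bN; exists 0; split=> [a|Eb]; first by rewrite mxE; apply: gr0.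
    by rewrite Eb eqxx in bN.
  have [|y Ey] := exf (x := row_coef x b).
    by rewrite -(leads_coef Mf) ?Eb // xM; apply/rowP => a; rewrite !mxE rc0.
  have hxb : hom_row (@gr k n A) sq (t - (deg b)%:Z) (y *m f').
    move=> a; rewrite -Ey mxE; have /env_degP := hx a; move=> /(_ b).
    by rewrite addrAC.
  have [y' hy' Ey'] := hom_row_lift gA (@grM k n A) hf' hxb.
  by exists y'; split=> // _; rewrite Ey.
have /choice [S HS] a : exists S, uniq S /\ (forall b, b \notin S -> rc (x 0 a) b = 0).
  by have [S uS [S0 _]] := rc_expand (x 0 a); exists S.
pose T := undup (flatten [seq S a | a <- enum 'I_q]).
(* The one-sided preimages of all coefficients of right-hand degree [N] are assembled into one row;
   [T] lists the basis elements that occur in [x]. *)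
pose y : 'rV[R]_p := \row_c \sum_(b <- T | deg b == N) epure (Y b 0 c) (bas A b).
have yE c b : rc (y 0 c) b = if (b \in T) && (deg b == N) then Y b 0 c else 0.
  rewrite mxE rc_sum big_mkcond.
  under eq_bigr do rewrite rc_bas.
  have [bT|bT] := boolP (b \in T).
    rewrite (bigD1_seq b) ?undup_uniq //= eqxx big1 ?addr0 // => b' /negPf ->.
    by rewrite if_same.
  rewrite big1_seq // => b' /andP[_ b'T]; case: eqP => // _; case: eqP => // Eb.
  by move: bT; rewrite -Eb b'T.
have hy : hom_row ed sp t y.
  move=> c; apply/env_degP => b; rewrite yE; case: ifP => _; last exact: gr0.
  by have [/(_ c)] := HY b; rewrite addrAC.
have yN c : rfil N (y 0 c).
  by move=> b bN; rewrite yE (ltn_eqF bN) andbF.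
have subE a : (x - y *m M') 0 a = x 0 a - (y *m M') 0 a by rewrite !mxE.
exists y; split=> // a b; rewrite ltnS leq_eqVlt => /orP[/eqP Eb|bN]; last first.
  rewrite subE rcD xN // add0r rcN mxE rc_sum big1 ?oppr0 // => c _.
  by have [h _] := @Mf' c a _ _ (yN c); apply: h.
have := leads_coef (b := b) (x := y) Mf'; rewrite Eb => /(_ yN) /rowP /(_ a).
rewrite mxE => Ey; rewrite subE rcD rcN Ey.
have [_ /(_ Eb)] := HY b.
have [bT|bT] := boolP (b \in T).
  have -> : row_coef y b = Y b by apply/rowP => c; rewrite mxE yE bT Eb eqxx.
  by move/rowP/(_ a); rewrite mxE => ->; rewrite subrr.
have -> : row_coef y b = 0 by apply/rowP => c; rewrite [LHS]mxE yE (negPf bT) mxE.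
rewrite mul0mx mxE subr0 => _.
have [_] := HS a; apply; apply: contra bT => bS.
by rewrite mem_undup; apply/flattenP; exists (S a) => //; apply: map_f; rewrite mem_enum.
Qed.

(** Every step raises the right-hand degree of the remainder by one. Generators have degree at least
    0 and A has no negative degrees, so a row of degree [t] has nothing in right-hand degrees above
    [t]; [K] counts the steps left. *)
Lemma lift_hom t (x : 'rV_q) : hom_row ed sq t x -> x *m M = 0 ->
  exists y, x = y *m M'.
Proof.
move=> hx xM.
suff H K N x' : (t < (N + K)%N%:Z)%R -> hom_row ed sq t x' ->
    (forall a, rfil N (x' 0 a)) -> x' *m M = 0 -> exists y, x' = y *m M'.
  by apply: (H (absz t).+1 0 x) => //; case: t {hx H} => t /=; lia.
elim: K N x' => [|K IHK] N x' tN hx' x'N x'M.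
  exists 0; rewrite mul0mx; apply/rowP => a; rewrite mxE; apply: rc_inj => b.
  rewrite rc0; have [/x'N//|bN] := ltnP (deg b) N.
  have /env_degP/(_ b) := hx' a => /gr_neg; apply.
  by have := sq0 a; lia.
have [y [hy Hy]] := lift_step hx' x'N x'M.
have [||||y' Ey'] := IHK N.+1 (x' - y *m M'); rewrite ?addSnnS //.
- apply: (gradingB (hom_row_grading (env_grading A) sq) hx').
  exact: (hom_row_mul (env_grading A) (@env_degM k n A) hy hM').
- by rewrite mulmxBl x'M -mulmxA M'M mulmx0 subr0.
by exists (y' + y); rewrite mulmxDl -Ey' subrK.
Qed.

Lemma lift_exact (x : 'rV_q) : x *m M = 0 -> exists y, x = y *m M'.
Proof.
move=> /(hom_row_ker (env_grading A) (@env_degM k n A) hM) [S hS ->].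
elim: S hS => [|[t x'] S IHS] hS; first by exists 0; rewrite big_nil mul0mx.
have [|y Ey] := IHS; first by move=> s sS; apply: hS; rewrite inE sS orbT.
have [/lift_hom h /h[y' Ey']] := hS _ (mem_head _ _).
by exists (y' + y); rewrite big_cons mulmxDl -Ey Ey'.
Qed.

End Lift.

End Filtration.

(** * The bimodule complex *)

(** Letters 0, 1, 2 are [ul], [dl], [wl] and 3, 4, 5 are [ur], [dr], [wr]. The right-hand letters
    satisfy the reversed relations and commute with the left-hand ones. *)
Definition env_rules : seq (seq nat * seq (int * seq nat)) :=
  [:: ([:: 1; 1; 0], [:: (Negz 0, [:: 0; 1; 1])]);
      ([:: 1; 0; 0], [:: (Posz 1, [:: 2]); (Negz 0, [:: 0; 0; 1])]);
      ([:: 0; 2], [:: (Posz 1, [:: 2; 0])]);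
      ([:: 1; 2], [:: (Posz 1, [:: 2; 1])]);
      ([:: 3; 4; 4], [:: (Negz 0, [:: 4; 4; 3])]);
      ([:: 3; 3; 4], [:: (Posz 1, [:: 5]); (Negz 0, [:: 4; 3; 3])]);
      ([:: 3; 5], [:: (Posz 1, [:: 5; 3])]);
      ([:: 4; 5], [:: (Posz 1, [:: 5; 4])]);
      ([:: 3; 0], [:: (Posz 1, [:: 0; 3])]);
      ([:: 3; 1], [:: (Posz 1, [:: 1; 3])]);
      ([:: 3; 2], [:: (Posz 1, [:: 2; 3])]);
      ([:: 4; 0], [:: (Posz 1, [:: 0; 4])]);
      ([:: 4; 1], [:: (Posz 1, [:: 1; 4])]);
      ([:: 4; 2], [:: (Posz 1, [:: 2; 4])]);
      ([:: 5; 0], [:: (Posz 1, [:: 0; 5])]);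
      ([:: 5; 1], [:: (Posz 1, [:: 1; 5])]);
      ([:: 5; 2], [:: (Posz 1, [:: 2; 5])])]%N.

(* Letter [6 + j] stands for the idempotent of weight [j - 4].                *)
Definition env_weight_rules : seq (seq nat * seq (int * seq nat)) :=
  flatten [seq [:: ([:: 6 + j.+1; 0], [:: (Posz 1, [:: 0; 6 + j])]);
                   ([:: 6 + j; 1], [:: (Posz 1, [:: 1; 6 + j.+1])]);
                   ([:: 6 + j.+1; 2], [:: (Posz 1, [:: 2; 6 + j])]);
                   ([:: 6 + j.+1; 3], [:: (Posz 1, [:: 3; 6 + j])]);
                   ([:: 6 + j; 4], [:: (Posz 1, [:: 4; 6 + j.+1])]);
                   ([:: 6 + j.+1; 5], [:: (Posz 1, [:: 5; 6 + j])])]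
          | j <- iota 0 8]%N.

Section CyclicShift.
Variable n : nat.

(** Weights are integers instead of residues, so that they add without reduction and one list of
    rules serves every [n]. *)
Definition cshift (m : int) (i : 'I_n) : 'I_n :=
  match m with Posz a => iter a (@ordS n) i | Negz a => iter a.+1 (@ord_pred n) i end.

Lemma cshiftSl m i : cshift (m + 1) i = ordS (cshift m i).
Proof.
case: m => [a|[|a]]; first by rewrite -PoszD addn1.
  by rewrite /= ord_predK.
have -> : Negz a.+1 + 1 = Negz a by rewrite !NegzE; lia.
by rewrite /cshift [in RHS]iterS ord_predK.
Qed.

Lemma cshiftSr m i : cshift (m + 1) i = cshift m (ordS i).
Proof.
case: m => [a|[|a]]; first by rewrite -PoszD addn1; exact: iterSr.
  by rewrite /= ordSK.
have -> : Negz a.+1 + 1 = Negz a by rewrite !NegzE; lia.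
by rewrite -[RHS]/(iter a.+2 (@ord_pred n) (ordS i)) [RHS]iterSr ordSK.
Qed.

End CyclicShift.

Section EnvLetters.
Variables (k : fieldType) (n : nat) (A : pbw_algebra k n).
Local Notation R := (env A).
Local Notation u := (gu A).
Local Notation d := (gd A).
Local Notation e := (@ge k n A).
Local Notation w := (gw A).

Definition ul : R := epure u 1.
Definition dl : R := epure d 1.
Definition wl : R := epure w 1.
Definition ur : R := epure 1 u.
Definition dr : R := epure 1 d.
Definition wr : R := epure 1 w.
(** The idempotent cutting the sum of the A e_i (x) e_(i + m) A out of the enveloping algebra. *)
Definition epi (m : int) : R := \sum_i epure (e i) (e (cshift m i)).

Lemma gd_gu_gu : d * u * u = w - u * u * d.
Proof. by rewrite /gw addrAC subrr add0r. Qed.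

Let lr (a b : A) : epure 1 b * epure a 1 = epure a 1 * epure 1 b.
Proof. by rewrite !epureM !mul1r !mulr1. Qed.

Let ll (a b : A) : epure a 1 * epure b 1 = epure (a * b) 1.
Proof. by rewrite epureM mulr1. Qed.

Let rr (a b : A) : epure 1 a * epure 1 b = epure 1 (b * a).
Proof. by rewrite epureM mulr1. Qed.

Let epureNr (a b : A) : epure a (- b) = - epure a b.
Proof. by apply: (addIr (epure a b)); rewrite -epureDr !addNr epure0r. Qed.

Lemma env_ok : ncvalid (nth 0 [:: ul; dl; wl; ur; dr; wr]) env_rules.
Proof.
rewrite /ncvalid /ncword /ncpval /= !mulr1 !addr0 !mulr1z !NegzE !mulrNz !mulr1z.
rewrite /ul /dl /wl /ur /dr /wr !mulrA !lr !ll !rr.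
rewrite !mulrA !g_rel1 !gd_gu_gu !gu_gw !gd_gw !epureDl !epureDr !epureNl !epureNr.
by do !split.
Qed.

Lemma epi_ul m : epi (m + 1) * ul = ul * epi m.
Proof.
rewrite /epi mulr_suml mulr_sumr [RHS](reindex_inj (can_inj (@ordSK n))).
by apply: eq_bigr => i _; rewrite !epureM mul1r mulr1 ge_gu cshiftSr.
Qed.

Lemma epi_dl m : epi m * dl = dl * epi (m + 1).
Proof.
rewrite /epi mulr_suml mulr_sumr [LHS](reindex_inj (can_inj (@ordSK n))).
by apply: eq_bigr => i _; rewrite !epureM mul1r mulr1 ge_gd cshiftSr.
Qed.

Lemma epi_ur m : epi (m + 1) * ur = ur * epi m.
Proof.
rewrite /epi mulr_suml mulr_sumr.
by apply: eq_bigr => i _; rewrite !epureM mul1r mulr1 ge_gu cshiftSl.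
Qed.

Lemma epi_dr m : epi m * dr = dr * epi (m + 1).
Proof.
rewrite /epi mulr_suml mulr_sumr.
by apply: eq_bigr => i _; rewrite !epureM mul1r mulr1 -ge_gd cshiftSl.
Qed.

Lemma wlE : wl = ul * ul * dl + dl * ul * ul.
Proof. by rewrite /ul /dl !ll -epureDl. Qed.

Lemma wrE : wr = dr * ur * ur + ur * ur * dr.
Proof. by rewrite /ur /dr !rr -epureDr !mulrA. Qed.

Lemma epi_wl m : epi (m + 1) * wl = wl * epi m.
Proof.
rewrite wlE mulrDr mulrDl !mulrA; congr (_ + _).
  have E : epi (m + 1) * ul * ul = ul * (ul * epi (m - 1)).
    by rewrite epi_ul -mulrA -{1}[m](subrK 1) epi_ul.
  by rewrite E -!mulrA epi_dl subrK.
by rewrite epi_dl -(mulrA dl) epi_ul -!mulrA epi_ul.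
Qed.

Lemma epi_wr m : epi (m + 1) * wr = wr * epi m.
Proof.
rewrite wrE mulrDr mulrDl !mulrA; congr (_ + _).
  by rewrite epi_dr -(mulrA dr) epi_ur -!mulrA epi_ur.
have E : epi (m + 1) * ur * ur = ur * (ur * epi (m - 1)).
  by rewrite epi_ur -mulrA -{1}[m](subrK 1) epi_ur.
by rewrite E -!mulrA epi_dr subrK.
Qed.

Lemma epi_idem m : epi m * epi m = epi m.
Proof.
rewrite /epi mulr_suml; apply: eq_bigr => i _; rewrite mulr_sumr (bigD1 i) //= big1.
  by rewrite epureM !ge_ge !eqxx addr0.
by move=> j ji; rewrite epureM ge_ge eq_sym (negPf ji) epure0l.
Qed.

Lemma env_weight_ok : ncvalid (nth 0 [:: ul; dl; wl; ur; dr; wr; epi (Negz 3);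
  epi (Negz 2); epi (Negz 1); epi (Negz 0); epi (Posz 0); epi (Posz 1);
  epi (Posz 2); epi (Posz 3); epi (Posz 4)]) env_weight_rules.
Proof.
rewrite /ncvalid /ncword /=.
have H m m' : m + 1 = m' -> [/\ epi m' * ul = ul * epi m, epi m * dl = dl * epi m',
    epi m' * wl = wl * epi m, epi m' * ur = ur * epi m & epi m * dr = dr * epi m'] /\
    epi m' * wr = wr * epi m.
  move=> <-; split; last exact: epi_wr.
  by split; [exact: epi_ul | exact: epi_dl | exact: epi_wl | exact: epi_ur | exact: epi_dr].
have [[H1 H2 H3 H4 H5] H6] := H (Negz 3) (Negz 2) erefl.
have [[H11 H12 H13 H14 H15] H16] := H (Negz 2) (Negz 1) erefl.
have [[H21 H22 H23 H24 H25] H26] := H (Negz 1) (Negz 0) erefl.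
have [[H31 H32 H33 H34 H35] H36] := H (Negz 0) (Posz 0) erefl.
have [[H41 H42 H43 H44 H45] H46] := H (Posz 0) (Posz 1) erefl.
have [[H51 H52 H53 H54 H55] H56] := H (Posz 1) (Posz 2) erefl.
have [[H61 H62 H63 H64 H65] H66] := H (Posz 2) (Posz 3) erefl.
have [[H71 H72 H73 H74 H75] H76] := H (Posz 3) (Posz 4) erefl.
by rewrite !mulr1 !addr0 !mulr1z; do !split.
Qed.

End EnvLetters.

Section BimoduleComplex.
Variables (k : fieldType) (n : nat) (A : pbw_algebra k n).
Local Notation R := (env A).
Local Notation ed := (env_deg (@gr k n A)).
Local Notation u := (gu A).
Local Notation d := (gd A).
Local Notation w := (gw A).
Local Notation ul := (ul A).
Local Notation dl := (dl A).
Local Notation wl := (wl A).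
Local Notation ur := (ur A).
Local Notation dr := (dr A).
Local Notation wr := (wr A).
Local Notation epi := (epi A).

(* Degree and cyclic weight of the generators in each homological degree: a   *)
(* generator of weight m spans the sum of the bimodules A e_i (x) e_(i + m) A. *)
Definition gens (j : nat) : seq (int * int) :=
  match j with
  | 0 => [:: (Posz 0, Posz 0)]
  | 1 => [:: (Posz 1, Posz 1); (Posz 1, Negz 0)]
  | 2 => [:: (Posz 3, Negz 0); (Posz 4, Posz 2)]
  | 3 => [:: (Posz 6, Posz 0); (Posz 6, Posz 2)]
  | 4 => [:: (Posz 7, Posz 1)]
  | _ => [::]
  end.

Definition rk (j : nat) : nat := size (gens j).
Definition gdeg j (a : 'I_(rk j)) : int := (nth (0, 0) (gens j) a).1.
Definition gwt j (a : 'I_(rk j)) : int := (nth (0, 0) (gens j) a).2.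

(* Fox derivatives of the relations, and of the relations between them        *)
Definition dmat (j a b : nat) : R :=
  match j, a, b with
  | 0, 0, _ => ul - ur
  | 0, _, _ => dl - dr
  | 1, 0, 0 => dl * dl + dr * dr
  | 1, 0, _ => ur * dr + dl * ur + ul * dr + ul * dl
  | 1, _, 0 => wr - wl + ul * dr * ur + ul * ul * dr - ur * dr * ur - ul * ur * dr
               + ul * dl * ur + ul * dl * ul - dl * ur * ur - dl * ul * ur
  | 1, _, _ => ul * ul * ul - ul * ul * ur + ul * ur * ur - ur * ur * ur
  | 2, 0, 0 => wl - wr + dl * ur * ur - dl * ul * ur + ur * dr * ur - ul * ur * dr
               + ul * dl * ur - ul * dl * ul + ul * dr * ur - ul * ul * dr
  | 2, 0, _ => dl * dl + dr * dr
  | 2, _, 0 => ur * ur * ur - ul * ur * ur + ul * ul * ur - ul * ul * ul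
  | 2, _, _ => dl * ur + dl * ul + ul * dr + dr * ur
  | 3, _, 0 => ul - ur
  | 3, _, _ => dl - dr
  | _, _, _ => 0
  end.

(** The leading part of [dmat], obtained by setting the right-hand letters [ur], [dr], [wr] to 0. *)
Definition lmat (j a b : nat) : A :=
  match j, a, b with
  | 0, 0, _ => u
  | 0, _, _ => d
  | 1, 0, 0 => d * d
  | 1, 0, _ => u * d
  | 1, _, 0 => - w + u * d * u
  | 1, _, _ => u * u * u
  | 2, 0, 0 => w - u * d * u
  | 2, 0, _ => d * d
  | 2, _, 0 => - (u * u * u)
  | 2, _, _ => d * u
  | 3, _, 0 => u
  | 3, _, _ => d
  | _, _, _ => 0
  end.

Definition Dm j : 'M[R]_(rk j.+1, rk j) := \matrix_(a, b) dmat j a b.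
Definition Lm j : 'M[A]_(rk j.+1, rk j) := \matrix_(a, b) lmat j a b.
Definition Em j : 'M[R]_(rk j) := \matrix_(a, b) if a == b then epi (gwt a) else 0.

Ltac er := ncring [:: ul; dl; wl; ur; dr; wr] (env_ok A).

(** For j = 0 this is a telescoping sum: the derivatives of a relation r, multiplied by the x (x) 1
    - 1 (x) x, add up to r (x) 1 - 1 (x) r, which vanishes. All entries are checked by normal
    forms. *)
Lemma Dm_Dm j : Dm j.+1 *m Dm j = 0.
Proof.
apply/matrixP => a b; rewrite !mxE.
case: j a b => [|[|[|[|j]]]] [[|[|a]] ia] [[|[|b]] ib] //=;
  rewrite !big_ord_recl big_ord0 !mxE /= ?mulr0 ?add0r ?addr0 //; er.
Qed.

Lemma Em_idem j : Em j *m Em j = Em j.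
Proof.
apply/matrixP => a b; rewrite mxE (bigD1 a) //= big1 ?addr0 => [|c ca].
  by rewrite !mxE eqxx; case: eqP => _; rewrite ?mulr0 ?epi_idem.
by rewrite mxE eq_sym (negPf ca) mul0r.
Qed.

Ltac erw := ncring [:: ul; dl; wl; ur; dr; wr; epi (Negz 3); epi (Negz 2);
  epi (Negz 1); epi (Negz 0); epi (Posz 0); epi (Posz 1); epi (Posz 2); epi (Posz 3);
  epi (Posz 4)] (env_weight_ok A).

Lemma dmat_weight j (a : 'I_(rk j.+1)) (b : 'I_(rk j)) :
  epi (gwt a) * dmat j a b = dmat j a b * epi (gwt b).
Proof.
by case: j a b => [|[|[|[|j]]]] [[|[|a]] ia] [[|[|b]] ib] //; rewrite /gwt /=; erw.
Qed.

Lemma Em_Dm j : Em j.+1 *m Dm j = Dm j *m Em j.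
Proof.
apply/matrixP => a b; rewrite !mxE (bigD1 a) //= big1 ?addr0 => [|c ca]; last first.
  by rewrite mxE eq_sym (negPf ca) mul0r.
rewrite (bigD1 b) //= big1 ?addr0 => [|c cb]; last first.
  by rewrite [Em j _ _]mxE (negPf cb) mulr0.
by rewrite !mxE !eqxx dmat_weight.
Qed.

Let ulP : ed 1 ul. Proof. by rewrite -[1]addr0; apply: env_deg_pure (gr_gu A) (gr1 A). Qed.
Let dlP : ed 1 dl. Proof. by rewrite -[1]addr0; apply: env_deg_pure (gr_gd A) (gr1 A). Qed.
Let urP : ed 1 ur. Proof. by rewrite -[1]add0r; apply: env_deg_pure (gr1 A) (gr_gu A). Qed.
Let drP : ed 1 dr. Proof. by rewrite -[1]add0r; apply: env_deg_pure (gr1 A) (gr_gd A). Qed.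

Let edM t x y : ed 1 x -> ed (t - 1) y -> ed t (y * x).
Proof. by move=> hx hy; rewrite -(subrK 1 t); apply: env_degM. Qed.

Lemma epi_deg m : ed 0 (epi m).
Proof.
rewrite /epi; elim/big_rec: _ => [|i x _ hx]; first exact: env_deg0.
by apply: env_degD hx; rewrite -[0]addr0; apply: env_deg_pure; apply: gr_ge.
Qed.

Lemma Em_hom j : hom_mx ed (@gdeg j) (@gdeg j) (Em j).
Proof.
move=> a b; rewrite mxE; case: eqP => [->|_]; last exact: env_deg0.
by rewrite subrr; apply: epi_deg.
Qed.

Lemma Dm_hom j : hom_mx ed (@gdeg j.+1) (@gdeg j) (Dm j).
Proof.
move=> a b; rewrite mxE.
case: j a b => [|[|[|[|j]]]] [[|[|a]] ia] [[|[|b]] ib] //; rewrite /gdeg /= ?wlE ?wrE;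
  do ![apply: env_degD | apply: env_degN | apply: edM];
  by [exact: ulP | exact: dlP | exact: urP | exact: drP].
Qed.

Lemma Lm_hom j : hom_mx (@gr k n A) (@gdeg j.+1) (@gdeg j) (Lm j).
Proof.
have grM1 t x y : gr 1 x -> gr (t - 1) y -> gr t (y * x : A).
  by move=> hx hy; rewrite -(subrK 1 t); apply: grM.
move=> a b; rewrite mxE.
case: j a b => [|[|[|[|j]]]] [[|[|a]] ia] [[|[|b]] ib] //; rewrite /gdeg /= /gw;
  do ?[apply: grD | apply: grN | apply: (grM1)];
  by [exact: (gr_gu A) | exact: (gr_gd A)].
Qed.

Let leads_ul : leads ul u. Proof. exact: leads_l. Qed.
Let leads_dl : leads dl d. Proof. exact: leads_l. Qed.
Let leads_ur : leads ur 0. Proof. exact: leads_r (gr_gu A) isT. Qed.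
Let leads_dr : leads dr 0. Proof. exact: leads_r (gr_gd A) isT. Qed.

Let leads_eq (r : R) (a b : A) : a = b -> leads r a -> leads r b.
Proof. by move=> ->. Qed.

Lemma Dm_leads j a b : leads (Dm j a b) (Lm j a b).
Proof.
rewrite !mxE.
(* Unification assembles the leading part from the shape of each entry; it is then simplified to the
   one in [lmat]. *)
case: j a b => [|[|[|[|j]]]] [[|[|a]] ia] [[|[|b]] ib] //; rewrite /= ?wlE ?wrE;
  (eapply leads_eq; last do ![apply: leadsD | apply: leadsN | apply: leadsM
     | exact: leads_ul | exact: leads_dl | exact: leads_ur | exact: leads_dr]);
  by rewrite /gw ?(mul0r, mulr0, oppr0, addr0, add0r).
Qed.

End BimoduleComplex.

(** * Rotation and duality *)

Lemma cshift0 n (i : 'I_n) : cshift 0 i = i. Proof. by []. Qed.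

Lemma cshiftD n l m (i : 'I_n) : cshift (l + m) i = cshift l (cshift m i).
Proof.
elim/int_rect: l i => [|l IHl|l IHl] i; first by rewrite add0r.
  by rewrite -addn1 PoszD addrAC !cshiftSl IHl.
apply: (can_inj (@ordSK n)); rewrite -!cshiftSl.
have -> : - l.+1%:Z + m + 1 = - l%:Z + m by lia.
by have -> : - l.+1%:Z + 1 = - l%:Z by lia.
Qed.

Section Rotation.
Variables (k : fieldType) (n : nat) (A : pbw_algebra k n).
Local Notation u := (gu A).
Local Notation d := (gd A).
Local Notation e := (@ge k n A).

Definition rot (m : int) (p : pbw n) : pbw n :=
  let: (j, a, b, l, c) := p in (cshift m j, a, b, l, c).

(* The automorphism e_i |-> e_(i + m) fixing u and d.                         *)
Definition rot_aut (m : int) (x : A) : A :=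
  plin (fun p => bas A (rot m p) : kmod A) (coord x).

Variable m : int.
Local Notation nu := (rot_aut m).

Lemma nuD : {morph nu : x y / x + y}.
Proof. by move=> x y; rewrite /rot_aut coordD; exact: (@plinD _ _ (kmod A)). Qed.

Lemma nuZ c x : nu (kscale c x) = kscale c (nu x).
Proof. by rewrite /rot_aut coordZ; exact: (@plinZ _ _ (kmod A)). Qed.

Lemma nu0 : nu 0 = 0.
Proof. by apply: (addIr (nu 0)); rewrite -nuD !add0r. Qed.

Lemma nuN x : nu (- x) = - nu x.
Proof. by apply: (addIr (nu x)); rewrite -nuD !addNr nu0. Qed.

Lemma nu_sum T (r : seq T) (F : T -> A) :
  nu (\sum_(i <- r) F i) = \sum_(i <- r) nu (F i).
Proof. exact: (big_morph nu nuD nu0). Qed.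

Lemma nu_bas p : nu (bas A p) = bas A (rot m p).
Proof. by rewrite /rot_aut coord_bas; exact: (@plinU _ _ (kmod A)). Qed.

Lemma nu_ext (f g : A -> A) : {morph f : x y / x + y} -> {morph g : x y / x + y} ->
  (forall c x, f (kscale c x) = kscale c (f x)) ->
  (forall c x, g (kscale c x) = kscale c (g x)) ->
  (forall p, f (bas A p) = g (bas A p)) -> f =1 g.
Proof.
move=> fD gD fZ gZ fg x; rewrite [x]cf_expand.
have f0 : f 0 = 0 by apply: (addIr (f 0)); rewrite -fD !add0r.
have g0 : g 0 = 0 by apply: (addIr (g 0)); rewrite -gD !add0r.
rewrite (big_morph f fD f0) (big_morph g gD g0).
by apply: eq_bigr => p _; rewrite fZ gZ fg.
Qed.

Lemma nu_u x : nu (x * u) = nu x * u.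
Proof.
apply: (nu_ext (f := fun x => nu (x * u)) (g := fun x => nu x * u)) x.
- by move=> x y; rewrite mulrDl nuD.
- by move=> x y; rewrite nuD mulrDl.
- by move=> c x; rewrite -kscaleAl nuZ.
- by move=> c x; rewrite nuZ -kscaleAl.
move=> p; rewrite bas_gu // kscale1 !nu_bas bas_gu // kscale1.
by case: p => [[[[j a] b] l] c]; rewrite /= -cshiftSr cshiftSl.
Qed.

Lemma nu_e x i : nu (x * e i) = nu x * e (cshift m i).
Proof.
apply: (nu_ext (f := fun x => nu (x * e i)) (g := fun x => nu x * e (cshift m i))) x.
- by move=> x y; rewrite mulrDl nuD.
- by move=> x y; rewrite nuD mulrDl.
- by move=> c x; rewrite -kscaleAl nuZ.
- by move=> c x; rewrite nuZ -kscaleAl.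
case=> [[[[j a] b] l] c]; rewrite nu_bas /= -!mulrA !ge_ge.
have cs_inj : injective (@cshift n m).
  by apply: (can_inj (g := cshift (- m))) => j'; rewrite -cshiftD addNr.
rewrite (inj_eq cs_inj); case: eqP => _; last by rewrite !mulr0 nu0.
by rewrite !mulrA; exact: (nu_bas (j, a, b, l, c)).
Qed.

(** Satisfied by combinations of the d^a z^b w^m u^c without vertex idempotents. Straightening a
    product with [d] stays among these, so [nu] commutes with right multiplication by [d]. *)
Let shifted (y : A) : Prop := forall j, nu (y * e j) = y * e (cshift m j).

Let shifted_word a b l c : shifted (pbwT A a b l * u ^+ c).
Proof. by move=> j; apply: (nu_bas (j, a, b, l, c)). Qed.

Let shiftedD x y : shifted x -> shifted y -> shifted (x + y).
Proof. by move=> hx hy j; rewrite !mulrDl nuD hx hy. Qed.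

Let shiftedN x : shifted x -> shifted (- x).
Proof. by move=> hx j; rewrite !mulNr nuN hx. Qed.

Let shiftedZ c x : shifted x -> shifted (kscale c x).
Proof. by move=> hx j; rewrite -!kscaleAl nuZ hx. Qed.

Let shifted_word_d a b l c : shifted (pbwT A a b l * u ^+ c * d).
Proof.
have hTd s x : shifted (kscale s (pbwT A a.+1 b l) * u ^+ x).
  by rewrite -kscaleAl; apply: shiftedZ.
move: (c %/ 4 * 4)%N (divn_eq c 4) (modnMl (c %/ 4) 4) (ltn_pmod c (isT : 0 < 4)%N).
move=> q Ec c4; move: (c %% 4)%N Ec => r -> r4.
case: r r4 => [|[|[|[|]]]] // _; rewrite ?addn0 ?addn1 ?addn2 ?addn3.
- by rewrite guX_gd0 // pbwT_gd.
- rewrite guX_gd1 // pbwT_gd pbwT_gz gJE.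
  by apply: shiftedD => //; apply: shiftedN; apply: shiftedZ.
- rewrite guX_gd2 // pbwT_gd pbwT_gw.
  by apply: shiftedD => //; apply: shiftedN.
rewrite guX_gd3 // pbwT_gd pbwT_gw pbwT_gz gJE.
by apply: shiftedD; [apply: shiftedD => //; apply: shiftedN | apply: shiftedZ].
Qed.

Lemma nu_d x : nu (x * d) = nu x * d.
Proof.
apply: (nu_ext (f := fun x => nu (x * d)) (g := fun x => nu x * d)) x.
- by move=> x y; rewrite mulrDl nuD.
- by move=> x y; rewrite nuD mulrDl.
- by move=> c x; rewrite -kscaleAl nuZ.
- by move=> c x; rewrite nuZ -kscaleAl.
case=> [[[[j a] b] l] c]; rewrite nu_bas /= -!(mulrA _ (e _) d) !ge_gd_pred.
rewrite !mulrA shifted_word_d; congr (_ * e _).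
by apply: (can_inj (@ordSK n)); rewrite ord_predK -cshiftSl cshiftSr ord_predK.
Qed.

Lemma nu1 : nu 1 = 1.
Proof.
have E1 i : e i = bas A (i, 0, 0, 0, 0)%N by rewrite /= /pbwT !expr0 !mul1r.
rewrite -{1}(ge_sum A) nu_sum -[RHS](ge_sum A).
rewrite [RHS](reindex_inj (h := @cshift n m)); last first.
  by apply: (can_inj (g := cshift (- m))) => j'; rewrite -cshiftD addNr.
by apply: eq_bigr => i _; rewrite !E1 nu_bas.
Qed.

Lemma nuM x y : nu (x * y) = nu x * nu y.
Proof.
elim/pbw_alg_ind: y x => [|y y' Ey Ey'|c y Ey|y Ey|y Ey|y i Ey] x.
- by rewrite nu1 !mulr1.
- by rewrite mulrDr !nuD Ey Ey' mulrDr.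
- by rewrite -kscaleAr !nuZ Ey kscaleAr.
- by rewrite mulrA !nu_u Ey mulrA.
- by rewrite mulrA !nu_d Ey mulrA.
by rewrite mulrA !nu_e Ey mulrA.
Qed.

Lemma nu_gu : nu u = u. Proof. by rewrite -[u]mul1r nu_u nu1. Qed.
Lemma nu_gd : nu d = d. Proof. by rewrite -[d]mul1r nu_d nu1. Qed.
Lemma nu_ge i : nu (e i) = e (cshift m i). Proof. by rewrite -[e i]mul1r nu_e nu1 mul1r. Qed.

Lemma nu_gr j x : gr j x -> gr j (nu x).
Proof.
move=> /gr_cfP gx; rewrite [x]cf_expand nu_sum big_seq.
elim/big_rec: _ => [|p y px gy]; first exact: gr0.
apply: grD gy; rewrite nuZ nu_bas; apply: grZ; rewrite -(gx p) -?mem_cfsupp //.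
have -> : pbw_deg p = pbw_deg (rot m p) by case: (p) => [[[[]]]].
exact: bas_gr.
Qed.

End Rotation.

Lemma nu_nu k n (A : pbw_algebra k n) l m (x : A) : rot_aut l (rot_aut m x) = rot_aut (l + m) x.
Proof.
apply: (nu_ext (f := fun x => rot_aut l (rot_aut m x)) (g := rot_aut (l + m))) x.
- by move=> x y; rewrite !nuD.
- by move=> x y; rewrite nuD.
- by move=> c x; rewrite !nuZ.
- by move=> c x; rewrite nuZ.
by move=> p; rewrite !nu_bas; case: p => [[[[j a] b] h] c]; rewrite /= cshiftD.
Qed.

Lemma nu_0 k n (A : pbw_algebra k n) (x : A) : rot_aut 0 x = x.
Proof.
rewrite [x in LHS]cf_expand nu_sum [RHS]cf_expand.
by apply: eq_bigr => p _; rewrite nuZ nu_bas; case: p => [[[[j a] b] h] c].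
Qed.

Section Duality.
Variables (k : fieldType) (n : nat) (A : pbw_algebra k n).
Local Notation R := (env A).
Local Notation ed := (env_deg (@gr k n A)).
Local Notation kbal := (balanced (fun (a : A) (c : k) => kscale c a)
  (fun (c : k) (b : A) => kscale c b)).

Let tau_fun l m (a b : A) : R := epure (rot_aut l b) (rot_aut m a).

Let tau_balanced l m : kbal (tau_fun l m).
Proof.
split=> [a a' b|a b b'|a c b]; rewrite /tau_fun ?nuD ?epureDl ?epureDr //.
by rewrite !nuZ epureZ.
Qed.

(** An anti-automorphism of the enveloping algebra exchanging left and right letters. The rotations
    adjust the weights: for l = 0 and m = 1 it carries [epi 1] to [epi 0]. *)
Definition tau l m (r : R) : R := tlift (tau_fun l m) r.

Section Weights.
Variables (l m : int).
Local Notation tau := (tau l m).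

Lemma tauD : {morph tau : x y / x + y}.
Proof. exact: tliftD (tau_balanced l m). Qed.

Lemma tau0 : tau 0 = 0.
Proof. by apply: (addIr (tau 0)); rewrite -tauD !add0r. Qed.

Lemma tauN x : tau (- x) = - tau x.
Proof. by apply: (addIr (tau x)); rewrite -tauD !addNr tau0. Qed.

Lemma tau_pure a b : tau (epure a b) = epure (rot_aut l b) (rot_aut m a).
Proof. exact: tlift_pure (tau_balanced l m). Qed.

Lemma tau_sum T (r : seq T) (P : pred T) (F : T -> R) :
  tau (\sum_(i <- r | P i) F i) = \sum_(i <- r | P i) tau (F i).
Proof. exact: (big_morph tau tauD tau0). Qed.

Lemma tauM x y : tau (x * y) = tau y * tau x.
Proof.
elim/env_ind: x => [|x x' Ex Ex'|a b].
- by rewrite mul0r tau0 mulr0.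
- by rewrite mulrDl !tauD Ex Ex' mulrDr.
elim/env_ind: y => [|x x' Ex Ex'|a' b'].
- by rewrite mulr0 tau0 mul0r.
- by rewrite mulrDr !tauD Ex Ex' mulrDl.
by rewrite epureM !tau_pure epureM !nuM.
Qed.

Lemma tau_deg t x : ed t x -> ed t (tau x).
Proof.
move=> [h [a [b [i [j [hab ->]]]]]]; rewrite tau_sum.
elim/big_rec: _ => [|c r _ hr]; first exact: env_deg0.
apply: env_degD hr; have [ga gb <-] := hab c; rewrite tau_pure addrC.
by apply: env_deg_pure; apply: nu_gr.
Qed.

Lemma tau_ul : tau (ul A) = ur A. Proof. by rewrite tau_pure nu_gu nu1. Qed.
Lemma tau_dl : tau (dl A) = dr A. Proof. by rewrite tau_pure nu_gd nu1. Qed.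
Lemma tau_ur : tau (ur A) = ul A. Proof. by rewrite tau_pure nu_gu nu1. Qed.
Lemma tau_dr : tau (dr A) = dl A. Proof. by rewrite tau_pure nu_gd nu1. Qed.

Definition tau_mx p q (M : 'M[R]_(p, q)) : 'M[R]_(q, p) := \matrix_(a, b) tau (M b a).

Lemma tau_mxM p q r (M : 'M_(p, q)) (N : 'M_(q, r)) :
  tau_mx (M *m N) = tau_mx N *m tau_mx M.
Proof.
by apply/matrixP => a b; rewrite !mxE tau_sum; apply: eq_bigr => c _; rewrite !mxE tauM.
Qed.

Lemma tau_mx0 p q : tau_mx (0 : 'M_(p, q)) = 0.
Proof. by apply/matrixP => a b; rewrite !mxE tau0. Qed.

End Weights.

Lemma tauK l m : cancel (tau l m) (tau (- m) (- l)).
Proof.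
move=> x; elim/env_ind: x => [|x y Ex Ey|a b]; first by rewrite !tau0.
  by rewrite !tauD Ex Ey.
by rewrite !tau_pure !nu_nu !addNr !nu_0.
Qed.

Lemma tau_mxK l m p q : cancel (@tau_mx l m p q) (@tau_mx (- m) (- l) q p).
Proof. by move=> M; apply/matrixP => a b; rewrite !mxE tauK. Qed.

End Duality.

(** * Exactness of the bimodule complex and of its augmentation *)

Section Exactness.
Variables (k : fieldType) (n : nat) (A : pbw_algebra k n).
Local Notation R := (env A).
Local Notation ed := (env_deg (@gr k n A)).
Local Notation u := (gu A).
Local Notation d := (gd A).
Local Notation w := (gw A).
Local Notation e := (@ge k n A).
Local Notation ul := (ul A).
Local Notation dl := (dl A).
Local Notation wl := (wl A).
Local Notation ur := (ur A).
Local Notation dr := (dr A).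
Local Notation wr := (wr A).
Local Notation epi := (epi A).
Local Notation Dm := (Dm A).
Local Notation Em := (Em A).

Let o0 : 'I_2 := ord0.
Let o1 : 'I_2 := lift ord0 ord0.

Let row2 (T : pzRingType) (x y : T) : 'rV[T]_2 := \row_a (if a == o0 then x else y).

Let row2P (T : pzRingType) (x y : 'rV[T]_2) :
  x 0 o0 = y 0 o0 -> x 0 o1 = y 0 o1 -> x = y.
Proof.
move=> h0 h1; apply/rowP; case=> [[|[|m]] hm] //.
  by have -> : Ordinal hm = o0 by apply: val_inj.
by have -> : Ordinal hm = o1 by apply: val_inj.
Qed.

Let mulmx2 (T : pzRingType) p (x : 'rV[T]_2) (M : 'M_(2, p)) b :
  (x *m M) 0 b = x 0 o0 * M o0 b + x 0 o1 * M o1 b.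
Proof. by rewrite mxE !big_ord_recl big_ord0 addr0. Qed.

Let mulmx1 (T : pzRingType) p (x : 'rV[T]_1) (M : 'M_(1, p)) b :
  (x *m M) 0 b = x 0 0 * M 0 b.
Proof. by rewrite mxE big_ord1. Qed.

Lemma Lm_exact j (x : 'rV[A]_(rk j.+1)) : x *m Lm A j = 0 -> exists y, x = y *m Lm A j.+1.
Proof.
case: j x => [|[|[|[|j]]]] x.
- move=> /rowP/(_ 0); rewrite mulmx2 !mxE /= => /one_sided_exact1[p [q [E0 E1]]].
  exists (row2 p q); apply: row2P; rewrite mulmx2 !mxE /= ?E0 ?E1 !mulrA //.
  by congr (_ + _); rewrite !mulrDr addrC mulrN !mulrA.
- move=> Hx; have := congr1 (fun z : 'rV_2 => z 0 o0) Hx.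
  have := congr1 (fun z : 'rV_2 => z 0 o1) Hx; rewrite /= !mulmx2 !mxE /=.
  rewrite !mulrA => H1 H0.
  have [||p [q [E0 E1]]] := one_sided_exact2 (x := x 0 o0) (y := x 0 o1).
  + by rewrite -H0 !mulrDr mulrN !mulrA [- _ + _]addrC.
  + by rewrite !mulrA.
  exists (row2 p q); apply: row2P; rewrite mulmx2 !mxE /= ?E0 ?E1 ?mulrN !mulrA //.
- move=> Hx; have := congr1 (fun z : 'rV_2 => z 0 o0) Hx.
  have := congr1 (fun z : 'rV_2 => z 0 o1) Hx; rewrite /= !mulmx2 !mxE /=.
  rewrite !mulrA => H1 H0.
  have [||t [E0 E1]] := one_sided_exact3 (x := x 0 o0) (y := x 0 o1).
  + by rewrite -H0 mulrN.
  + exact: H1.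
  exists (const_mx t : 'rV_1); apply: row2P; rewrite mulmx1 !mxE //=.
- move=> Hx; have := congr1 (fun z : 'rV_2 => z 0 o0) Hx.
  rewrite /= mulmx1 !mxE /= => /one_sided_exact4 x0.
  exists 0; rewrite mul0mx; apply/rowP => a; rewrite [RHS]mxE -x0.
  by congr (x _ _); apply: val_inj; case: a => [[]].
by exists 0; apply/rowP; case.
Qed.

Lemma Dm_exact j (x : 'rV[R]_(rk j.+1)) : x *m Dm j = 0 -> exists y, x = y *m Dm j.+1.
Proof.
apply: (lift_exact _ (@Dm_hom k n A j.+1) (@Dm_hom k n A j) (@Lm_hom k n A j.+1)
  (@Dm_Dm k n A j) (@Dm_leads k n A j.+1) (@Dm_leads k n A j) (@Lm_exact j)).
by case: j {x} => [|[|[|[|j]]]] [[|[|a]] ia].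
Qed.

Let aug (r : R) : Prop := exists y y', r = y * (ul - ur) + y' * (dl - dr).

Let augD r s : aug r -> aug s -> aug (r + s).
Proof.
move=> [a [b ->]] [a' [b' ->]]; exists (a + a'), (b + b').
by rewrite !mulrDl addrACA.
Qed.

Let augM r s : aug s -> aug (r * s).
Proof. by move=> [a [b ->]]; exists (r * a), (r * b); rewrite mulrDr !mulrA. Qed.

Let augu : aug (ul - ur). Proof. by exists 1, 0; rewrite mul1r mul0r addr0. Qed.
Let augd : aug (dl - dr). Proof. by exists 0, 1; rewrite mul1r mul0r add0r. Qed.

Let aug_trans s r t : aug (r - s) -> aug (s - t) -> aug (r - t).
Proof. by move=> h1 h2; rewrite -(subrKA s); apply: augD. Qed.

Let augN r : aug r -> aug (- r).
Proof. by move=> h; rewrite -mulN1r; apply: augM. Qed.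

Let epi_e i : epure 1 (e i) * epi 0 = epure (e i) 1 * epi 0.
Proof.
rewrite /epi !mulr_sumr; apply: eq_bigr => j _; rewrite !epureM mul1r mulr1 !cshift0 !ge_ge.
by rewrite eq_sym; case: eqP => [->|_] //; rewrite epure0l epure0r.
Qed.

(** In front of [epi 0] the letters of the right-hand factor can be moved to the left-hand one: the
    [e i] exactly, [u] and [d] modulo the left ideal, because (ul - ur) epi 0 = epi 1 (ul - ur) and
    similarly for [d]. *)
Let aug_pure b a : aug (epure a b * epi 0 - epure (a * b) 1 * epi 0).
Proof.
have step (r : R) (c x y : A) : aug (r * epi 0 - epure x 1 * epi 0) ->
    aug (epure 1 c * epi 0 - epure c 1 * epi 0) -> y = x * c ->
    aug (epure 1 c * r * epi 0 - epure y 1 * epi 0).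
  move=> hr hc ->; apply: (aug_trans (s := epure 1 c * epure x 1 * epi 0)).
    by rewrite -!mulrA -mulrBr; apply: augM.
  have -> : epure 1 c * epure x 1 = epure x 1 * epure 1 c by rewrite !epureM !mul1r !mulr1.
  have -> : epure (x * c) 1 = epure x 1 * epure c 1 by rewrite epureM mulr1.
  by rewrite -!mulrA -mulrBr; apply: augM.
elim/pbw_alg_ind: b a => [|y y' Ey Ey'|c y Ey|y Ey|y Ey|y i Ey] a.
- by rewrite mulr1 subrr; exists 0, 0; rewrite !mul0r addr0.
- rewrite epureDr mulrDr epureDl !mulrDl opprD addrACA; exact: augD.
- by rewrite -epureZ -kscaleAr kscaleAl; apply: Ey.
- have -> : epure a (y * u) = ur * epure a y by rewrite epureM mul1r.
  apply: step (Ey a) _ (mulrA _ _ _).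
  rewrite -opprB -mulrBl; apply: augN.
  have -> : (ul - ur) * epi 0 = epi 1 * (ul - ur).
    by rewrite mulrBl mulrBr -(add0r 1) epi_ul epi_ur.
  exact: augM.
- have -> : epure a (y * d) = dr * epure a y by rewrite epureM mul1r.
  apply: step (Ey a) _ (mulrA _ _ _).
  rewrite -opprB -mulrBl; apply: augN.
  have -> : (dl - dr) * epi 0 = epi (-1) * (dl - dr).
    by rewrite mulrBl mulrBr epi_dl epi_dr.
  exact: augM.
have -> : epure a (y * e i) = epure 1 (e i) * epure a y by rewrite epureM mul1r.
apply: step (Ey a) _ (mulrA _ _ _).
by rewrite epi_e subrr; exists 0, 0; rewrite !mul0r addr0.
Qed.

Lemma augmentation_kernel (r : R) : r *: (1 : diag A) = 0 ->
  exists y y', r * epi 0 = y * (ul - ur) + y' * (dl - dr).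
Proof.
move=> r1; suff : aug (r * epi 0 - epure (r *: (1 : diag A)) 1 * epi 0).
  by rewrite r1 epure0l mul0r subr0.
elim/env_ind: (r) => [|x y hx hy|a b].
- by rewrite scale0r epure0l !mul0r subrr; exists 0, 0; rewrite !mul0r addr0.
- rewrite scalerDl epureDl !mulrDl opprD addrACA; exact: augD.
by rewrite [_ *: _]diag_scale_pure mulr1; apply: aug_pure.
Qed.

End Exactness.

(** * Exactness of the transposed complex *)

Section DualExactness.
Variables (k : fieldType) (n : nat) (A : pbw_algebra k n).
Local Notation R := (env A).
Local Notation ul := (ul A).
Local Notation dl := (dl A).
Local Notation wl := (wl A).
Local Notation ur := (ur A).
Local Notation dr := (dr A).
Local Notation wr := (wr A).
Local Notation Dm := (Dm A).
Local Notation T := (@tau k n A 0 1).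
Local Notation Tm := (@tau_mx k n A 0 1 _ _).
Local Notation T' := (@tau_mx k n A (-1) 0 _ _).

Ltac er := ncring [:: ul; dl; wl; ur; dr; wr] (env_ok A).

Let T_wl : T wl = wr.
Proof. rewrite wlE wrE !(tauD, tauM) !(tau_ul, tau_dl); er. Qed.

Let T_wr : T wr = wl.
Proof. rewrite wlE wrE !(tauD, tauM) !(tau_ur, tau_dr); er. Qed.

(** Duality pairs generators whose degrees add up to 7 and whose weights add up to 1. This reverses
    the two generators in homological degree 2 and keeps the order between degrees 1 and 3. *)
Let swap : 'M[R]_2 := \matrix_(a, b) if a == b then 0 else 1.

Let swapK : swap *m swap = 1%:M.
Proof.
apply/matrixP; case=> [[|[|a]] ia] [[|[|b]] ib] //;
  rewrite !mxE !big_ord_recl big_ord0 !mxE /= !(mul0r, mulr0, mulr1, add0r, addr0) //.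
Qed.

Let T_cancel p q (M : 'M[R]_(p, q)) : Tm (T' M) = M.
Proof. exact: (@tau_mxK k n A (-1) 0). Qed.

Local Ltac dual := apply/matrixP;
  case=> [[|[|a]] ia] [[|[|b]] ib] //; rewrite !mxE ?big_ord_recl ?big_ord0 ?mxE /=
   !(tauD, tauM, tauN) !(tau_ul, tau_dl, tau_ur, tau_dr, T_wl, T_wr)
    ?(mul0r, mulr0, mulr1, mul1r, add0r, addr0);
  er.

Lemma tau_Dm0 : Tm (Dm 0) = - Dm 3.
Proof. dual. Qed.

Lemma tau_Dm3 : Tm (Dm 3) = - Dm 0.
Proof. dual. Qed.

Lemma tau_Dm1 : Tm (Dm 1) = Dm 2 *m swap.
Proof. dual. Qed.

Lemma tau_Dm2 : Tm (Dm 2) = swap *m Dm 1.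
Proof. dual. Qed.

Lemma Dm0_col_inj (c : 'cV[R]_(rk 0)) : Dm 0 *m c = 0 -> c = 0.
Proof.
move=> /(congr1 (fun M => Tm M)); rewrite tau_mxM tau_Dm0 tau_mx0 mulmxN.
move=> /(congr1 -%R); rewrite opprK oppr0 => /(@Dm_exact _ _ A 3)[y Ey].
have c0 : Tm c = 0 by rewrite Ey; apply/rowP => b; rewrite !mxE big_ord0.
by rewrite -[c](tau_mxK 0 1) c0 tau_mx0.
Qed.

Lemma col_of_dual p q (c : 'cV[R]_p) (N : 'M[R]_(p, q)) y : Tm c = y *m Tm N ->
  exists c', c = N *m c'.
Proof.
move=> Ec; exists (T' y); apply: (can_inj (@tau_mxK k n A 0 1 _ _)).
by rewrite tau_mxM T_cancel.
Qed.

(** [Tm] turns a column cocycle into a row cycle of the complementary differential, where [Dm_exact]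
    applies, and [col_of_dual] translates the preimage back. The excluded j = 3 is the place where
    cohomology survives. *)
Lemma Dm_col_exact j (c : 'cV[R]_(rk j.+1)) : j != 3 -> Dm j.+1 *m c = 0 ->
  exists c', c = Dm j *m c'.
Proof.
have T_eq p q (M : 'M[R]_(p, q)) c' : M *m c' = 0 -> Tm c' *m Tm M = 0.
  by move=> Mc; rewrite -tau_mxM Mc tau_mx0.
case: j c => [|[|[|[|j]]]] c // _.
- move/T_eq; rewrite tau_Dm1 => /(congr1 (mulmxr swap)).
  rewrite /= mul0mx -!mulmxA swapK mulmx1 => /(@Dm_exact _ _ A 2)[y Ey].
  by apply: (@col_of_dual _ _ c (Dm 0) (- y)); rewrite tau_Dm0 mulNmx mulmxN opprK.
- move/T_eq; rewrite tau_Dm2 mulmxA => /(@Dm_exact _ _ A 1)[y Ey].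
  apply: (@col_of_dual _ _ c (Dm 1) y); rewrite tau_Dm1 mulmxA -Ey.
  by rewrite -(mulmxA (Tm c)) swapK mulmx1.
- move/T_eq; rewrite tau_Dm3 mulmxN => /(congr1 -%R).
  rewrite opprK oppr0 => /(@Dm_exact _ _ A 0)[y Ey].
  apply: (@col_of_dual _ _ c (Dm 2) (y *m swap)).
  by rewrite tau_Dm2 mulmxA -(mulmxA y) swapK mulmx1.
by exists 0; apply/colP; case.
Qed.

End DualExactness.

(** * Twisted bimodules and the Calabi--Yau property *)

Section TwistedBimodule.
Variables (k : fieldType) (n : nat) (A : pbw_algebra k n).
Local Notation R := (env A).
Local Notation ed := (env_deg (@gr k n A)).
Local Notation nu := (@rot_aut k n A).
Local Notation kbal := (balanced (fun (a : A) (c : k) => kscale c a)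
  (fun (c : k) (b : A) => kscale c b)).

(** One copy of A for each [m], to carry its own module structure. *)
Definition twmod (m : int) : Type := A.

Section Twist.
Variable m : int.
Local Notation twmod := (twmod m).

HB.instance Definition _ := GRing.Zmodule.on twmod.

Definition tw_scale (r : R) (x : twmod) : twmod :=
  tlift (fun a b : A => a * (x : A) * nu m b) r.

Lemma tw_balanced (x : A) : kbal (fun a b : A => a * x * nu m b).
Proof.
split=> [a a' b|a b b'|a c b]; first by rewrite !mulrDl.
  by rewrite nuD mulrDr.
by rewrite nuZ -!kscaleAl -kscaleAr.
Qed.

Lemma tw_scale_pure a b (x : twmod) : tw_scale (epure a b) x = a * (x : A) * nu m b.
Proof. exact: (tlift_pure _ _ (tw_balanced x)). Qed.

Lemma tw_scaleDl x : {morph tw_scale^~ x : r s / r + s}.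
Proof. by move=> r s; apply: (tliftD (tw_balanced x)). Qed.

Lemma tw_scaleDr : right_distributive tw_scale +%R.
Proof.
move=> r x y; rewrite /tw_scale -tlift_addf; apply: tlift_ext => a b.
by rewrite mulrDr mulrDl.
Qed.

Lemma tw_scale0l x : tw_scale 0 x = 0.
Proof. by apply: (addIr (tw_scale 0 x)); rewrite -tw_scaleDl !add0r. Qed.

Lemma tw_scale0r r : tw_scale r 0 = 0.
Proof. by apply: (addIr (tw_scale r 0)); rewrite -tw_scaleDr !add0r. Qed.

Lemma tw_scaleA r s x : tw_scale r (tw_scale s x) = tw_scale (r * s) x.
Proof.
elim/env_ind: r => [|r r' Er Er'|a b].
- by rewrite mul0r !tw_scale0l.
- by rewrite mulrDl !tw_scaleDl Er Er'.
elim/env_ind: s => [|r r' Er Er'|a' b'].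
- by rewrite mulr0 !tw_scale0l tw_scale0r.
- by rewrite mulrDr !tw_scaleDl tw_scaleDr Er Er'.
by rewrite epureM !tw_scale_pure nuM !mulrA.
Qed.

Lemma tw_scale1 : left_id 1 tw_scale.
Proof. by move=> x; rewrite [1]/(epure 1 1) tw_scale_pure nu1 mul1r mulr1. Qed.

HB.instance Definition _ := GRing.Zmodule_isLmodule.Build R twmod
  tw_scaleA tw_scale1 tw_scaleDr tw_scaleDl.

End Twist.

Lemma env_deg_lift (V : zmodType) (gV : int -> V -> Prop) (f : R -> V) j t r :
  (forall i, gV i 0) -> (forall i x y, gV i x -> gV i y -> gV i (x + y)) ->
  {morph f : r s / r + s} ->
  (forall p q a b, gr p a -> gr q b -> gV (p + q + j) (f (epure a b))) ->
  ed t r -> gV (t + j) (f r).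
Proof.
move=> gV0 gVD fD hf [h [a [b [p [q [hab ->]]]]]].
have f0 : f 0 = 0 by apply: (addIr (f 0)); rewrite -fD !add0r.
rewrite (big_morph f fD f0); elim/big_rec: _ => [|l x _ hx]; first exact: gV0.
by apply: gVD hx; have [ga gb <-] := hab l; apply: hf.
Qed.

Lemma diag_deg i j (r : R) (x : diag A) : ed i r -> gr j (x : A) -> gr (i + j) (r *: x : A).
Proof.
move=> hr hx; apply: (@env_deg_lift A (@gr k n A) (fun r => r *: x) _ _ _ _ _ _ _ hr).
- exact: gr0.
- by move=> ? ? ?; apply: grD.
- exact: (@diag_scaleDl k A x).
move=> p q a b ha hb; rewrite [_ *: _]diag_scale_pure addrAC.
by apply: grM hb; apply: grM.
Qed.

Section GradedTwist.
Variables (m s : int).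

Definition tw_deg (j : int) (x : twmod m) : Prop := gr (j + s) (x : A).

Lemma tw_graded : graded_module ed tw_deg.
Proof.
split; last first.
  move=> i j r x hr hx; rewrite /tw_deg -addrA.
  apply: (@env_deg_lift A (@gr k n A) (fun r => tw_scale r x) _ _ _ _ _ _ _ hr).
  - exact: gr0.
  - by move=> ? ? ?; apply: grD.
  - by move=> r1 r2; apply: tw_scaleDl.
  move=> p q a b ha hb; rewrite tw_scale_pure addrAC.
  by apply: grM (nu_gr m hb); apply: grM.
have [G0 GB Gs Gu] := gr_grading A; split.
- by move=> j; apply: G0.
- by move=> j x y; apply: GB.
- move=> x; have [S [f [hf Ex]]] := Gs x.
  exists [seq j - s | j <- S], (fun j => f (j + s)); split=> [j|]; first exact: hf.
  by rewrite big_map {1}Ex; apply: eq_bigr => j _; rewrite subrK.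
move=> S f uS hf f0 j jS.
have := Gu [seq i + s | i <- S] (fun i => f (i - s)).
rewrite map_inj_uniq; last exact: addIr.
move=> /(_ uS) H; rewrite -[j](addrK s); apply: H; last exact: map_f.
  by move=> i; have := hf (i - s); rewrite /tw_deg subrK.
by rewrite big_map -[RHS]f0; apply: eq_bigr => i _; rewrite addrK.
Qed.

Definition twisted : grmod ed := GrMod tw_graded.

End GradedTwist.

(** The map sending x (x) y to x nu^m(y) is balanced, and x is sent back to x (x) 1. *)
Lemma twisted_tensor m m' s s' : m + m' = 0 -> s + s' = 0 ->
  tensor_iso_unit (twisted m s) (twisted m' s').
Proof.
move=> mm ss; pose f (x : twisted m s) (y : twisted m' s') : A := (x : A) * nu m (y : A).
have lE a (x : twisted m' s') : lact a x = a * (x : A) :> A.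
  by rewrite /lact [_ *: _]tw_scale_pure nu1 mulr1.
have rE l t (x : twisted l t) b : ract x b = (x : A) * nu l b :> A.
  by rewrite /ract [_ *: _]tw_scale_pure mul1r.
have l'E a (x : twisted m s) : lact a x = a * (x : A) :> A.
  by rewrite /lact [_ *: _]tw_scale_pure nu1 mulr1.
have fb : balanced (@ract _ A (twisted m s)) (@lact _ A (twisted m' s')) f.
  split=> [x x' y|x y y'|x b y]; rewrite /f.
  - exact: mulrDl.
  - by rewrite nuD mulrDr.
  by rewrite rE lE nuM mulrA.
exists (tlift f); split.
- exact: tliftD.
- have [pD _ pZ] := @pure_balanced _ _ _ (@ract _ A (twisted m s)) (@lact _ A (twisted m' s')).
  exists (fun x : A => pure _ _ (x : twisted m s) (1 : A)) => [t|x]; last first.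
    by rewrite tlift_pure // /f nu1 mulr1.
  elim/tens_ind: t => [|x y Ex Ey|x y].
  + rewrite tlift0 //; apply: (addIr (pure _ _ (0 : twisted m s) (1 : A))).
    by rewrite -pD !add0r.
  + by rewrite tliftD // pD Ex Ey.
  rewrite tlift_pure //.
  have -> : f x y = ract x (y : A) :> A by rewrite rE.
  by rewrite pZ; congr pure; rewrite lE mulr1.
- move=> a b x y; rewrite !tlift_pure // /f l'E rE nuM nu_nu mm nu_0 !mulrA.
  by [].
move=> i j x y hx hy; rewrite tlift_pure //.
have -> : i + j = i + s + (j + s') by rewrite addrACA ss addr0.
by apply: grM => //; apply: nu_gr.
Qed.

Lemma twisted_invertible m s : invertible_bimodule (twisted m s).
Proof.
exists (twisted (- m) (- s)); split; apply: twisted_tensor;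
  by rewrite ?subrr ?addNr.
Qed.

End TwistedBimodule.

(** * The Ext groups and the dualizing bimodule *)

Section CalabiYau.
Variables (k : fieldType) (n : nat) (A : pbw_algebra k n).
Local Notation R := (env A).
Local Notation ed := (env_deg (@gr k n A)).
Local Notation L := (diag A).
Local Notation gL := (@gr k n A : int -> diag A -> Prop).
Local Notation Dm := (Dm A).
Local Notation Em := (Em A).
Local Notation epi := (epi A).
Local Notation T := (@tau k n A 0 1).
Local Notation Tm := (@tau_mx k n A 0 1 _ _).

Let g (_ : 'I_(rk 0)) : L := (1 : A).

Let sum_rk0 (F : 'I_(rk 0) -> L) : \sum_a F a = F 0.
Proof. exact: big_ord1. Qed.

Let epi0_1 : epi 0 *: (1 : L) = 1 :> A.
Proof.
rewrite /epi scaler_suml -[RHS](ge_sum A); apply: eq_bigr => i _.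
by rewrite [LHS]diag_scale_pure mulr1 cshift0 ge_ge eqxx.
Qed.

Let gE a : \sum_b Em 0 a b *: g b = g a.
Proof. by rewrite sum_rk0 mxE (ord1 a) eqxx; apply: epi0_1. Qed.

Let ul1 : (ul A - ur A) *: (1 : L) = 0.
Proof. by rewrite scalerBl ![_ *: _]diag_scale_pure !mulr1 mul1r subrr. Qed.

Let dl1 : (dl A - dr A) *: (1 : L) = 0.
Proof. by rewrite scalerBl ![_ *: _]diag_scale_pure !mulr1 mul1r subrr. Qed.

Let gD a : \sum_b Dm 0 a b *: g b = 0.
Proof. by rewrite sum_rk0 mxE; case: a => [[|[|a]] ia]. Qed.

Let g_surj (y : L) : exists x : 'rV[R]_(rk 0), y = \sum_a x 0 a *: g a.
Proof.
exists (const_mx (epure (y : A) 1)); rewrite sum_rk0 mxE.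
by rewrite [RHS]diag_scale_pure !mulr1.
Qed.

Let aug_exact (r : 'rV[R]_(rk 0)) : r 0 0 *: (1 : L) = 0 -> r 0 0 * epi 0 = r 0 0 ->
  exists y, r = y *m Dm 0.
Proof.
move=> /augmentation_kernel[y [y' Er]] r0.
exists (\row_(a < rk 1) if a == 0 then y else y'); apply/rowP => a.
rewrite (ord1 a) -r0 Er mxE; rewrite (big_ord_recl 1) big_ord1 !mxE /=.
by [].
Qed.

Let g_ex (x : 'rV[R]_(rk 0)) : x *m Em 0 = x -> \sum_a x 0 a *: g a = 0 ->
  exists y, x = y *m Dm 0.
Proof.
move=> /rowP/(_ 0); rewrite sum_rk0 mxE big_ord1 !mxE eqxx => Ex x1.
exact: aug_exact.
Qed.

Let hg a : gL (@gdeg 0 a) (g a).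
Proof. by rewrite (ord1 a); apply: gr1. Qed.

Let gR := env_grading A.
Let gM := @env_degM k n A.
Let gLG : is_grading gL := gr_grading A.
Let gLM i j c (x : L) : ed i c -> gL j x -> gL (i + j) (c *: x).
Proof. exact: diag_deg. Qed.

Let res : resolution ed gL := idem_resolution gR (env_deg1 A) gM
  (@Em_idem k n A) (@Em_hom k n A) (@Em_Dm k n A) (@Dm_hom k n A) (@Dm_Dm k n A)
  (@Dm_exact k n A) gLG gLM hg gE gD g_surj g_ex.

Let res_finite : finite_fg_resolution res.
Proof.
have r0 j : (5 <= j)%N -> rk j = 0%N by case: j => [|[|[|[|[|j]]]]].
exact: idem_resolution_finite r0.
Qed.

Let Ext_vanish i : i != 4 -> Ext_zero ed gL i.
Proof.
case: i => [_|i i4].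
  apply: (idem_Ext_zero0 gR (env_deg1 A) gM
    (@Em_idem k n A) (@Em_hom k n A) (@Em_Dm k n A) (@Dm_hom k n A) (@Dm_Dm k n A)
    (@Dm_exact k n A) gLG gLM hg gE gD g_surj g_ex).
  exact: Dm0_col_inj.
apply: (idem_Ext_zero gR (env_deg1 A) gM
    (@Em_idem k n A) (@Em_hom k n A) (@Em_Dm k n A) (@Dm_hom k n A) (@Dm_Dm k n A)
    (@Dm_exact k n A) gLG gLM hg gE gD g_surj g_ex) => c.
exact: Dm_col_exact.
Qed.

(** The generator of the last term has degree 7, so a cochain of degree t takes it to degree t + 7;
    the twist by one rotation comes from [T]. *)
Let U := twisted A 1 7.

(** [T] carries the cokernel of the transposed last differential to that of the first one, which on
    the [epi 0] part is A. On a (x) b the value is b nu(a). *)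
Let psi (c : 'cV[R]_(rk 4)) : U := T (c 0 0) *: (1 : L).

Let swap_balanced : balanced (fun (a : A) (c : k) => kscale c a)
  (fun (c : k) (b : A) => kscale c b) (fun a b : A => epure b a).
Proof.
by split=> [a a' b|a b b'|a c b]; rewrite ?epureDr ?epureDl // epureZ.
Qed.

(** Both sides give b x nu(a) for a (x) b: the rotation inside [T] becomes the twist of [U]. *)
Let tau_swap (b : R) (x : A) : T b *: (x : L) = env_swap b *: (x : U) :> A.
Proof.
elim/env_ind: b => [|b b' E E'|a b].
- by rewrite tau0 /env_swap tlift0 // !scale0r.
- by rewrite tauD /env_swap tliftD // !scalerDl E E'.
rewrite tau_pure nu_0 /env_swap tlift_pure //.
by rewrite [LHS]diag_scale_pure [RHS]tw_scale_pure.
Qed.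

Let psiD : {morph psi : c c' / c + c'}.
Proof. by move=> c c'; rewrite /psi mxE tauD scalerDl. Qed.

Let psiM c b : psi (c *m b%:M) = env_ract (psi c) b.
Proof.
rewrite /psi mxE big_ord1 !mxE eqxx mulr1n tauM -scalerA.
exact: tau_swap.
Qed.

Let tau_epi1 : T (epi 1) = epi 0.
Proof.
rewrite /epi tau_sum [RHS](reindex_inj (can_inj (@ordSK n))).
by apply: eq_bigr => i _; rewrite tau_pure nu_0 nu_ge.
Qed.

Let Em4 (c : 'cV[R]_(rk 4)) : (Em 4 *m c) 0 0 = epi 1 * c 0 0.
Proof. by rewrite mxE big_ord1 mxE. Qed.

Let col4 (c c' : 'cV[R]_(rk 4)) : c 0 0 = c' 0 0 -> c = c'.
Proof. by move=> E; apply/colP => a; rewrite (ord1 a). Qed.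

Let psi_surj (x : U) : exists c, [/\ Em 4 *m c = c, Dm 4 *m c = 0 & psi c = x].
Proof.
(* The preimage of x (x) 1 under [T]. It is then cut by [epi 1] to be fixed by [Em 4]; [T] turns
   this cut into [epi 0], which fixes 1. *)
pose r : R := @tau k n A (-1) 0 (epure (x : A) 1).
have Tr : T r = epure (x : A) 1 by exact: (@tauK k n A (-1) 0).
exists (const_mx (epi 1 * r)); split.
- by apply: col4; rewrite Em4 !mxE mulrA epi_idem.
- by apply/colP; case.
rewrite /psi mxE tauM tau_epi1 Tr -scalerA.
by rewrite epi0_1 [LHS]diag_scale_pure !mulr1.
Qed.

Let psi_ker (c : 'cV[R]_(rk 4)) : Em 4 *m c = c -> Dm 4 *m c = 0 ->
  psi c = 0 <-> exists c', c = Dm 3 *m c'.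
Proof.
move=> Ec _; split=> [psi0|[c' ->]].
  have [||y Ey] := aug_exact (r := Tm c); rewrite ?mxE //.
    by rewrite -tau_epi1 -tauM -Em4 Ec.
  apply: (@col_of_dual k n A _ _ c (Dm 3) (- y)).
  by rewrite tau_Dm3 mulNmx mulmxN opprK.
rewrite /psi.
have -> : T ((Dm 3 *m c') 0 0) = (Tm c' *m - Dm 0) 0 0.
  by rewrite -tau_Dm3 -tau_mxM [RHS]mxE.
rewrite mulmxN mxE mxE scaleNr scaler_suml big1 ?oppr0 // => a _.
rewrite -scalerA; have := gD a; rewrite sum_rk0 => ->; exact: scaler0.
Qed.

Let psi_deg t (c : 'cV[R]_(rk 4)) : (forall a, ed (@gdeg 4 a + t) (c a 0)) ->
  grdeg U t (psi c).
Proof.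
move=> hc; rewrite /= /tw_deg [t + 7]addrC -[X in gr X]addr0.
by apply: diag_deg (gr1 A); apply: tau_deg; exact: (hc 0).
Qed.

Let Ext4 : Ext_iso ed gL 4 (@env_ract k A U) (grdeg U).
Proof.
exact: (idem_Ext_iso gR (env_deg1 A) gM
    (@Em_idem k n A) (@Em_hom k n A) (@Em_Dm k n A) (@Dm_hom k n A) (@Dm_Dm k n A)
    (@Dm_exact k n A) gLG gLM hg gE gD g_surj g_ex
    psiD psiM psi_surj psi_ker psi_deg).
Qed.

Theorem pbw_algebra_CY : twisted_graded_CY (@gr k n A) 4.
Proof.
split; last by exists U; split; [exact: twisted_invertible | exact: Ext4 | exact: Ext_vanish].
  by split; [exact: gr_grading | exact: gr1 | exact: grM | exact: grZ].
by exists res.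
Qed.

End CalabiYau.

Theorem proposition6p12 (k : closedFieldType) (char0 : [pchar k]%R =i pred0)
    (n : nat) (hn : (1 <= n)%N) :
  @twisted_graded_CY k (algD k n) (@algD_deg k n) 4.
Proof.
(* The square root of -1 needed for [z]: a root of X^2 = -1, whose right-hand side has -1 as its
   only nonzero coefficient. *)
have [I] := @solve_monicpoly k 2 (fun i => if i == 0 then -1 else 0) isT.
rewrite !big_ord_recl big_ord0 /= !mulr1 mul0r !addr0 => II.
exact: (pbw_algebra_CY (algD_pbw n II)).
Qed.
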